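(* Let $G$ be a second countable compact Hausdorff group with normalized Haar measure $\mu$, and fix a bi-invariant metric $d$ on $G$ which metrizes its topology. Let $X_1, X_2, \dots$ be a sequence of i.i.d. $G$-valued random variables with distribution $\nu$, and set $S_k = X_1 X_2 \cdots X_k$. Let $0<p\le 1$, and assume that $\sum_{k=1}^{\infty} W_p(\nu^{*k},\mu)<\infty$. Then for any $p$-H\''older function $f:G\to\mathbb{R}$ such that $\int_G f\,\mathrm{d}\mu=0$, there exists a constant $0\le\sigma<\infty$ depending only on $f$ and $\nu$ such that the central limit theorem $$\frac{\sum_{k=1}^N f(S_k)}{\sqrt{N}} \overset{d}{\to} \mathcal{N}(0,\sigma^2)\qquad (N\to\infty)$$ and the law of the iterated logarithm $$\limsup_{N\to\infty}\frac{\sum_{k=1}^N f(S_k)}{\sqrt{2N\log\log N}}=\sigma\qquad\text{almost surely}$$ both hold.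
   Context: A metric $d$ on a group $G$ is bi-invariant if $d(ax,ay)=d(xa,ya)=d(x,y)$ for all $x,y,a\in G$. A $G$-valued random variable is a Borel measurable map from a probability space to $G$. $\nu^{*k}$ denotes the $k$-fold convolution of the Borel probability measure $\nu$ on $G$ (the distribution of $S_k$). A function $f:G\to\mathbb{R}$ is $p$-H\''older if there is $K\ge 0$ with $|f(x)-f(y)|\le K d(x,y)^p$ for all $x,y\in G$. For $0<p\le 1$ and Borel probability measures $\nu_1,\nu_2$ on $G$, $W_p(\nu_1,\nu_2)=\inf_{\vartheta}\int_{G\times G} d(x,y)^p\,\mathrm{d}\vartheta(x,y)$, where the infimum is over all Borel probability measures $\vartheta$ on $G\times G$ with marginals $\nu_1$ and $\nu_2$ (no exponent $1/p$). The same metric $d$ is used in the definitions of $W_p$ and of $p$-H\''older functions. $\overset{d}{\to}$ denotes convergence in distribution, and $\mathcal{N}(0,\sigma^2)$ is the normal distribution with mean $0$ and variance $\sigma^2$ (the constant $0$ if $\sigma=0$). *)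

(* Defs.v *)
From HB Require Import structures.
From mathcomp Require Import all_boot all_order all_algebra finmap.
From mathcomp Require Import all_classical all_reals all_analysis.

Set Implicit Arguments.
Unset Strict Implicit.
Unset Printing Implicit Defensive.

Import Order.TTheory GRing.Theory Num.Theory.
Import numFieldNormedType.Exports.

Local Open Scope classical_set_scope.
Local Open Scope ring_scope.

HB.structure Definition PreTopologicalGroup := {G of Topological G & Group G}.

HB.mixin Record PreTopologicalGroup_isTopologicalGroup G
    of PreTopologicalGroup G := {
  mulg_continuous : continuous (fun x : G * G => (x.1 * x.2)%g) ;
  invg_continuous : continuous (fun x : G => (x^-1)%g) }.

#[short(type="topologicalGroupType")]
HB.structure Definition TopologicalGroup :=
  {G of PreTopologicalGroup G & PreTopologicalGroup_isTopologicalGroup G}.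

(* An alias of [G] equipped with the Borel sigma-algebra of [G]. *)
Definition borel (G : topologicalGroupType) : Type := G.

Section borel_instances.
Context {G : topologicalGroupType}.

HB.instance Definition _ := TopologicalGroup.on (borel G).
HB.instance Definition _ := isPointed.Build (borel G) 1%g.
HB.instance Definition _ := @isMeasurable.Build (sigma_display (@open (borel G)))
  (borel G) <<s @open (borel G) >>
  (@sigma_algebra0 _ setT (@open (borel G))) (@sigma_algebraC _ (@open (borel G)))
  (@sigma_algebra_bigcup _ setT (@open (borel G))).

End borel_instances.

Section mulg_measurable.
Context {G : topologicalGroupType} (hG : @second_countable G).

(* By second countability, every open subset of [G * G] belongs to the product
   of the Borel sigma-algebras, which is therefore the Borel sigma-algebra of
   [G * G]. *)
Lemma open_measurable_prod (U : set (G * G)) :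
  open U -> measurable (U : set (borel G * borel G)).
Proof.
move=> oU; case: hG => B cB [Bopen Bbasis].
pose D := [set b : set G * set G | [/\ B b.1, B b.2 & b.1 `*` b.2 `<=` U]].
have -> : U = \bigcup_(b in D) (b.1 `*` b.2).
  apply/seteqP; split => [[x y] Uxy|z [b [_ _ bU] /bU//]].
  have [[V W] /= [nV nW] VWU] : nbhs (x, y) U by exact: open_nbhs_nbhs.
  have [V' [BV' V'x] V'V] := Bbasis x V nV.
  have [W' [BW' W'y] W'W] := Bbasis y W nW.
  exists (V', W') => //; split => //= -[a b] [/= /V'V ? /W'W ?].
  exact: VWU.
have cD : countable D.
  apply: (@sub_countable _ _ _ (B `*` B)); last exact: countableX.
  by apply: subset_card_le => b [].
rewrite bigcup_set_type; apply: countable_bigcupT_measurable => [|[b bD]].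
  by rewrite (eq_countable (card_setT D)).
have [b1 b2 _] := set_mem bD.
by apply: measurableX; apply: sub_sigma_algebra; exact: Bopen.
Qed.

Lemma measurable_mulg :
  measurable_fun setT (fun x : borel G * borel G => (x.1 * x.2)%g : borel G).
Proof.
apply: (measurability (@open (borel G))) => // _ [U oU <-].
rewrite setTI; apply: open_measurable_prod.
by apply: open_comp => // x _; exact: mulg_continuous.
Qed.

End mulg_measurable.

Section convolution.
Context {R : realType} {G : topologicalGroupType} (hG : @second_countable G).

Definition mulg_mfun : {mfun (borel G * borel G)%type >-> borel G} :=
  mfun_Sub (mem_set (measurable_mulg hG)).

Definition convolution (nu1 nu2 : probability (borel G) R) :
    probability (borel G) R :=
  distribution (nu1 \x nu2)%E mulg_mfun.

Fixpoint convolution_pow (nu : probability (borel G) R) (k : nat) :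
    probability (borel G) R :=
  if k is k'.+1 then convolution (convolution_pow nu k') nu
  else dirac (1%g : borel G).

End convolution.

Section metrics.
Context {R : realType}.

Record is_metric (T : Type) (d : T -> T -> R) : Prop := IsMetric {
  metric_ge0 : forall x y, 0 <= d x y ;
  metric_eq0 : forall x y, d x y = 0 <-> x = y ;
  metric_symmetric : forall x y, d x y = d y x ;
  metric_triangular : forall x y z, d x z <= d x y + d y z }.

Definition metrizes (T : topologicalType) (d : T -> T -> R) : Prop :=
  forall (x : T) (A : set T),
    nbhs x A <-> exists2 e : R, 0 < e & [set y | d x y < e] `<=` A.

Definition bi_invariant (G : groupType) (d : G -> G -> R) : Prop :=
  forall x y a : G, d (a * x)%g (a * y)%g = d x y /\ d (x * a)%g (y * a)%g = d x y.

Definition holder (T : Type) (d : T -> T -> R) (p : R) (f : T -> R) : Prop :=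
  exists2 K : R, 0 <= K & forall x y, `|f x - f y| <= K * d x y `^ p.

End metrics.

Section group_measures.
Context {R : realType} {G : topologicalGroupType}.

(* On a compact group, Haar measure is also right-invariant; on a second
   countable one, every Borel probability measure is regular. *)
Definition normalized_haar (mu : probability (borel G) R) : Prop :=
  forall (a : G) (A : set (borel G)), measurable A ->
    mu [set (a * x)%g | x in A] = mu A.

Definition coupling (nu1 nu2 : probability (borel G) R)
    (theta : probability (borel G * borel G)%type R) : Prop :=
  forall A : set (borel G), measurable A ->
    theta (A `*` setT) = nu1 A /\ theta (setT `*` A) = nu2 A.

Definition wasserstein (d : G -> G -> R) (p : R)
    (nu1 nu2 : probability (borel G) R) : \bar R :=
  ereal_inf [set (\int[theta]_z (d z.1 z.2 `^ p)%:E)%E | theta in coupling nu1 nu2].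

End group_measures.

Section random_variables.
Context {R : realType} {dO : measure_display} {Omega : measurableType dO}.
Variable P : probability Omega R.

Definition mutually_independent {dT} {T : measurableType dT} {I : choiceType}
    (X : I -> {RV P >-> T}) : Prop :=
  forall (J : {fset I}) (A : I -> set T), (forall i, measurable (A i)) ->
    P (\bigcap_(i in [set` J]) (X i @^-1` A i)) =
    (\prod_(i <- J) P (X i @^-1` A i))%E.

Definition iid {dT} {T : measurableType dT} {I : choiceType}
    (X : I -> {RV P >-> T}) (nu : probability T R) : Prop :=
  mutually_independent X /\
  forall i (A : set T), measurable A -> distribution P (X i) A = nu A.

Definition cvg_in_distribution (Y : nat -> Omega -> R)
    (m : probability (measurableTypeR R) R) : Prop :=
  forall g : R -> R, continuous g -> bounded_fun g ->
    (\int[P]_w (g (Y n w))%:E)%E @[n --> \oo] --> (\int[m]_x (g x)%:E)%E.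

End random_variables.

(* [normal_prob 0 0] is the uniform distribution on [0, 1]. *)
Definition centered_normal {R : realType} (sigma : R) :
    probability (measurableTypeR R) R :=
  if sigma == 0 then (dirac (0 : measurableTypeR R) : probability _ R)
  else (normal_prob 0 sigma : probability _ R).

(* The sequence is indexed from 0: [X i] is the (i+1)-th increment, so
   [random_walk X k] is the product of the first [k] increments. *)
Definition random_walk {Omega : Type} {G : groupType} (X : nat -> Omega -> G)
    (k : nat) (w : Omega) : G :=
  (\prod_(0 <= i < k) X i w)%g.

Definition walk_sum {R : realType} {Omega : Type} {G : groupType} (f : G -> R)
    (X : nat -> Omega -> G) (N : nat) (w : Omega) : R :=
  \sum_(1 <= k < N.+1) f (random_walk X k w).

(* Main.v *)
From HB Require Import structures.
From mathcomp Require Import all_boot all_order all_algebra finmap ring lra.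
From mathcomp Require Import all_classical all_reals all_analysis.
From mathcomp Require Import measurable_realfun.
Require Import Defs.

(** Let [U] be the operator averaging a function over one step of the walk,
    [U u x = \int[nu]_y u (x * y)], so that [U^k f x] averages [f (x * y)] against
    the [k]-th convolution power of [nu]. For a nearly optimal coupling of that
    power with [mu], invariance of [mu] and of [d] gives
    [|U^k f x - \int[mu] f| <= K * W_p], uniformly in [x] ([markov_rate]). Since
    [f] has mean zero and the Wasserstein distances are summable, the series
    [g = \sum_k U^k f] converges uniformly and solves the Poisson equation
    [g - U g = f] ([poisson_equation]). Along the walk this gives
    [f (S_1) + ... + f (S_N) = M_N + U g (1) - U g (S_N)], where [M] is the
    martingale with bounded increments [g (S_{k+1}) - U g (S_k)]
    ([walk_sum_martingale]), and the last two terms are bounded. The conditional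
    variance of an increment is a continuous function of the position of the walk,
    so its averages over many steps converge, uniformly in the starting point, to
    its integral [sigma ^ 2] against [mu] ([sum_var_increment]). It remains to prove
    both limit theorems for such martingales.

    The central limit theorem follows Lindeberg: blocks of [m] steps, over which the
    conditional variance is close to [m * sigma ^ 2], are replaced one at a time by
    Gaussians of that variance ([uniform_clt]). Test functions are those with uniform
    second-order Taylor expansions; cubic splines belong to this class and are
    rich enough for convergence in distribution ([weak_cvg_of_spline]).

    For the upper half of the law of the iterated logarithm, the same block
    decomposition bounds the exponential moments of [M] by nearly Gaussian ones
    ([exponential_moment]); with Doob's inequality and the first Borel-Cantelli
    lemma along a geometric sequence of times this gives [lil_upper]. For the lower
    half, the steps between [r ^ k] and [r ^ (k + 1)] are cut into slightly fewer
    than [2 * ln (ln (r ^ k)) / u ^ 2] blocks, with [u] large. By the central limit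
    theorem each of them gains [u] standard deviations with probability
    [expR (- u ^ 2 / 2)] to leading exponential order, whatever the past, so all of
    them do with probability at least of order [1 / k]; a conditional
    Borel-Cantelli lemma ([borel_cantelli_past]) concludes ([lil_lower]). *)

Set Implicit Arguments.
Unset Strict Implicit.
Unset Printing Implicit Defensive.

Import Order.TTheory GRing.Theory Num.Theory.
Import numFieldNormedType.Exports.

Local Open Scope classical_set_scope.
Local Open Scope ring_scope.

(** * Expectations of bounded measurable functions *)

Section bounded_measurable.
Context {R : realType}.

(** On a probability space, expectations of such functions are finite and linear
    without further hypotheses, and averaging over a parameter stays in the class. *)
Definition bounded_mfun {d} {T : measurableType d} (u : T -> R) : Prop :=
  measurable_fun setT u /\ exists B, forall x, `|u x| <= B.

Context {d} {T : measurableType d}.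
Implicit Types (u v : T -> R).

Lemma bounded_mfun_cst c : bounded_mfun (fun _ : T => c).
Proof. by split; [exact: measurable_cst|exists `|c|]. Qed.

Lemma bounded_mfunD u v : bounded_mfun u -> bounded_mfun v ->
  bounded_mfun (fun x => u x + v x).
Proof.
move=> [mu [A uA]] [mv [B vB]]; split; first exact: measurable_funD.
by exists (A + B) => x; rewrite (le_trans (ler_normD _ _))// lerD.
Qed.

Lemma bounded_mfunM u v : bounded_mfun u -> bounded_mfun v ->
  bounded_mfun (fun x => u x * v x).
Proof.
move=> [mu [A uA]] [mv [B vB]]; split; first exact: measurable_funM.
by exists (A * B) => x; rewrite normrM ler_pM.
Qed.

Lemma bounded_mfunZ c u : bounded_mfun u -> bounded_mfun (fun x => c * u x).
Proof. by move=> bu; apply: bounded_mfunM => //; exact: bounded_mfun_cst. Qed.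

Lemma bounded_mfunN u : bounded_mfun u -> bounded_mfun (fun x => - u x).
Proof.
move=> [mu [A uA]]; split; first exact: measurable_funN.
by exists A => x; rewrite normrN.
Qed.

Lemma bounded_mfunB u v : bounded_mfun u -> bounded_mfun v ->
  bounded_mfun (fun x => u x - v x).
Proof. by move=> bu bv; apply: bounded_mfunD => //; exact: bounded_mfunN. Qed.

Lemma bounded_mfun_norm u : bounded_mfun u -> bounded_mfun (fun x => `|u x|).
Proof.
move=> [mu [A uA]]; split; first exact: measurableT_comp.
by exists A => x; rewrite normr_id.
Qed.

Lemma bounded_mfun_indic (A : set T) : measurable A -> bounded_mfun (\1_A : T -> R).
Proof.
move=> mA; split; first exact: measurable_indic.
by exists 1 => x; rewrite indicE; case: (x \in A); rewrite ?normr1 ?normr0.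
Qed.

Lemma bounded_mfun_comp {d'} {T' : measurableType d'} (f : T' -> T) u :
  measurable_fun setT f -> bounded_mfun u -> bounded_mfun (fun x => u (f x)).
Proof.
move=> mf [mu [A uA]]; split; last by exists A.
exact: (measurableT_comp mu mf).
Qed.

Variable P : probability T R.

Lemma bounded_mfun_integrable u : bounded_mfun u ->
  P.-integrable setT (fun x => (u x)%:E).
Proof.
move=> [mu [A uA]]; apply: measurable_bounded_integrable => //.
  by rewrite (le_lt_trans (probability_le1 _ _))// ltry.
exists A; split; first by rewrite num_real.
by move=> M AM x _ /=; rewrite (le_trans (uA x))// ltW.
Qed.

Lemma EFin_expect u : bounded_mfun u ->
  (\int[P]_x u x)%:E = (\int[P]_x (u x)%:E)%E.
Proof.
move=> bu; rewrite /Rintegral fineK//.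
by apply: integrable_fin_num => //; exact: bounded_mfun_integrable.
Qed.

Lemma expect_cst c : \int[P]_x c = c.
Proof. rewrite Rintegral_cst//= (_ : P setT = 1%E) ?mulr1//; exact: probability_setT. Qed.

Lemma expectD u v : bounded_mfun u -> bounded_mfun v ->
  \int[P]_x (u x + v x) = \int[P]_x u x + \int[P]_x v x.
Proof. by move=> bu bv; rewrite RintegralD//; exact: bounded_mfun_integrable. Qed.

Lemma expectB u v : bounded_mfun u -> bounded_mfun v ->
  \int[P]_x (u x - v x) = \int[P]_x u x - \int[P]_x v x.
Proof. by move=> bu bv; rewrite RintegralB//; exact: bounded_mfun_integrable. Qed.

Lemma expectZ c u : bounded_mfun u -> \int[P]_x (c * u x) = c * \int[P]_x u x.
Proof. by move=> bu; rewrite RintegralZl//; exact: bounded_mfun_integrable. Qed.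

Lemma expect_le u v : bounded_mfun u -> bounded_mfun v ->
  (forall x, u x <= v x) -> \int[P]_x u x <= \int[P]_x v x.
Proof.
by move=> bu bv uv; apply: le_Rintegral => //; exact: bounded_mfun_integrable.
Qed.

Lemma expect_norm_le u c : bounded_mfun u -> (forall x, `|u x| <= c) ->
  `|\int[P]_x u x| <= c.
Proof.
move=> bu uc.
have := expect_le bu (bounded_mfun_cst c) (fun x => le_trans (ler_norm _) (uc x)).
have := expect_le (bounded_mfun_cst (- c)) bu _.
rewrite !expect_cst ler_norml => -> // x.
by have := uc x; rewrite ler_norml => /andP[].
Qed.

Lemma expect_dist_le u v c : bounded_mfun u -> bounded_mfun v ->
  (forall x, `|u x - v x| <= c) ->
  `|\int[P]_x u x - \int[P]_x v x| <= c.
Proof.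
by move=> bu bv uv; rewrite -expectB//; apply: expect_norm_le => //; exact: bounded_mfunB.
Qed.

Lemma expect_sum {I : Type} (s : seq I) (F : I -> T -> R) :
  (forall i, bounded_mfun (F i)) ->
  bounded_mfun (fun x => \sum_(i <- s) F i x) /\
  \int[P]_x (\sum_(i <- s) F i x) = \sum_(i <- s) \int[P]_x F i x.
Proof.
move=> bF; elim: s => [|i s [IH1 IH2]].
  have -> : (fun x => \sum_(i <- [::]) F i x) = (fun=> 0).
    by apply/funext => x; rewrite big_nil.
  by rewrite big_nil expect_cst; split => //; exact: bounded_mfun_cst.
have -> : (fun x => \sum_(j <- i :: s) F j x) = (fun x => F i x + \sum_(j <- s) F j x).
  by apply/funext => x; rewrite big_cons.
by split; [exact: bounded_mfunD|rewrite expectD// IH2 big_cons].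
Qed.

End bounded_measurable.

Section parametrized_expectation.
Context {R : realType} {d d'} {T : measurableType d} {T' : measurableType d'}.
Variables (nu : probability T' R).
Implicit Type H : T * T' -> R.

Lemma bounded_mfun_section H x : bounded_mfun H -> bounded_mfun (fun y => H (x, y)).
Proof. by move=> bH; apply: (bounded_mfun_comp _ bH); exact: pair1_measurable. Qed.

Lemma measurable_expect H : measurable_fun setT H ->
  measurable_fun setT (fun x => \int[nu]_y H (x, y)).
Proof.
move=> mH; apply: measurableT_comp => //.
have mHe : measurable_fun setT (EFin \o H) by exact/measurable_EFinP.
under eq_fun do rewrite integralE.
apply: emeasurable_funB.
  have := @measurable_fun_fubini_tonelli_F _ _ _ _ R nu _
    (measurable_funepos mHe) (fun z => funepos_ge0 _ z).
  apply: eq_measurable_fun => x _; by apply: eq_integral => y _; rewrite !funeposE.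
apply: (eq_measurable_fun (fubini_F nu (EFin \o H)^\-%E)).
  by move=> x _; apply: eq_integral => y _; rewrite ?funenegE.
apply: measurable_fun_fubini_tonelli_F => //; exact: measurable_funeneg.
Qed.

Lemma bounded_mfun_expect H : bounded_mfun H ->
  bounded_mfun (fun x => \int[nu]_y H (x, y)).
Proof.
move=> bH; have [mH [A HA]] := bH; split; first exact: measurable_expect.
by exists A => x; apply: expect_norm_le => //; exact: (bounded_mfun_section x bH).
Qed.

Lemma expect_prod (mu : probability T R) H : bounded_mfun H ->
  \int[(mu \x nu)%E]_z H z = \int[mu]_x \int[nu]_y H (x, y).
Proof.
move=> bH; have bH' := bounded_mfun_expect bH.
rewrite /Rintegral; congr fine.
rewrite -integral12_prod_meas1; last first.
  exact: (bounded_mfun_integrable (mu \x nu)%E bH).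
by apply: eq_integral => x _; apply/esym/(EFin_expect nu (bounded_mfun_section x bH)).
Qed.

End parametrized_expectation.

Section distribution.
Context {R : realType} {d d'} {T : measurableType d} {T' : measurableType d'}.

Lemma expect_distribution (P : probability T R) (X : {RV P >-> T'}) (u : T' -> R) :
  bounded_mfun u -> \int[distribution P X]_y u y = \int[P]_x u (X x).
Proof.
move=> bu; rewrite /Rintegral integral_distribution//.
  by apply/measurable_EFinP; exact: bu.1.
by apply: (bounded_mfun_integrable P (bounded_mfun_comp _ bu)).
Qed.

End distribution.

(** * Additive functionals of a Markov chain *)

Section additive_functional.
Context {R : realType} {d d'} {T : measurableType d} {T' : measurableType d'}.

(** Functions of the pair (state, accumulated sum). Squares and exponentials of the
    sum are unbounded, but each step changes the sum by at most [C], so bounds on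
    bounded windows are enough for all the averages to converge. *)
Definition locally_bounded_mfun (F : T * R -> R) : Prop :=
  measurable_fun setT F /\
  forall A, exists B, forall x a, `|a| <= A -> `|F (x, a)| <= B.

Variables (nu : probability T' R) (step : T * T' -> T) (phi : T * T' -> R) (C : R).

Definition markov (u : T -> R) (x : T) : R := \int[nu]_y u (step (x, y)).

Definition cond_var (x : T) : R := \int[nu]_y (phi (x, y) ^+ 2).

(** The expected total conditional variance of [j] increments, from the state [x]. *)
Fixpoint sum_var (j : nat) (x : T) : R :=
  if j is j'.+1 then cond_var x + markov (sum_var j') x else 0.

(** One step of the chain formed by the state and the accumulated sum. Its iterates
    determine all the laws needed, so the analysis can be done before any
    probability space enters. *)
Definition transition (F : T * R -> R) (z : T * R) : R :=
  \int[nu]_y F (step (z.1, y), z.2 + phi (z.1, y)).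

Hypothesis mstep : measurable_fun setT step.
Hypothesis mphi : measurable_fun setT phi.
Hypothesis phiC : forall z, `|phi z| <= C.
Hypothesis phi0 : forall x, \int[nu]_y phi (x, y) = 0.

Implicit Types F G : T * R -> R.

Lemma locally_bounded_mfun_snd (psi : R -> R) : measurable_fun setT psi ->
  (forall A, exists B, forall a, `|a| <= A -> `|psi a| <= B) ->
  locally_bounded_mfun (fun z => psi z.2).
Proof.
move=> mpsi bpsi; split; last by move=> A; have [B HB] := bpsi A; exists B.
by apply: measurableT_comp => //; exact: measurable_snd.
Qed.

Lemma bounded_mfun_phi : bounded_mfun phi.
Proof. by split => //; exists C. Qed.

Lemma bound_ge0 (x : T) : 0 <= C.
Proof. by rewrite (le_trans _ (phiC (x, point))). Qed.

Let measurable_next :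
  measurable_fun setT (fun zy : (T * R) * T' =>
    (step (zy.1.1, zy.2), zy.1.2 + phi (zy.1.1, zy.2))).
Proof.
have m11 : measurable_fun setT (fun zy : (T * R) * T' => (zy.1.1, zy.2)).
  exact: (measurable_fun_pair
    (measurableT_comp (@measurable_fst _ _ T R) (@measurable_fst _ _ (T * R)%type T'))
    (@measurable_snd _ _ (T * R)%type T')).
apply: measurable_fun_pair => /=.
  by apply: (measurableT_comp mstep m11).
apply: measurable_funD; last exact: (measurableT_comp mphi m11).
exact: (measurableT_comp (@measurable_snd _ _ T R) (@measurable_fst _ _ (T * R)%type T')).
Qed.

Lemma bounded_mfun_next F z : locally_bounded_mfun F ->
  bounded_mfun (fun y => F (step (z.1, y), z.2 + phi (z.1, y))).
Proof.
move=> [mF bF]; split.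
  have m2 : measurable_fun setT (fun y : T' => (z, y)) by exact: pair1_measurable.
  exact: (measurableT_comp mF (measurableT_comp measurable_next m2)).
have [B HB] := bF (`|z.2| + C); exists B => y; apply: HB.
by rewrite (le_trans (ler_normD _ _))// lerD2l.
Qed.

Lemma locally_bounded_transition F : locally_bounded_mfun F ->
  locally_bounded_mfun (transition F).
Proof.
move=> lF; have [mF bF] := lF; split.
  exact: (measurable_expect nu (measurableT_comp mF measurable_next)).
move=> A; have [B HB] := bF (A + C); exists B => x a aA.
apply: expect_norm_le; first exact: (bounded_mfun_next (x, a) lF).
by move=> y; apply: HB; rewrite (le_trans (ler_normD _ _))// lerD.
Qed.

Lemma locally_bounded_iter j F : locally_bounded_mfun F ->
  locally_bounded_mfun (iter j transition F).
Proof. by move=> lF; elim: j => //= j; exact: locally_bounded_transition. Qed.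

(** A path of length [j] moves the second coordinate by at most [C * j], so only
    the values of the integrand in that window matter. *)
Lemma iter_transition_le j F G x a :
  locally_bounded_mfun F -> locally_bounded_mfun G ->
  (forall y b, `|b - a| <= C * j%:R -> F (y, b) <= G (y, b)) ->
  iter j transition F (x, a) <= iter j transition G (x, a).
Proof.
move=> lF lG; elim: j x a => [|j IH] x a FG /=.
  by apply: FG; rewrite subrr normr0 mulr0.
apply: expect_le => [||y].
- exact: (bounded_mfun_next (x, a) (locally_bounded_iter j lF)).
- exact: (bounded_mfun_next (x, a) (locally_bounded_iter j lG)).
apply: IH => z b bj; apply: FG.
rewrite -natr1 mulrDr mulr1 (_ : b - a = (b - (a + phi (x, y))) + phi (x, y)).
  by rewrite (le_trans (ler_normD _ _))// lerD.
by rewrite /=; ring.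
Qed.

Lemma iter_transitionZ j c F z : locally_bounded_mfun F ->
  iter j transition (fun z => c * F z) z = c * iter j transition F z.
Proof.
move=> lF; elim: j z => [//|j IH] z /=.
rewrite -expectZ; last exact: (bounded_mfun_next z (locally_bounded_iter j lF)).
by apply: eq_Rintegral => y _.
Qed.

Lemma bounded_mfun_markov u : bounded_mfun u -> bounded_mfun (markov u).
Proof.
move=> bu; apply: (bounded_mfun_expect nu (H := fun z => u (step z))).
exact: bounded_mfun_comp.
Qed.

Lemma bounded_mfun_cond_var : bounded_mfun cond_var.
Proof.
apply: (bounded_mfun_expect nu (H := fun z => phi z ^+ 2)).
by under eq_fun do rewrite expr2; apply: bounded_mfunM; exact: bounded_mfun_phi.
Qed.

Lemma bounded_mfun_sum_var j : bounded_mfun (sum_var j).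
Proof.
elim: j => [|j IH] /=; first exact: bounded_mfun_cst.
apply: bounded_mfunD; first exact: bounded_mfun_cond_var.
exact: bounded_mfun_markov.
Qed.

Lemma sum_var_bounds j x : 0 <= sum_var j x <= C ^+ 2 * j%:R.
Proof.
elim: j x => [|j IH] x /=; first by rewrite mulr0 lexx.
have bs1 : bounded_mfun (fun z => sum_var j (step (x, z))).
  apply: (bounded_mfun_section x (H := fun z => sum_var j (step z))).
  by apply: bounded_mfun_comp => //; exact: bounded_mfun_sum_var.
have bs2 : bounded_mfun (fun z => phi (x, z) ^+ 2).
  apply: (bounded_mfun_section x (H := fun z => phi z ^+ 2)).
  by under eq_fun do rewrite expr2; apply: bounded_mfunM; exact: bounded_mfun_phi.
apply/andP; split.
  apply: addr_ge0; apply: Rintegral_ge0 => y _; first exact: sqr_ge0.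
  by have /andP[] := IH (step (x, y)).
rewrite -natr1 mulrDr mulr1 addrC lerD//.
  rewrite -(expect_cst nu (C ^+ 2 * j%:R)); apply: expect_le => //.
    exact: bounded_mfun_cst.
  by move=> y; have /andP[] := IH (step (x, y)).
rewrite -(expect_cst nu (C ^+ 2)); apply: expect_le => //.
  exact: bounded_mfun_cst.
by move=> y; rewrite -[leLHS]real_normK ?num_real// lerXn2r ?nnegrE// (bound_ge0 x).
Qed.

(** The increments are centered, hence orthogonal: affine functions of the sum are
    preserved, and its square grows by the conditional variances only. *)
Lemma iter_transition_quadratic j (c0 c1 c2 : R) x a :
  iter j transition (fun z => c0 + c1 * z.2 + c2 * z.2 ^+ 2) (x, a) =
  c0 + c1 * a + c2 * (a ^+ 2 + sum_var j x).
Proof.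
elim: j x a => [|j IH] x a /=; first by rewrite addr0.
rewrite /transition.
under eq_Rintegral do rewrite IH/=.
have bphi : bounded_mfun (fun y => phi (x, y)).
  exact: (bounded_mfun_section x bounded_mfun_phi).
have bphi2 : bounded_mfun (fun y => phi (x, y) ^+ 2).
  by under eq_fun do rewrite expr2; exact: bounded_mfunM.
have bs : bounded_mfun (fun y => sum_var j (step (x, y))).
  apply: (bounded_mfun_section x (H := fun z => sum_var j (step z))).
  by apply: bounded_mfun_comp => //; exact: bounded_mfun_sum_var.
have -> : (fun y => c0 + c1 * (a + phi (x, y)) +
      c2 * ((a + phi (x, y)) ^+ 2 + sum_var j (step (x, y)))) =
    (fun y => (c0 + c1 * a + c2 * a ^+ 2) + (c1 + 2 * c2 * a) * phi (x, y) +
      c2 * (phi (x, y) ^+ 2 + sum_var j (step (x, y)))).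
  by apply/funext => y; ring.
have b1 : bounded_mfun (fun y => (c1 + 2 * c2 * a) * phi (x, y)).
  exact: bounded_mfunZ.
have b0 : bounded_mfun (fun y => c0 + c1 * a + c2 * a ^+ 2 + (c1 + 2 * c2 * a) * phi (x, y)).
  by apply: bounded_mfunD => //; exact: bounded_mfun_cst.
have b2 : bounded_mfun (fun y => phi (x, y) ^+ 2 + sum_var j (step (x, y))).
  exact: bounded_mfunD.
rewrite expectD//; last exact: bounded_mfunZ.
rewrite expectD//; last exact: bounded_mfun_cst.
rewrite expect_cst !expectZ// phi0 expectD// -/(cond_var x) -/(markov (sum_var j) x).
by ring.
Qed.

(** The linear term vanishes on average, the quadratic one yields the summed
    conditional variances, and the cubic remainder is bounded on the window
    reached in [m] steps. *)
Lemma iter_transition_taylor m (psi : R -> R) (c1 c2 e : R) x a :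
  locally_bounded_mfun (fun z : T * R => psi z.2) ->
  (forall b, `|b - a| <= C * m%:R ->
    `|psi b - (psi a + c1 * (b - a) + c2 / 2 * (b - a) ^+ 2)| <= e) ->
  `|iter m transition (fun z => psi z.2) (x, a) - (psi a + c2 / 2 * sum_var m x)| <= e.
Proof.
move=> lpsi He.
pose k0 := psi a - c1 * a + c2 / 2 * a ^+ 2; pose k1 := c1 - c2 * a.
have qE b : psi a + c1 * (b - a) + c2 / 2 * (b - a) ^+ 2 =
    k0 + k1 * b + c2 / 2 * b ^+ 2 by rewrite /k0 /k1; field.
have lq e' : locally_bounded_mfun
    (fun z : T * R => (k0 + e') + k1 * z.2 + c2 / 2 * z.2 ^+ 2).
  apply: (locally_bounded_mfun_snd (psi := fun b => k0 + e' + k1 * b + c2 / 2 * b ^+ 2)).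
    apply: measurable_funD; first by apply: measurable_funD => //; exact: measurable_funM.
    by apply: measurable_funM => //; exact: measurable_funX.
  move=> A; exists (`|k0 + e'| + `|k1| * A + `|c2 / 2| * A ^+ 2) => b bA.
  rewrite (le_trans (ler_normD _ _))// lerD//.
    by rewrite (le_trans (ler_normD _ _))// lerD// normrM ler_wpM2l.
  rewrite normrM ler_wpM2l// normrX lerXn2r// ?nnegrE//.
  by rewrite (le_trans _ bA).
have sumE e' : k0 + e' + k1 * a + c2 / 2 * (a ^+ 2 + sum_var m x) =
    psi a + c2 / 2 * sum_var m x + e' by rewrite /k0 /k1; field.
rewrite ler_distl; apply/andP; split.
  rewrite lerBlDr -lerBlDr -sumE -iter_transition_quadratic.
  apply: iter_transition_le => // y b /He; rewrite qE /= ler_distl => /andP[+ _].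
  by rewrite /= => H; rewrite (le_trans _ H)//; lra.
rewrite -sumE -iter_transition_quadratic.
apply: iter_transition_le => // y b /He; rewrite qE /= ler_distl => /andP[_].
by move=> H; rewrite (le_trans H)//; lra.
Qed.

End additive_functional.

(** * Gaussian averages *)

Section exponential.
Context {R : realType}.
Implicit Types x : R.

(** The terms of order at least three of the exponential series, with [`|x| ^+ 3]
    factored out and [(i + 3)`!] bounded below by [i`!]. *)
Lemma expR_taylor2 x :
  `|expR x - (1 + x + x ^+ 2 / 2)| <= `|x| ^+ 3 * expR `|x|.
Proof.
have cvx : series (exp_coeff x) n @[n --> \oo] --> expR x by exact: is_cvg_series_exp_coeff.
have : (`|series (exp_coeff x) n - (1 + x + x ^+ 2 / 2)| @[n --> \oo])%R
    --> `|expR x - (1 + x + x ^+ 2 / 2)|.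
  by apply: cvg_norm; apply: cvgB => //; exact: cvg_cst.
move=> H; rewrite -(cvg_lim _ H)//; apply: limr_le; first by apply/cvg_ex; eexists; exact: H.
exists 3%N => // n /= n3; rewrite /series/=.
rewrite (@big_cat_nat _ _ _ 3)//=.
have -> : \sum_(3 <= i < n) exp_coeff x i = \sum_(0 <= i < n - 3) exp_coeff x (i + 3)%N.
  by rewrite -{1}[3%N]add0n big_addn.
have -> : \sum_(0 <= i < 3) exp_coeff x i = 1 + x + x ^+ 2 / 2.
  by rewrite !big_nat_recl// big_geq// /exp_coeff/= !factS fact0; field.
rewrite addrC addrK (le_trans (ler_norm_sum _ _ _))//.
have s_le m : \sum_(0 <= i < m) exp_coeff `|x| i <= expR `|x|.
  have nd : nondecreasing_seq (series (exp_coeff `|x|)).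
    apply/nondecreasing_seqP => k; rewrite /series/= big_nat_recr//= lerDl.
    exact: exp_coeff_ge0.
  exact: (nondecreasing_cvgn_le nd (@is_cvg_series_exp_coeff R `|x|) m).
rewrite (le_trans _ (ler_wpM2l _ (s_le (n - 3)%N)))// ?exprn_ge0// mulr_sumr.
apply: ler_sum => i _; rewrite /exp_coeff/= normrM normfV normrX normr_nat exprD.
rewrite [X in X / _]mulrC -mulrA ler_wpM2l ?exprn_ge0// ler_wpM2l ?exprn_ge0//.
by rewrite lef_pV2 ?posrE ?ltr0n ?fact_gt0// ler_nat leq_fact// leq_addr.
Qed.

End exponential.

Section normal_density.
Context {R : realType}.
Import HBNNSimple.
Local Open Scope ereal_scope.
Notation leb := (@lebesgue_measure R).
Variables (m s : R).

Let mpdf : measurable_fun setT (fun x : measurableTypeR R => (normal_pdf m s x)%:E).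
Proof. by apply/measurable_EFinP; exact: measurable_normal_pdf. Qed.

(** Integration against a density, for nonnegative functions that need not be
    integrable: true for simple functions, then by monotone convergence. *)
Lemma ge0_integral_normal_prob (f : measurableTypeR R -> R) :
  measurable_fun setT f -> (forall x, 0 <= f x)%R ->
  \int[normal_prob m s]_x (f x)%:E = \int[leb]_x (f x * normal_pdf m s x)%:E.
Proof.
move=> mf f0.
have mfe : measurable_fun setT (EFin \o f) by exact/measurable_EFinP.
have f0e x : 0 <= (f x)%:E by rewrite lee_fin.
pose f_ := nnsfun_approx (@measurableT _ (measurableTypeR R)) mfe.
have pdf0 x : 0 <= (normal_pdf m s x)%:E by rewrite lee_fin normal_pdf_ge0.
have nnE (h : {nnsfun measurableTypeR R >-> R}) : \int[normal_prob m s]_x (h x)%:E =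
    \int[leb]_x ((h x)%:E * (normal_pdf m s x)%:E).
  under [LHS]eq_integral do rewrite fimfunE -fsumEFin//.
  rewrite [LHS]ge0_integral_fsum//; last 2 first.
    - by move=> r; exact/measurable_EFinP/measurableT_comp.
    - by move=> n x _; rewrite EFinM nnfun_muleindic_ge0.
  under [RHS]eq_integral.
    move=> x xD; rewrite muleC fimfunE -fsumEFin// ge0_mule_fsumr; last first.
      by move=> r; rewrite EFinM nnfun_muleindic_ge0.
    over.
  rewrite [RHS]ge0_integral_fsum//; last 2 first.
    - move=> r; apply: emeasurable_funM => //.
      by apply/measurable_EFinP; apply/measurableT_comp.
    - by move=> n x _; rewrite mule_ge0// EFinM nnfun_muleindic_ge0.
  apply: eq_fsbigr => r _.
  rewrite integralZl_indic_nnsfun//= integral_indic// setIT.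
  under [RHS]eq_integral do rewrite EFinM muleCA.
  have [r0|r0] := leP 0%R r; last first.
    rewrite preimage_nnfun0//= measure0 mule0; under eq_integral do rewrite indic0 mule0 mule0.
    by rewrite integral0.
  rewrite ge0_integralZl//; last 2 first.
  - apply: emeasurable_funM => //; exact/measurable_EFinP.
  - by move=> x _; rewrite mule_ge0.
  congr (_ * _); rewrite /= /normal_prob integral_mkcond/=.
  by apply: eq_integral => x _; rewrite patchE indicE; case: ifP => _; rewrite ?mule1 ?mule0.
transitivity (limn (fun n => \int[normal_prob m s]_x (f_ n x)%:E)).
  rewrite -monotone_convergence//=.
  - apply: eq_integral => x /[!inE] xD; apply/esym/cvg_lim => //=.
    exact: (cvg_nnsfun_approx (@measurableT _ (measurableTypeR R)) mfe (fun y _ => f0e y)).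
  - by move=> n; apply: measurableT_comp => //; exact: measurable_funTS.
  - by move=> n x _; rewrite lee_fin.
  - by move=> x _ a b ab; rewrite lee_fin//; exact/lefP/nd_nnsfun_approx.
under eq_fun do rewrite nnE.
rewrite -monotone_convergence//=.
- apply: eq_integral => x _; rewrite EFinM; apply/cvg_lim => //.
  apply: cvgeM; [exact: mule_def_fin| |exact: cvg_cst].
  exact: (cvg_nnsfun_approx (@measurableT _ (measurableTypeR R)) mfe (fun y _ => f0e y)).
- move=> n; apply: emeasurable_funM => //.
  by apply: measurableT_comp => //; exact: measurable_funTS.
- by move=> n x _; rewrite mule_ge0// lee_fin.
- move=> x _ a b ab; rewrite lee_wpmul2r// lee_fin//; exact/lefP/nd_nnsfun_approx.
Qed.

End normal_density.

Section gaussian.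
Context {R : realType}.
Notation leb := (@lebesgue_measure R).

Definition gauss : probability (measurableTypeR R) R := normal_prob 0 1.

(** The heat semigroup, indexed by the standard deviation rather than by time. *)
Definition heat (s : R) (psi : R -> R) (a : R) : R := \int[gauss]_z psi (a + s * z).

Lemma normal_pdf_scale (a s z : R) : 0 < s ->
  normal_pdf a s (a + s * z) * s = normal_pdf 0 1 z.
Proof.
move=> s0; rewrite !normal_pdfE ?gt_eqF//= /normal_peak /normal_fun.
have -> : s ^+ 2 * pi *+ 2 = s ^+ 2 * (1 ^+ 2 * pi *+ 2) :> R.
  by rewrite expr1n mul1r mulrnAr.
rewrite sqrtrM ?sqr_ge0// sqrtr_sqr gtr0_norm// invfM.
have -> : - (a + s * z - a) ^+ 2 / (s ^+ 2 *+ 2) = - (z - 0) ^+ 2 / (1 ^+ 2 *+ 2).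
  by field; rewrite gt_eqF.
by rewrite mulrC !mulrA divff ?gt_eqF// mul1r.
Qed.

(** Completing the square in [z]: the product of the two densities is the density of
    the sum times a conditional normal density, which integrates to [1]. *)
Lemma normal_pdf_convolution (a s t x z : R) : 0 < s -> 0 < t ->
  let r := Num.sqrt (s ^+ 2 + t ^+ 2) in
  normal_pdf (a + s * z) t x * normal_pdf 0 1 z =
  normal_pdf a r x * normal_pdf (s * (x - a) / r ^+ 2) (t / r) z.
Proof.
move=> s0 t0 r.
have r20 : 0 < s ^+ 2 + t ^+ 2 by rewrite addr_gt0 ?exprn_gt0.
have r0 : 0 < r by rewrite sqrtr_gt0.
have r2 : r ^+ 2 = s ^+ 2 + t ^+ 2 by rewrite sqr_sqrtr// ltW.
have tr0 : 0 < t / r by rewrite divr_gt0.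
rewrite !normal_pdfE ?gt_eqF//= /normal_peak /normal_fun.
have peakE (v : R) : 0 < v -> (Num.sqrt (v ^+ 2 * pi *+ 2))^-1 =
    v^-1 * (Num.sqrt (pi *+ 2))^-1.
  move=> v0; rewrite -mulrnAr sqrtrM ?sqr_ge0// sqrtr_sqr gtr0_norm//.
  by rewrite invfM.
rewrite !peakE//.
set c := (Num.sqrt (pi *+ 2))^-1.
have -> : t^-1 * c * expR (- (x - (a + s * z)) ^+ 2 / (t ^+ 2 *+ 2)) *
   (1^-1 * c * expR (- (z - 0) ^+ 2 / (1 ^+ 2 *+ 2))) =
   t^-1 * c * c * expR (- (x - (a + s * z)) ^+ 2 / (t ^+ 2 *+ 2) +
     - (z - 0) ^+ 2 / (1 ^+ 2 *+ 2)) by rewrite expRD invr1; ring.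
have -> : r^-1 * c * expR (- (x - a) ^+ 2 / (r ^+ 2 *+ 2)) *
   ((t / r)^-1 * c * expR (- (z - s * (x - a) / r ^+ 2) ^+ 2 / ((t / r) ^+ 2 *+ 2))) =
   t^-1 * c * c * expR (- (x - a) ^+ 2 / (r ^+ 2 *+ 2) +
     - (z - s * (x - a) / r ^+ 2) ^+ 2 / ((t / r) ^+ 2 *+ 2)).
  by rewrite expRD; field; rewrite !gt_eqF.
congr (_ * expR _).
rewrite expr_div_n r2; field.
by rewrite !gt_eqF.
Qed.

(** The substitution [x = a + s * z]. *)
Lemma integral_normal_shift (a s : R) (psi : R -> R) : 0 < s -> continuous psi ->
  (forall x, 0 <= psi x) ->
  (\int[leb]_x (psi x * normal_pdf a s x)%:E =
   \int[gauss]_z (psi (a + s * z))%:E)%E.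
Proof.
move=> s0 cpsi psi0; pose F (z : R) := a + s * z.
have F' : F^`()%classic = cst s.
  apply/funext => z; rewrite /F derive1E deriveD// derive_cst add0r.
  by rewrite deriveM// derive_cst derive_id scaler0 addr0 scaler1.
have cF : continuous F.
  by move=> z; apply: cvgD; [exact: cvg_cst|apply: cvgM; [exact: cvg_cst|exact: cvg_id]].
rewrite (@increasing_ge0_integration_by_substitutionT _ F
    (fun x => psi x * normal_pdf a s x)); first last.
- by move=> x; rewrite mulr_ge0// normal_pdf_ge0.
- move=> x; apply: cvgM; first exact: cpsi.
  by apply: continuous_normal_pdf; rewrite gt_eqF.
- apply/cvgryPge => A; exists (s^-1 * (A - a)); split; first by rewrite num_real.
  by move=> x /ltW; rewrite ler_pdivrMl// lerBlDl.
- apply/cvgrNyPle => A; exists (s^-1 * (A - a)); split; first by rewrite num_real.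
  by move=> x /ltW; rewrite ler_pdivlMl// lerBrDl.
- by move=> x; rewrite /F.
- by rewrite F'; exact: is_cvg_cst.
- by rewrite F'; exact: is_cvg_cst.
- by rewrite F' => ?; exact: cvg_cst.
- by move=> x y xy; rewrite /F ltrD2l ltr_pM2l.
rewrite ge0_integral_normal_prob//.
  apply: eq_integral => z _; congr EFin.
  transitivity (psi (F z) * normal_pdf a s (F z) * F^`()%classic z) => //.
  by rewrite F' -mulrA normal_pdf_scale.
apply: (measurableT_comp (f := psi) (g := F)); exact: continuous_measurable_fun.
Qed.

Lemma measurable_affine (a s : R) :
  measurable_fun setT (fun z : measurableTypeR R => a + s * z).
Proof. by apply: measurable_funD => //; exact: measurable_funM. Qed.

Lemma bounded_mfun_affine (s : R) (psi : R -> R) (a : R) : bounded_mfun psi ->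
  bounded_mfun (fun z : measurableTypeR R => psi (a + s * z)).
Proof. by move=> bpsi; apply: (bounded_mfun_comp (measurable_affine a s) bpsi). Qed.

Lemma heat0 (psi : R -> R) : heat 0 psi = psi.
Proof.
apply/funext => a; rewrite /heat.
under eq_Rintegral do rewrite mul0r addr0.
by rewrite expect_cst.
Qed.

Lemma bounded_mfun_heat (s : R) (psi : R -> R) : bounded_mfun psi ->
  bounded_mfun (heat s psi : measurableTypeR R -> R).
Proof.
move=> bpsi.
apply: (bounded_mfun_expect gauss
  (H := fun z : measurableTypeR R * measurableTypeR R => psi (z.1 + s * z.2))).
apply: (bounded_mfun_comp (f := fun z : measurableTypeR R * measurableTypeR R => z.1 + s * z.2) _ bpsi).
apply: measurable_funD; first exact: measurable_fst.
by apply: measurable_funM => //; exact: measurable_snd.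
Qed.

(** Sums of independent Gaussians are Gaussian. Tonelli's theorem requires a
    nonnegative integrand, which is obtained by adding a constant to [psi]. *)
Lemma heat_semigroup (s t : R) (psi : R -> R) (a : R) : 0 < s -> 0 < t ->
  continuous psi -> bounded_mfun psi ->
  heat s (heat t psi) a = heat (Num.sqrt (s ^+ 2 + t ^+ 2)) psi a.
Proof.
move=> s0 t0; set r := Num.sqrt _ => cpsi bpsi.
have r0 : 0 < r by rewrite sqrtr_gt0 addr_gt0 ?exprn_gt0.
wlog psi0 : psi cpsi bpsi / forall x, 0 <= psi x.
  move=> H; have [_ [B HB]] := bpsi.
  have bB : bounded_mfun (fun x : measurableTypeR R => psi x + B).
    by apply: bounded_mfunD => //; exact: bounded_mfun_cst.
  have heatB v : heat v (fun x => psi x + B) = (fun x => heat v psi x + B).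
    apply/funext => x; rewrite /heat expectD ?expect_cst//; last exact: bounded_mfun_cst.
    exact: bounded_mfun_affine.
  have := H (fun x => psi x + B); rewrite !heatB.
  have -> : heat s (fun x => heat t psi x + B) a = heat s (heat t psi) a + B.
    rewrite /heat expectD ?expect_cst//; last exact: bounded_mfun_cst.
    exact: (bounded_mfun_affine s a (bounded_mfun_heat t bpsi)).
  move/(_ _ bB _)/addIr; apply => //.
    by move=> x; apply: cvgD; [exact: cpsi|exact: cvg_cst].
  by move=> x; rewrite -lerBlDr sub0r; have := HB x; rewrite ler_norml => /andP[].
apply: EFin_inj; rewrite /heat !EFin_expect; last 2 first.
- exact: bounded_mfun_affine.
- exact: (bounded_mfun_affine s a (bounded_mfun_heat t bpsi)).
transitivity (\int[leb]_z \int[leb]_x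
    (psi x * (normal_pdf (a + s * z) t x * normal_pdf 0 1 z))%:E)%E.
  rewrite ge0_integral_normal_prob; last 2 first.
  - have := bounded_mfun_affine s a (bounded_mfun_heat t bpsi).
    by case.
  - by move=> z; apply: Rintegral_ge0.
  apply: eq_integral => z _; rewrite EFinM EFin_expect; last exact: bounded_mfun_affine.
  rewrite -(integral_normal_shift (a + s * z) t0 cpsi psi0) muleC -ge0_integralZl.
  - by apply: eq_integral => x _; rewrite -EFinM; congr EFin; ring.
  - exact: measurableT.
  - apply/measurable_EFinP/measurable_funM; first by case: bpsi.
    exact: measurable_normal_pdf.
  - by move=> x _; rewrite lee_fin mulr_ge0// normal_pdf_ge0.
  - by rewrite lee_fin normal_pdf_ge0.
transitivity (\int[leb]_x \int[leb]_z
    (psi x * (normal_pdf (a + s * z) t x * normal_pdf 0 1 z))%:E)%E.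
  apply: (@fubini_tonelli _ _ _ _ R leb leb
    (fun zx => (psi zx.2 * (normal_pdf (a + s * zx.1) t zx.2 * normal_pdf 0 1 zx.1))%:E)).
    apply/measurable_EFinP/measurable_funM.
      by apply: (measurableT_comp (f := psi)); [case: bpsi|exact: measurable_snd].
    apply: measurable_funM; last first.
      exact: (measurableT_comp (measurable_normal_pdf 0 1) (@measurable_fst _ _ (measurableTypeR R) (measurableTypeR R))).
    rewrite /normal_pdf gt_eqF//= /normal_fun.
    apply: measurable_funM => //; apply: measurableT_comp => //.
    apply: measurable_funM => //; apply: measurableT_comp => //.
    apply: measurable_funX; apply: measurable_funB; first exact: measurable_snd.
    exact: (measurableT_comp (measurable_affine a s) (@measurable_fst _ _ (measurableTypeR R) (measurableTypeR R))).
  by move=> zx; rewrite lee_fin !mulr_ge0// normal_pdf_ge0.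
rewrite -(integral_normal_shift a r0 cpsi psi0).
apply: eq_integral => x _.
under eq_integral do rewrite normal_pdf_convolution// mulrA EFinM.
rewrite ge0_integralZl//.
- by rewrite integral_normal_pdf mule1.
- by apply/measurable_EFinP; exact: measurable_normal_pdf.
- by move=> z _; rewrite lee_fin normal_pdf_ge0.
- by rewrite lee_fin mulr_ge0// normal_pdf_ge0.
Qed.

(** Completing the square turns [expR (l * z)] times the density at mean [0] into
    a multiple of the density at mean [l]. *)
Lemma gauss_mgf (l : R) : (\int[gauss]_z (expR (l * z))%:E = (expR (l ^+ 2 / 2))%:E)%E.
Proof.
rewrite ge0_integral_normal_prob; last 2 first.
- by apply: measurableT_comp => //; exact: measurable_funM.
- by move=> z; exact: expR_ge0.
under eq_integral => z _.
  rewrite (_ : expR (l * z) * normal_pdf 0 1 z = expR (l ^+ 2 / 2) * normal_pdf l 1 z); last first.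
    rewrite !normal_pdfE ?oner_eq0//= /normal_fun mulrCA [RHS]mulrCA; congr (_ * _).
    by rewrite -!expRD; congr expR; rewrite expr1n; field.
  rewrite EFinM; over.
rewrite ge0_integralZl//.
- by rewrite integral_normal_pdf mule1.
- by apply/measurable_EFinP; exact: measurable_normal_pdf.
- by move=> z _; rewrite lee_fin normal_pdf_ge0.
Qed.

(** The Laplace transform at [2] and [-2] controls [expR (2 * `|z|)], hence all the
    polynomials met below. *)
Lemma gauss_integrable (K : R) (u : measurableTypeR R -> R) : measurable_fun setT u ->
  (forall z, `|u z| <= K * expR (2 * `|z|)) ->
  gauss.-integrable setT (EFin \o u).
Proof.
move=> mu uK.
have iexp (l : R) : gauss.-integrable setT (fun z => (expR (l * z))%:E).
  apply/integrableP; split.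
    by apply/measurable_EFinP; apply: measurableT_comp => //; exact: measurable_funM.
  under eq_integral do rewrite gee0_abs ?lee_fin ?expR_ge0//.
  by rewrite gauss_mgf ltry.
have K0 : 0 <= K.
  by have := le_trans (normr_ge0 _) (uK 0); rewrite pmulr_lge0// expR_gt0.
apply: (@le_integrable _ _ _ gauss _ _ _ (fun z => (K * (expR (2 * z) + expR (- 2 * z)))%:E)) => //.
- exact/measurable_EFinP.
- move=> z _ /=; rewrite lee_fin [leRHS]ger0_norm; last first.
    by rewrite mulr_ge0// addr_ge0// expR_ge0.
  rewrite (le_trans (uK z))// ler_wpM2l//.
  have [z0|z0] := ler0P z.
    by rewrite mulrN -mulNr lerDr expR_ge0.
  by rewrite lerDl expR_ge0.
- have -> : (fun z => (K * (expR (2 * z) + expR (- 2 * z)))%:E) =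
     (fun z : measurableTypeR R => (K%:E * ((expR (2 * z))%:E + (expR (- 2 * z))%:E))%E).
    by apply/funext => z; rewrite EFinM EFinD.
  apply: integrableZl => //.
  by apply: integrableD => //; exact: iexp.
Qed.

Lemma cube_le_expR (t : R) : 0 <= t -> t ^+ 3 <= 6 * expR t.
Proof.
move=> t0; have := expR_ge1Dxn 2 t0.
rewrite -(ler_pM2l (ltr0n _ 6)) => /(le_trans _); apply.
by rewrite !factS fact0; have := t0; lra.
Qed.

Lemma eq0_of_norm_le_linear (x K : R) :
  (forall l, 0 < l <= 1 -> `|x| <= K * l) -> x = 0.
Proof.
move=> H; apply/eqP; rewrite -normr_le0; apply/ler_addgt0Pl => e e0; rewrite addr0.
have K0 : 0 <= K.
  by have := H 1 _; rewrite mulr1 ltr01 lexx => /(_ isT); apply: le_trans.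
have [K1|K1] := leP K e.
  by have := H 1 _; rewrite mulr1 ltr01 lexx => /(_ isT)/le_trans; apply.
have K0' : 0 < K by rewrite (lt_trans e0).
have := H (e / K); rewrite divr_gt0//= ler_pdivrMr// mul1r ltW// => /(_ isT).
by rewrite mulrCA divff ?gt_eqF// mulr1.
Qed.

(** Comparing the expansions in [l] of both sides of [gauss_mgf] up to order two. *)
Lemma gauss_moments :
  [/\ gauss.-integrable setT (EFin \o (fun z => z)),
      gauss.-integrable setT (EFin \o (fun z => z ^+ 2)),
      gauss.-integrable setT (EFin \o (fun z => `|z| ^+ 3)),
      \int[gauss]_z z = 0 & \int[gauss]_z (z ^+ 2) = 1].
Proof.
have le1exp (z : R) : 1 <= expR (2 * `|z|) by rewrite -expR0 ler_expR mulr_ge0.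
have lexp (z : R) : `|z| <= expR (2 * `|z|).
  rewrite (le_trans _ (expR_ge1Dx _))//.
  by have := normr_ge0 z; lra.
have i1 : gauss.-integrable setT (EFin \o (fun z => z)).
  by apply: (gauss_integrable (K := 1)) => // z; rewrite mul1r.
have i2 : gauss.-integrable setT (EFin \o (fun z => z ^+ 2)).
  apply: (gauss_integrable (K := 1)) => [|z]; first exact: measurable_funX.
  rewrite mul1r normrX (le_trans _ (expR_ge1Dxn 1 _))//.
  by rewrite !factS fact0; have := sqr_ge0 `|z|; lra.
have i3 : gauss.-integrable setT (EFin \o (fun z => `|z| ^+ 3)).
  apply: (gauss_integrable (K := 6)) => [|z]; first exact: measurable_funX.
  rewrite ger0_norm ?exprn_ge0// (le_trans (cube_le_expR _))//.
  by rewrite ler_pM2l// ler_expR; have := normr_ge0 z; lra.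
have ir : gauss.-integrable setT (EFin \o (fun z => 6 * expR (2 * `|z|))).
  apply: (gauss_integrable (K := 6)) => [|z].
    apply: measurable_funM => //; apply: measurableT_comp => //; exact: measurable_funM.
  by rewrite ger0_norm// mulr_ge0// expR_ge0.
have i0 : gauss.-integrable setT (EFin \o (fun z => 1 : R)).
  by apply: (gauss_integrable (K := 1)) => // z; rewrite normr1 mul1r.
set m1 := \int[gauss]_z z; set m2 := \int[gauss]_z (z ^+ 2).
set K := \int[gauss]_z (6 * expR (2 * `|z|)).
have key (l : R) : 0 < l <= 1 ->
    `|l * m1 + l ^+ 2 / 2 * (m2 - 1)| <= (K + expR 1) * l ^+ 3.
  move=> /andP[l0 l1].
  have il : gauss.-integrable setT (EFin \o (fun z => expR (l * z))).
    apply: (gauss_integrable (K := 1)) => [|z].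
      by apply: measurableT_comp => //; exact: measurable_funM.
    rewrite mul1r ger0_norm ?expR_ge0// ler_expR.
    rewrite (le_trans (ler_norm _))// normrM gtr0_norm// ler_wpM2r//.
    by rewrite (le_trans l1)// ler1n.
  have ilz : gauss.-integrable setT (EFin \o (fun z => l * z)).
    exact: (integrableZl measurableT l i1).
  have ilz2 : gauss.-integrable setT (EFin \o (fun z => l ^+ 2 / 2 * z ^+ 2)).
    exact: (integrableZl measurableT (l ^+ 2 / 2) i2).
  have i1l : gauss.-integrable setT (EFin \o (fun z => 1 + l * z)).
    exact: (integrableD measurableT i0 ilz).
  have iq : gauss.-integrable setT (EFin \o (fun z => 1 + l * z + l ^+ 2 / 2 * z ^+ 2)).
    exact: (integrableD measurableT i1l ilz2).
  have H1 : \int[gauss]_z (expR (l * z)) - \int[gauss]_z (1 + l * z + l ^+ 2 / 2 * z ^+ 2) =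
      expR (l ^+ 2 / 2) - (1 + l * m1 + l ^+ 2 / 2 * m2).
    rewrite {1}/Rintegral gauss_mgf/=.
    rewrite RintegralD// RintegralD// expect_cst !RintegralZl//.
  have H2 : `|\int[gauss]_z (expR (l * z)) -
      \int[gauss]_z (1 + l * z + l ^+ 2 / 2 * z ^+ 2)| <= l ^+ 3 * K.
    rewrite -RintegralB// -RintegralZl//.
    have iB : gauss.-integrable setT
        (EFin \o (fun z => expR (l * z) - (1 + l * z + l ^+ 2 / 2 * z ^+ 2))).
      exact: (integrableB measurableT il iq).
    rewrite (le_trans (le_normr_Rintegral _ iB))//.
    apply: le_Rintegral => //.
    - exact: (integrable_norm iB).
    - exact: (integrableZl measurableT (l ^+ 3) ir).
    - move=> z _; have := expR_taylor2 (l * z).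
      rewrite (_ : (l * z) ^+ 2 / 2 = l ^+ 2 / 2 * z ^+ 2); last by field.
      move=> /le_trans; apply; rewrite normrM gtr0_norm// exprMn -mulrA.
      rewrite ler_wpM2l// ?exprn_ge0 ?(ltW l0)//.
      rewrite (le_trans (ler_wpM2r (expR_ge0 _) (cube_le_expR (normr_ge0 z))))//.
      rewrite -mulrA ler_pM2l// -expRD ler_expR.
      by have := ler_piMl (normr_ge0 z) l1; lra.
  have H3 : `|expR (l ^+ 2 / 2) - (1 + l ^+ 2 / 2)| <= expR 1 * l ^+ 3.
    set x := l ^+ 2 / 2.
    have x0 : 0 < x by rewrite divr_gt0// exprn_gt0.
    have xl : x <= l / 2 by rewrite /x ler_pM2r// expr2 ler_piMl// ltW.
    have e1 : 1 <= expR 1 :> R by rewrite -expR0 ler_expR.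
    have := expR_taylor2 x; rewrite (gtr0_norm x0) => H.
    have Hx : x ^+ 3 * expR x <= x ^+ 2 / 2 * expR 1.
      rewrite exprSr -mulrA -[in leRHS]mulrA ler_wpM2l ?sqr_ge0//.
      by rewrite ler_pM ?expR_ge0 ?ler_expR; lra.
    have H4 : `|expR x - (1 + x)| <= x ^+ 2 * expR 1.
      have x20 : 0 <= x ^+ 2 by exact: sqr_ge0.
      have x2e : x ^+ 2 <= x ^+ 2 * expR 1 by rewrite ler_peMr.
      by move: H; rewrite !ler_norml => /andP[? ?]; apply/andP; split; lra.
    rewrite (le_trans H4)// mulrC ler_wpM2l ?expR_ge0//.
    have l30 : 0 <= l ^+ 3 by rewrite exprn_ge0// ltW.
    have : l ^+ 4 <= l ^+ 3 by rewrite exprS ler_piMl.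
    by rewrite /x expr_div_n -exprM/=; lra.
  rewrite H1 in H2.
  have -> : l * m1 + l ^+ 2 / 2 * (m2 - 1) = (expR (l ^+ 2 / 2) - (1 + l ^+ 2 / 2)) -
    (expR (l ^+ 2 / 2) - (1 + l * m1 + l ^+ 2 / 2 * m2)) by ring.
  by rewrite (le_trans (ler_normB _ _))//; rewrite mulrDl addrC [K * _]mulrC lerD.
have K0 : 0 <= K by apply: Rintegral_ge0 => z _; rewrite mulr_ge0// expR_ge0.
have m10 : m1 = 0.
  apply: (@eq0_of_norm_le_linear _ (K + expR 1 + `|m2 - 1|)) => l l01.
  have /andP[l0 l1] := l01.
  rewrite -(ler_pM2l l0) -{1}(gtr0_norm l0) -normrM.
  have -> : l * m1 = (l * m1 + l ^+ 2 / 2 * (m2 - 1)) - l ^+ 2 / 2 * (m2 - 1) by ring.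
  rewrite (le_trans (ler_normB _ _))// (le_trans (lerD (key l l01) (lexx _)))//.
  rewrite normrM (ger0_norm (_ : 0 <= l ^+ 2 / 2)); last by rewrite divr_ge0// sqr_ge0.
  have l20 : 0 <= l ^+ 2 by rewrite sqr_ge0.
  have : (K + expR 1) * l ^+ 3 <= (K + expR 1) * l ^+ 2.
    rewrite ler_wpM2l ?addr_ge0 ?expR_ge0// exprS ler_piMl//.
  have : 0 <= l ^+ 2 * `|m2 - 1| by rewrite mulr_ge0.
  have -> : l * ((K + expR 1 + `|m2 - 1|) * l) = (K + expR 1) * l ^+ 2 + l ^+ 2 * `|m2 - 1|.
    by ring.
  by lra.
have m21 : m2 - 1 = 0.
  apply: (@eq0_of_norm_le_linear _ (2 * (K + expR 1))) => l l01.
  have /andP[l0 l1] := l01.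
  have l20 : 0 < l ^+ 2 / 2 by rewrite divr_gt0// exprn_gt0.
  rewrite -(ler_pM2l l20) -{1}(gtr0_norm l20) -normrM.
  have := key l l01; rewrite m10 mulr0 add0r => /le_trans; apply.
  by rewrite le_eqVlt; apply/orP; left; apply/eqP; field.
by split => //; apply/eqP; rewrite -subr_eq0 m21.
Qed.

(** The odd moment vanishes and the second one is [1], so averaging a Taylor
    expansion over a centered normal shift leaves half the second derivative. *)
Lemma heat_taylor : exists2 K : R, 0 <= K &
  forall (s L c1 c2 a : R) (psi : R -> R), 0 <= s -> bounded_mfun psi ->
  (forall h, `|psi (a + h) - (psi a + c1 * h + c2 / 2 * h ^+ 2)| <= L * `|h| ^+ 3) ->
  `|heat s psi a - (psi a + c2 / 2 * s ^+ 2)| <= L * K * s ^+ 3.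
Proof.
have [i1 i2 i3 m1 m2] := gauss_moments.
exists (\int[gauss]_z (`|z| ^+ 3)).
  by apply: Rintegral_ge0 => z _; rewrite exprn_ge0.
move=> s L c1 c2 a psi s0 bpsi H.
have i0 : gauss.-integrable setT (EFin \o (fun z => psi a : R)).
  exact: (bounded_mfun_integrable _ (bounded_mfun_cst _)).
have iz : gauss.-integrable setT (EFin \o (fun z => c1 * s * z)).
  exact: (integrableZl measurableT (c1 * s) i1).
have iz2 : gauss.-integrable setT (EFin \o (fun z => c2 / 2 * s ^+ 2 * z ^+ 2)).
  exact: (integrableZl measurableT (c2 / 2 * s ^+ 2) i2).
have i01 : gauss.-integrable setT (EFin \o (fun z => psi a + c1 * s * z)).
  exact: (integrableD measurableT i0 iz).
have iq : gauss.-integrable setT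
    (EFin \o (fun z => psi a + c1 * s * z + c2 / 2 * s ^+ 2 * z ^+ 2)).
  exact: (integrableD measurableT i01 iz2).
have ip : gauss.-integrable setT (EFin \o (fun z => psi (a + s * z))).
  exact: (bounded_mfun_integrable gauss (bounded_mfun_affine s a bpsi)).
have -> : psi a + c2 / 2 * s ^+ 2 =
    \int[gauss]_z (psi a + c1 * s * z + c2 / 2 * s ^+ 2 * z ^+ 2).
  by rewrite RintegralD// RintegralD// expect_cst !RintegralZl// m1 m2; ring.
have iB := integrableB measurableT ip iq.
rewrite -RintegralB// (le_trans (le_normr_Rintegral _ iB))//.
rewrite [leRHS](_ : _ = L * s ^+ 3 * \int[gauss]_z (`|z| ^+ 3)); last by ring.
rewrite -RintegralZl//; apply: le_Rintegral => //.
- exact: (integrable_norm iB).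
- exact: (integrableZl measurableT (L * s ^+ 3) i3).
- move=> z _; have := H (s * z).
  have -> : psi a + c1 * (s * z) + c2 / 2 * (s * z) ^+ 2 =
    psi a + c1 * s * z + c2 / 2 * s ^+ 2 * z ^+ 2 by ring.
  by move/le_trans; apply; rewrite normrM (ger0_norm s0) exprMn mulrA.
Qed.

(** The density on [[u, u + 1]] is at least its value at [u + 1]. *)
Lemma gauss_tail (u : R) : 0 <= u ->
  normal_peak 1 * expR (- ((u + 1) ^+ 2 / 2)) <= \int[gauss]_z \1_`[u, +oo[ z.
Proof.
move=> u0.
have mI (b : itv_bound R) : measurable ([set` Interval (BLeft u) b] : set (measurableTypeR R)).
  exact: measurable_itv.
rewrite -lee_fin EFin_expect; last by apply: bounded_mfun_indic; exact: measurable_itv.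
rewrite integral_indic//.
pose D : set (measurableTypeR R) := `[u, u + 1]%classic.
rewrite setIT (@le_trans _ _ (gauss D))//; last first.
  apply: le_measure; rewrite ?inE; [exact: (mI (BRight _))|exact: (mI (BInfty _ false))|].
  by move=> x /=; rewrite !in_itv/= andbT => /andP[].
have -> : (normal_peak 1 * expR (- ((u + 1) ^+ 2 / 2)))%:E =
    (\int[leb]_(x in D) (normal_peak 1 * expR (- ((u + 1) ^+ 2 / 2)))%:E)%E.
  rewrite integral_cst//=; last exact: measurable_itv.
  rewrite /D lebesgue_measure_itv/= lte_fin ltrDl ltr01.
  by rewrite -EFinD addrAC subrr add0r mule1.
apply: ge0_le_integral => //.
- exact: measurable_itv.
- by move=> x _; rewrite lee_fin mulr_ge0 ?expR_ge0// normal_peak_ge0.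
- by apply/measurable_EFinP; apply: measurable_funTS; exact: measurable_normal_pdf.
- move=> x; rewrite /D/= in_itv/= => /andP[ux xu].
  rewrite lee_fin normal_pdfE ?oner_eq0//= ler_wpM2l ?normal_peak_ge0// ler_expR.
  rewrite subr0 expr1n -mulNr ler_pM2r ?invr_gt0// lerN2.
  by rewrite lerXn2r// nnegrE; lra.
Qed.

(** The degenerate case is included: [heat 0] is the identity, and the limit law is
    then the Dirac mass at [0]. *)
Lemma gauss_centered_normal (s : R) (psi : R -> R) : 0 <= s ->
  continuous psi -> bounded_mfun (psi : measurableTypeR R -> R) ->
  \int[centered_normal s]_x psi x = heat s psi 0.
Proof.
move=> s0 cpsi bpsi; rewrite /centered_normal; case: eqP => [->|/eqP sN0].
  rewrite heat0 /Rintegral integral_dirac//; last by apply/measurable_EFinP; case: bpsi.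
  by rewrite diracT mul1e.
have {s0 sN0} s0 : 0 < s by rewrite lt_neqAle eq_sym sN0.
wlog psi0 : psi cpsi bpsi / forall x, 0 <= psi x.
  move=> H; have [_ [B HB]] := bpsi.
  have bB : bounded_mfun (fun x : measurableTypeR R => psi x + B).
    by apply: bounded_mfunD => //; exact: bounded_mfun_cst.
  have bc : bounded_mfun (fun _ : measurableTypeR R => B) by exact: bounded_mfun_cst.
  have bh := bounded_mfun_affine s 0 bpsi.
  have e1 : \int[normal_prob 0 s]_x (psi x + B) = \int[normal_prob 0 s]_x psi x + B.
    by etransitivity; [exact: (expectD _ bpsi bc)|rewrite expect_cst].
  have e2 : heat s (fun x => psi x + B) 0 = heat s psi 0 + B.
    rewrite /heat; apply: (etrans (expectD gauss bh bc)).
    by congr (_ + _); exact: expect_cst.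
  apply: (addIr B); apply: (etrans (esym e1)); apply: (etrans _ e2).
  apply: (H (fun x => psi x + B)) => // [x|x].
    by apply: cvgD; [exact: cpsi|exact: cvg_cst].
  by rewrite -lerBlDr sub0r; have := HB x; rewrite ler_norml => /andP[].
apply: EFin_inj; apply: (etrans (EFin_expect _ bpsi)).
apply: (etrans _ (esym (EFin_expect gauss (bounded_mfun_affine s 0 bpsi)))).
apply: (etrans _ (integral_normal_shift 0 s0 cpsi psi0)).
exact: (ge0_integral_normal_prob 0 s bpsi.1 psi0).
Qed.

End gaussian.

(** * A central limit theorem uniform in the starting point *)

Section smooth_functions.
Context {R : realType}.

(** Second-order Taylor expansions with uniform constants: unlike derivatives,
    such expansions pass under an average over translations by themselves. *)
Definition taylor_class (L B : R) (psi : R -> R) : Prop :=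
  bounded_mfun (psi : measurableTypeR R -> R) /\
  exists psi1 psi2 : measurableTypeR R -> R,
  [/\ bounded_mfun psi1, bounded_mfun psi2, forall a, `|psi2 a| <= B &
      forall a h, `|psi (a + h) - (psi a + psi1 a * h + psi2 a / 2 * h ^+ 2)|
        <= L * `|h| ^+ 3].

Lemma taylor_class_continuous L B psi : taylor_class L B psi -> continuous psi.
Proof.
move=> [_ [psi1 [psi2 [_ _ _ H]]]] a; apply/cvgrPdist_le => e e0 /=.
pose D := `|psi1 a| + `|psi2 a / 2| + `|L|.
have D0 : 0 <= D by rewrite /D !addr_ge0.
have ab c : 0 < c -> \forall b \near a, `|b - a| <= c.
  by move=> c0; exists c => //= b'; rewrite /ball_/= distrC => /ltW.
near=> b.
have ab1 : `|b - a| <= 1 by near: b; exact: ab.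
have abD : `|b - a| <= e / (D + 1) by near: b; apply: ab; rewrite divr_gt0// ltr_pwDr.
have := H a (b - a); rewrite (addrC a) subrK => Hb.
have -> : psi a - psi b = - (psi b - (psi a + psi1 a * (b - a) + psi2 a / 2 * (b - a) ^+ 2))
    - (psi1 a * (b - a) + psi2 a / 2 * (b - a) ^+ 2) by ring.
set h := `|b - a| in Hb ab1 abD.
have h0 : 0 <= h by rewrite /h.
have h2 : h ^+ 2 <= h by rewrite expr2 ler_piMl.
have h3 : h ^+ 3 <= h by rewrite exprS ler_piMr// exprn_ile1.
have bd : `|psi1 a * (b - a) + psi2 a / 2 * (b - a) ^+ 2| <= `|psi1 a| * h + `|psi2 a / 2| * h.
  rewrite (le_trans (ler_normD _ _))//; apply: lerD; first by rewrite normrM.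
  by rewrite (normrM (psi2 a / 2)) normrX ler_wpM2l.
have bL : L * h ^+ 3 <= `|L| * h.
  by rewrite (le_trans (ler_wpM2r _ (ler_norm L)))// ?exprn_ge0// ler_wpM2l.
rewrite (le_trans (ler_normB _ _))// normrN.
rewrite (le_trans (lerD (le_trans Hb bL) bd))//.
have -> : `|L| * h + (`|psi1 a| * h + `|psi2 a / 2| * h) = D * h by rewrite /D; ring.
rewrite (le_trans (ler_wpM2l D0 abD))// mulrCA ler_piMr ?(ltW e0)//.
by rewrite ler_pdivrMr ?mul1r ?lerDl// ltr_pwDr.
Unshelve. all: by end_near. Qed.

Lemma taylor_class_heat L B psi s : taylor_class L B psi -> taylor_class L B (heat s psi).
Proof.
move=> [bpsi [psi1 [psi2 [b1 b2 B2 H]]]].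
split; first exact: bounded_mfun_heat.
exists (heat s psi1), (heat s psi2); split; [exact: bounded_mfun_heat|exact: bounded_mfun_heat| |].
  by move=> a; apply: expect_norm_le => //; exact: bounded_mfun_affine.
move=> a h.
have e0 := bounded_mfun_affine s a bpsi.
have e1 := bounded_mfunZ h (bounded_mfun_affine s a b1).
have e2 := bounded_mfunZ (h ^+ 2 / 2) (bounded_mfun_affine s a b2).
have -> : heat s psi a + heat s psi1 a * h + heat s psi2 a / 2 * h ^+ 2 =
   \int[gauss]_z (psi (a + s * z) + h * psi1 (a + s * z) + h ^+ 2 / 2 * psi2 (a + s * z)).
  rewrite (expectD gauss (bounded_mfunD e0 e1) e2) (expectD gauss e0 e1).
  rewrite (expectZ gauss h (bounded_mfun_affine s a b1)).
  rewrite (expectZ gauss (h ^+ 2 / 2) (bounded_mfun_affine s a b2)) /heat; ring.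
apply: expect_dist_le; [exact: bounded_mfun_affine|exact: bounded_mfunD (bounded_mfunD e0 e1) e2|].
move=> z; have -> : a + h + s * z = a + s * z + h by ring.
have -> : psi (a + s * z) + h * psi1 (a + s * z) + h ^+ 2 / 2 * psi2 (a + s * z) =
  psi (a + s * z) + psi1 (a + s * z) * h + psi2 (a + s * z) / 2 * h ^+ 2 by ring.
exact: H.
Qed.

(** Rescaling by [c = Num.sqrt n%:R] divides the cubic constant by [n ^ (3 / 2)]:
    this is why the remainders of [n] steps add up to something negligible. *)
Lemma taylor_class_scale L B psi c : 0 < c -> taylor_class L B psi ->
  taylor_class (L / c ^+ 3) (B / c ^+ 2) (fun a => psi (a / c)).
Proof.
move=> c0 [bpsi [psi1 [psi2 [b1 b2 B2 H]]]].
have c00 : c != 0 by rewrite gt_eqF.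
have mc : measurable_fun setT (fun a : measurableTypeR R => a / c) by exact: measurable_funM.
split; first exact: (bounded_mfun_comp mc bpsi).
exists (fun a => c^-1 * psi1 (a / c)), (fun a => (c ^+ 2)^-1 * psi2 (a / c)); split.
- exact: (bounded_mfunZ _ (bounded_mfun_comp mc b1)).
- exact: (bounded_mfunZ _ (bounded_mfun_comp mc b2)).
- move=> a; rewrite normrM gtr0_norm ?invr_gt0 ?exprn_gt0// mulrC.
  by rewrite ler_pM2r// invr_gt0 exprn_gt0.
- move=> a h; have := H (a / c) (h / c).
  rewrite -mulrDl normrM normfV (gtr0_norm c0) expr_div_n.
  have -> : psi (a / c) + c^-1 * psi1 (a / c) * h + (c ^+ 2)^-1 * psi2 (a / c) / 2 * h ^+ 2 =
    psi (a / c) + psi1 (a / c) * (h / c) + psi2 (a / c) / 2 * (h ^+ 2 / c ^+ 2) by field.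
  by move/le_trans; apply; rewrite exprMn exprVn le_eqVlt; apply/orP; left; apply/eqP; ring.
Qed.

Lemma heat_add (u v : R) psi : 0 <= u -> 0 <= v -> continuous psi ->
  bounded_mfun (psi : measurableTypeR R -> R) ->
  heat (Num.sqrt u) (heat (Num.sqrt v) psi) = heat (Num.sqrt (u + v)) psi.
Proof.
move=> u0 v0 cpsi bpsi.
have [->|uN0] := eqVneq u 0; first by rewrite sqrtr0 heat0 add0r.
have [->|vN0] := eqVneq v 0; first by rewrite sqrtr0 heat0 addr0.
apply/funext => a; rewrite heat_semigroup ?sqrtr_gt0 ?lt_neqAle 1?eq_sym ?uN0 ?vN0//.
by rewrite !sqr_sqrtr.
Qed.

End smooth_functions.

Section lindeberg.
Context {R : realType} {d d'} {T : measurableType d} {T' : measurableType d'}.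
Variables (nu : probability T' R) (step : T * T' -> T) (phi : T * T' -> R) (C : R).
Hypothesis mstep : measurable_fun setT step.
Hypothesis mphi : measurable_fun setT phi.
Hypothesis phiC : forall z, `|phi z| <= C.
Hypothesis phi0 : forall x, \int[nu]_y phi (x, y) = 0.
Local Notation V := (transition nu step phi).
Local Notation sum_var := (sum_var nu step phi).

Lemma iter_transition_dist j (F G : T * R -> R) e z :
  locally_bounded_mfun F -> locally_bounded_mfun G ->
  (forall z, `|F z - G z| <= e) -> `|iter j V F z - iter j V G z| <= e.
Proof.
move=> lF lG FG; elim: j z => [//|j IH] z /=.
apply: expect_dist_le => [||y]; last exact: IH.
  exact: (bounded_mfun_next mstep mphi phiC z (locally_bounded_iter nu mstep mphi phiC j lF)).
exact: (bounded_mfun_next mstep mphi phiC z (locally_bounded_iter nu mstep mphi phiC j lG)).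
Qed.

Lemma bounded_mfun_snd (psi : R -> R) : bounded_mfun (psi : measurableTypeR R -> R) ->
  locally_bounded_mfun (fun z : T * R => psi z.2).
Proof.
move=> [mpsi [B HB]]; apply: locally_bounded_mfun_snd; first exact: mpsi.
by move=> A; exists B => a _.
Qed.

Variables (K s2 : R).
Hypothesis K0 : 0 <= K.
Hypothesis HK : forall (s L c1 c2 a : R) (psi : R -> R), 0 <= s ->
  bounded_mfun (psi : measurableTypeR R -> R) ->
  (forall h, `|psi (a + h) - (psi a + c1 * h + c2 / 2 * h ^+ 2)| <= L * `|h| ^+ 3) ->
  `|heat s psi a - (psi a + c2 / 2 * s ^+ 2)| <= L * K * s ^+ 3.
Hypothesis s20 : 0 <= s2.

(** Both averages have the same second-order expansion, up to the discrepancy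
    between the variance of the block and [r%:R * s2]. *)
Lemma block_compare r L B psi x a : 0 <= L -> taylor_class L B psi ->
  `|iter r V (fun z => psi z.2) (x, a) - heat (Num.sqrt (r%:R * s2)) psi a| <=
  B / 2 * `|sum_var r x - r%:R * s2| +
  (L * (C * r%:R) ^+ 3 + L * K * Num.sqrt (r%:R * s2) ^+ 3).
Proof.
move=> L0 [bpsi [psi1 [psi2 [b1 b2 B2 H]]]].
have C0 := bound_ge0 phiC x.
have rs0 : 0 <= r%:R * s2 by rewrite mulr_ge0.
have H1 := HK (sqrtr_ge0 (r%:R * s2)) bpsi (H a).
have H2 : `|iter r V (fun z => psi z.2) (x, a) - (psi a + psi2 a / 2 * sum_var r x)|
    <= L * (C * r%:R) ^+ 3.
  apply: (iter_transition_taylor mstep mphi phiC phi0 (c1 := psi1 a)).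
    exact: bounded_mfun_snd.
  move=> b bm; have := H a (b - a); rewrite (addrC a) subrK => /le_trans; apply.
  by rewrite ler_wpM2l// lerXn2r ?nnegrE// mulr_ge0.
rewrite sqr_sqrtr// in H1.
have H3 : `|psi2 a / 2 * (sum_var r x - r%:R * s2)| <= B / 2 * `|sum_var r x - r%:R * s2|.
  by rewrite normrM ler_wpM2r// normrM normfV (@gtr0_norm _ 2)// ler_pM2r.
set u := iter _ _ _ _ in H2 *; set v := heat _ _ _ in H1 *.
have -> : u - v = (u - (psi a + psi2 a / 2 * sum_var r x)) +
   (psi2 a / 2 * (sum_var r x - r%:R * s2) -
   (v - (psi a + psi2 a / 2 * (r%:R * s2)))) by ring.
rewrite (le_trans (ler_normD _ _))// addrCA lerD//.
by rewrite (le_trans (ler_normB _ _))// lerD.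
Qed.

(** Telescoping: Gaussian averages and transitions do not increase uniform
    distances, so replacing the blocks one at a time adds up their errors. The
    incomplete block of length [r] is the one next to the test function. *)
Lemma blocks_compare m r j e0 e1 L B psi : (r <= m)%N ->
  0 <= L -> taylor_class L B psi ->
  (forall phi x a, taylor_class L B phi ->
    `|iter r V (fun z => phi z.2) (x, a) - heat (Num.sqrt (r%:R * s2)) phi a| <= e0) ->
  (forall phi x a, taylor_class L B phi ->
    `|iter m V (fun z => phi z.2) (x, a) - heat (Num.sqrt (m%:R * s2)) phi a| <= e1) ->
  forall x a,
  `|iter (j * m + r) V (fun z => psi z.2) (x, a) -
    heat (Num.sqrt ((j * m + r)%:R * s2)) psi a| <= e0 + e1 *+ j.
Proof.
move=> rm L0 cpsi He0 He1; have bpsi := cpsi.1.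
elim: j => [|j IH] x a; first by rewrite mul0n add0n mulr0n addr0; exact: He0.
set n := (j * m + r)%N in IH *.
have nE : (j.+1 * m + r = m + n)%N by rewrite mulSn addnA.
rewrite nE iterD natrD mulrDl -heat_add ?mulr_ge0//; last exact: taylor_class_continuous cpsi.
set G := heat (Num.sqrt (n%:R * s2)) psi.
have lG : locally_bounded_mfun (fun z : T * R => G z.2).
  by apply: bounded_mfun_snd; exact: bounded_mfun_heat.
have lF := locally_bounded_iter nu mstep mphi phiC n (bounded_mfun_snd bpsi).
have := @iter_transition_dist m _ _ (e0 + e1 *+ j) (x, a) lF lG (fun z => _).
move=> /(_ (fun z => ltac:(by case: z => y b; exact: IH))) H1.
have H2 := He1 G x a (taylor_class_heat _ cpsi).
by rewrite (le_trans (ler_distD (iter m V (fun z => G z.2) (x, a)) _ _))// mulrSr addrA lerD.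
Qed.

End lindeberg.

Section uniform_clt.
Context {R : realType} {d d'} {T : measurableType d} {T' : measurableType d'}.
Variables (nu : probability T' R) (step : T * T' -> T) (phi : T * T' -> R) (C s2 : R).
Hypothesis mstep : measurable_fun setT step.
Hypothesis mphi : measurable_fun setT phi.
Hypothesis phiC : forall z, `|phi z| <= C.
Hypothesis phi0 : forall x, \int[nu]_y phi (x, y) = 0.
Hypothesis s20 : 0 <= s2.
Hypothesis sum_var_s2 : forall e : R, 0 < e -> exists2 m, (0 < m)%N &
  forall x, `|sum_var nu step phi m x - m%:R * s2| <= e * m%:R.
Local Notation V := (transition nu step phi).
Local Notation sum_var := (sum_var nu step phi).

Lemma heat_scale (n : nat) psi : (0 < n)%N ->
  heat (Num.sqrt (n%:R * s2)) (fun a => psi (a / Num.sqrt n%:R)) 0 =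
  heat (Num.sqrt s2) psi 0.
Proof.
move=> n0; apply: eq_Rintegral => z _; congr psi.
have q0 : Num.sqrt n%:R != 0 :> R by rewrite gt_eqF// sqrtr_gt0 ltr0n.
by rewrite !add0r sqrtrM//; field.
Qed.

(** Lindeberg's replacement, by blocks of [m] steps. A block has conditional
    variance close to [m%:R * s2] whatever its starting point, so replacing it by a
    Gaussian of that variance costs a small multiple of [m%:R / n%:R] for the
    variances, plus a cubic remainder of order [n ^ (- 3 / 2)]. *)
Lemma uniform_clt (L B : R) psi : 0 <= L -> taylor_class L B psi ->
  forall e : R, 0 < e -> exists N, forall n, (N <= n)%N -> forall x,
  `|iter n V (fun z => psi (z.2 / Num.sqrt n%:R)) (x, 0) -
    heat (Num.sqrt s2) psi 0| <= e.
Proof.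
move=> L0 cpsi e e0; have [K K0 HK] := @heat_taylor R.
have B0 : 0 <= B.
  by case: cpsi => _ [? [psi2 [_ _ HB _]]]; rewrite (le_trans _ (HB 0)).
have C0 : 0 <= C := bound_ge0 phiC point.
(* The variances of the blocks may deviate by [del * m%:R]; over [n / m] blocks
   this costs [B * del / 2 <= e / 2]. *)
have [m m0 Hm] := sum_var_s2 (divr_gt0 e0 (ltr_pwDr ltr01 B0)).
set del := e / (B + 1) in Hm.
have del0 : 0 < del by rewrite divr_gt0// ltr_pwDr.
pose A := (C * m%:R) ^+ 3 + K * Num.sqrt (m%:R * s2) ^+ 3.
pose D := (C ^+ 2 + s2) * m%:R.
have A0 : 0 <= A by apply: addr_ge0; [rewrite exprn_ge0// mulr_ge0|rewrite mulr_ge0// exprn_ge0// sqrtr_ge0].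
have D0 : 0 <= D by apply: mulr_ge0 => //; rewrite addr_ge0// sqr_ge0.
(* [E / Num.sqrt n%:R] bounds the incomplete block and all the cubic remainders. *)
pose E := B * D / 2 + 2 * L * A.
have E0 : 0 <= E by apply: addr_ge0; [rewrite divr_ge0// mulr_ge0|rewrite mulr_ge0// mulr_ge0].
exists (Num.truncn ((2 * E / e) ^+ 2)).+1 => n nN x.
have n0 : (0 < n)%N by rewrite (leq_trans _ nN).
have nE : (2 * E / e) ^+ 2 <= n%:R.
  by rewrite (le_trans (ltW (truncnS_gt _)))// ler_nat.
pose q : R := Num.sqrt n%:R.
have q1 : 1 <= q by rewrite -sqrtr1 ler_wsqrtr// ler1n.
have q0 : 0 < q by rewrite (lt_le_trans _ q1).
have q2 : q ^+ 2 = n%:R by rewrite sqr_sqrtr.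
have qE : 2 * E / e <= q.
  rewrite -(@ger0_norm _ (2 * E / e)) ?divr_ge0 ?mulr_ge0// ?(ltW e0)//.
  by rewrite -sqrtr_sqr ler_wsqrtr.
have cpsin := taylor_class_scale q0 cpsi; rewrite q2 in cpsin.
have Lq0 : 0 <= L / q ^+ 3 by rewrite divr_ge0// exprn_ge0// ltW.
have Bn0 : 0 <= B / n%:R / 2 by rewrite !divr_ge0.
have remle r : (r <= m)%N -> L / q ^+ 3 * (C * r%:R) ^+ 3 +
    L / q ^+ 3 * K * Num.sqrt (r%:R * s2) ^+ 3 <= L / q ^+ 3 * A.
  move=> rm; rewrite -[L / q ^+ 3 * K * _]mulrA -mulrDr ler_wpM2l// /A lerD//.
    by rewrite lerXn2r ?nnegrE ?mulr_ge0// ler_wpM2l// ler_nat.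
  rewrite ler_wpM2l// lerXn2r ?nnegrE ?sqrtr_ge0// ler_wsqrtr//.
  by rewrite ler_wpM2r// ler_nat.
pose e0' := B / n%:R / 2 * D + L / q ^+ 3 * A.
pose e1' := B / n%:R / 2 * (del * m%:R) + L / q ^+ 3 * A.
pose r := (n %% m)%N; pose j := (n %/ m)%N.
have rm : (r <= m)%N by rewrite ltnW// ltn_mod.
have njr : n = (j * m + r)%N by rewrite /j /r -divn_eq.
have H := @blocks_compare _ _ _ _ _ nu step phi C mstep mphi phiC s2 s20 m r j
  e0' e1' _ _ (fun a => psi (a / q)) rm Lq0 cpsin.
have {}H := H _ _ x 0.
rewrite -(heat_scale psi n0) -/q {1 2}njr.
apply: (le_trans (H _ _)).
- move=> phi' y a cphi'.
  apply: (le_trans (block_compare mstep mphi phiC phi0 HK s20 r y a Lq0 cphi')).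
  apply: lerD; last exact: remle.
  rewrite ler_wpM2l// (le_trans (ler_normB _ _))// /D.
  have /andP[v0 v1] := sum_var_bounds nu mstep mphi phiC r y.
  rewrite !ger0_norm ?mulr_ge0// mulrDl lerD//.
    by rewrite (le_trans v1)// ler_wpM2l ?sqr_ge0// ler_nat.
  by rewrite mulrC ler_wpM2l// ler_nat.
- move=> phi' y a cphi'.
  apply: (le_trans (block_compare mstep mphi phiC phi0 HK s20 m y a Lq0 cphi')).
  by apply: lerD; [rewrite ler_wpM2l|exact: remle].
rewrite /e0' /e1' -[_ *+ j]mulr_natr.
have jm : (j%:R * m%:R : R) <= n%:R by rewrite -natrM ler_nat njr leq_addr.
have jn : (1 + j%:R : R) <= 2 * n%:R.
  have h1 : 1 <= n%:R :> R by rewrite ler1n.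
  by have : (j%:R : R) <= n%:R by [rewrite ler_nat leq_div]; lra.
have t1 : B / n%:R / 2 * (del * m%:R) * j%:R <= e / 2.
  have -> : B / n%:R / 2 * (del * m%:R) * j%:R =
    (B * del / 2) * (j%:R * m%:R / n%:R) by field; rewrite pnatr_eq0 -lt0n.
  apply: (@le_trans _ _ (B * del / 2)).
    have Bd0 : 0 <= B * del / 2 by rewrite divr_ge0// mulr_ge0// ltW.
    rewrite ler_piMr//.
    by rewrite ler_pdivrMr ?ltr0n// mul1r.
  rewrite ler_pM2r// /del mulrCA ler_piMr ?(ltW e0)//.
  by rewrite ler_pdivrMr ?ltr_pwDr// mul1r lerDl.
have t2 : L / q ^+ 3 * A * (1 + j%:R) <= 2 * L * A / q.
  apply: (@le_trans _ _ (L / q ^+ 3 * A * (2 * n%:R))).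
    by rewrite ler_wpM2l// mulr_ge0.
  by rewrite -q2 le_eqVlt; apply/orP; left; apply/eqP; field; rewrite gt_eqF.
have t3 : B / n%:R / 2 * D <= B * D / 2 / q.
  have -> : B / n%:R / 2 * D = B * D / 2 / n%:R by field; rewrite pnatr_eq0 -lt0n.
  have BD0 : 0 <= B * D / 2 by rewrite divr_ge0// mulr_ge0.
  rewrite ler_wpM2l// -q2 lef_pV2 ?posrE ?exprn_gt0//.
  by rewrite expr2 ler_peMl// ltW.
have t4 : E / q <= e / 2.
  rewrite ler_pdivrMr//.
  by move: qE; rewrite ler_pdivrMr// => qE; lra.
have E4 : E / q = B * D / 2 / q + 2 * L * A / q by rewrite /E mulrDl.
rewrite mulrDl.
move: t2; rewrite [_ * (1 + _)]mulrDr mulr1 => t2.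
lra.
Qed.

End uniform_clt.

(** * Exponential moments *)

Section exponential_moments.
Context {R : realType} {d d'} {T : measurableType d} {T' : measurableType d'}.
Variables (nu : probability T' R) (step : T * T' -> T) (phi : T * T' -> R) (C s2 : R).
Hypothesis mstep : measurable_fun setT step.
Hypothesis mphi : measurable_fun setT phi.
Hypothesis phiC : forall z, `|phi z| <= C.
Hypothesis phi0 : forall x, \int[nu]_y phi (x, y) = 0.
Hypothesis s20 : 0 <= s2.
Hypothesis sum_var_s2 : forall e : R, 0 < e -> exists2 m, (0 < m)%N &
  forall x, `|sum_var nu step phi m x - m%:R * s2| <= e * m%:R.
Local Notation V := (transition nu step phi).
Local Notation sum_var := (sum_var nu step phi).

Lemma locally_bounded_expR l : locally_bounded_mfun (fun z : T * R => expR (l * z.2)).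
Proof.
apply: (locally_bounded_mfun_snd (psi := fun a => expR (l * a))).
  by apply: measurableT_comp => //; exact: measurable_funM.
move=> A; exists (expR (`|l| * A)) => a aA.
rewrite ger0_norm ?expR_ge0// ler_expR (le_trans (ler_norm _))//.
by rewrite normrM ler_wpM2l.
Qed.

(** The sum moves by at most [C * r%:R]; this crude bound serves the incomplete block. *)
Lemma iter_transition_expR_le r l x a : 0 <= l ->
  iter r V (fun z => expR (l * z.2)) (x, a) <= expR (l * (C * r%:R)) * expR (l * a).
Proof.
move=> l0.
have := @iter_transition_quadratic _ _ _ _ _ nu step phi C mstep mphi phiC phi0 r
  (expR (l * (C * r%:R)) * expR (l * a)) 0 0 x a.
rewrite !mul0r !addr0 => <-.
apply: (iter_transition_le nu mstep mphi phiC).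
- exact: locally_bounded_expR.
- apply: (locally_bounded_mfun_snd (psi := fun b : R =>
    expR (l * (C * r%:R)) * expR (l * a) + 0 * b + 0 * b ^+ 2)).
    apply: measurable_funD; first by apply: measurable_funD => //; exact: measurable_funM.
    by apply: measurable_funM => //; exact: measurable_funX.
  move=> A; exists `|expR (l * (C * r%:R)) * expR (l * a)| => b _.
  by rewrite !mul0r !addr0.
- move=> y b ab; rewrite !mul0r !addr0 -expRD ler_expR/= -mulrDr ler_wpM2l//.
  by rewrite -lerBlDr (le_trans (ler_norm _)).
Qed.

(** Over one block, the second-order expansion of the exponential gives a factor at
    most [1 + l ^+ 2 / 2 * (s2 + e) * m%:R], hence at most the exponential of the
    same quantity; the blocks then multiply. *)
Lemma exponential_moment e : 0 < e -> exists2 l0, 0 < l0 &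
  forall l, 0 <= l <= l0 -> forall n x a,
  iter n V (fun z => expR (l * z.2)) (x, a) <=
  expR 1 * expR (l ^+ 2 / 2 * (s2 + e) * n%:R) * expR (l * a).
Proof.
move=> e0; have [m m0 Hm] := sum_var_s2 (divr_gt0 e0 (ltr0n _ 2)).
have C0 : 0 <= C := bound_ge0 phiC point.
pose M := C * m%:R; have M0 : 0 <= M by rewrite mulr_ge0.
have e1 : 0 < expR 1 :> R := expR_gt0 1.
(* The first bound keeps [l * M <= 1] in the exponential of the remainder; the
   second makes the cubic term at most half of the slack [e]. *)
pose l0 := Num.min ((M + 1)^-1) (e * m%:R / 4 / (M ^+ 3 * expR 1 + 1)).
have D1 : 0 < M ^+ 3 * expR 1 + 1 by rewrite ltr_pwDr// mulr_ge0 ?exprn_ge0 ?expR_ge0.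
have l00 : 0 < l0.
  rewrite lt_min invr_gt0 ltr_pwDr//= divr_gt0// divr_gt0// mulr_gt0// ltr0n//.
exists l0 => // l /andP[lge0 ll0].
have lM : l * M <= 1.
  have : l <= (M + 1)^-1 by rewrite (le_trans ll0)// ge_min lexx.
  move=> H; apply: (le_trans (ler_wpM2r M0 H)).
  by rewrite mulrC ler_pdivrMr ?mul1r ?lerDl ?ltr_pwDr.
have lM3 : l * (M ^+ 3 * expR 1) <= e * m%:R / 4.
  have : l <= e * m%:R / 4 / (M ^+ 3 * expR 1 + 1).
    by rewrite (le_trans ll0)// ge_min lexx orbT.
  rewrite ler_pdivlMr// => H; apply: (le_trans _ H).
  by rewrite ler_wpM2l// lerDl.
have block x a : iter m V (fun z => expR (l * z.2)) (x, a) <=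
    expR (l ^+ 2 / 2 * (s2 + e) * m%:R) * expR (l * a).
  have := @iter_transition_taylor _ _ _ _ _ nu step phi C mstep mphi phiC phi0 m
    (fun b => expR (l * b)) (l * expR (l * a)) (l ^+ 2 * expR (l * a))
    (expR (l * a) * (l ^+ 3 * (M ^+ 3 * expR 1))) x a (locally_bounded_expR l).
  have H b : `|b - a| <= C * m%:R -> `|expR (l * b) - (expR (l * a) + l * expR (l * a) * (b - a) +
      l ^+ 2 * expR (l * a) / 2 * (b - a) ^+ 2)| <= expR (l * a) * (l ^+ 3 * (M ^+ 3 * expR 1)).
    move=> abM; have := expR_taylor2 (l * (b - a)).
    have -> : expR (l * b) - (expR (l * a) + l * expR (l * a) * (b - a) +
      l ^+ 2 * expR (l * a) / 2 * (b - a) ^+ 2) = expR (l * a) *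
      (expR (l * (b - a)) - (1 + l * (b - a) + (l * (b - a)) ^+ 2 / 2)).
      by rewrite (_ : l * b = l * a + l * (b - a)) ?expRD; [field|ring].
    move=> H; rewrite normrM (ger0_norm (expR_ge0 _)).
    rewrite ler_pM2l ?expR_gt0// (le_trans H)// normrM (ger0_norm lge0) mulrA -exprMn.
    have lab : l * `|b - a| <= l * M by rewrite ler_wpM2l.
    apply: ler_pM; rewrite ?exprn_ge0 ?expR_ge0 ?mulr_ge0//.
      by rewrite lerXn2r ?nnegrE ?mulr_ge0.
    by rewrite ler_expR (le_trans lab).
  move=> /(_ H); rewrite ler_distl => /andP[_]; move/le_trans; apply.
  rewrite [leRHS]mulrC.
  have -> : expR (l * a) + l ^+ 2 * expR (l * a) / 2 * sum_var m x +
    expR (l * a) * (l ^+ 3 * (M ^+ 3 * expR 1)) =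
    expR (l * a) * (1 + (l ^+ 2 / 2 * sum_var m x + l ^+ 2 * (l * (M ^+ 3 * expR 1)))).
    by field.
  rewrite ler_pM2l ?expR_gt0//; apply: (le_trans (expR_ge1Dx _)); rewrite ler_expR.
  have l2 : 0 <= l ^+ 2 by exact: sqr_ge0.
  have t1 : l ^+ 2 * (l * (M ^+ 3 * expR 1)) <= l ^+ 2 * (e * m%:R / 4) by rewrite ler_wpM2l.
  have t2 : l ^+ 2 / 2 * sum_var m x <= l ^+ 2 / 2 * (m%:R * s2 + e / 2 * m%:R).
    have := Hm x; rewrite ler_distl => /andP[_ H2].
    by rewrite ler_wpM2l// divr_ge0.
  have -> : l ^+ 2 / 2 * (s2 + e) * m%:R = l ^+ 2 / 2 * (m%:R * s2 + e / 2 * m%:R) +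
    l ^+ 2 * (e * m%:R / 4) by field.
  by rewrite lerD.
move=> n x a.
have le2 : 0 <= l ^+ 2 / 2 * (s2 + e).
  by rewrite mulr_ge0 ?divr_ge0 ?sqr_ge0// addr_ge0// ltW.
have main j r y b : (r <= m)%N -> iter (j * m + r) V (fun z => expR (l * z.2)) (y, b) <=
    expR 1 * expR (l ^+ 2 / 2 * (s2 + e) * (j * m)%:R) * expR (l * b).
  move=> rm; elim: j y b => [|j IH] y b.
    rewrite mul0n add0n mulr0 expR0 mulr1 (le_trans (iter_transition_expR_le _ _ _ lge0))//.
    rewrite ler_pM2r ?expR_gt0// ler_expR (le_trans _ lM)// ler_wpM2l//.
    by rewrite ler_wpM2l// ler_nat.
  rewrite mulSn -addnA iterD.
  set c := expR 1 * expR (l ^+ 2 / 2 * (s2 + e) * (j * m)%:R) in IH.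
  apply: (@le_trans _ _ (iter m V (fun z => c * expR (l * z.2)) (y, b))).
    apply: (iter_transition_le nu mstep mphi phiC) => //.
    - apply: (locally_bounded_iter nu mstep mphi phiC); exact: locally_bounded_expR.
    - have [m1 b1] := locally_bounded_expR l.
      split; first exact: measurable_funM.
      move=> A; have [B HB] := b1 A; exists (`|c| * B) => y' b' /HB H.
      by rewrite normrM ler_wpM2l.
  rewrite (iter_transitionZ nu mstep mphi phiC); last exact: locally_bounded_expR.
  apply: (le_trans (ler_wpM2l _ (block y b))); first by rewrite mulr_ge0 ?expR_ge0.
  rewrite mulrA ler_pM2r ?expR_gt0// /c -[expR 1 * _ * _]mulrA -expRD -mulrDr -natrD.
  by rewrite addnC.
rewrite {1}(divn_eq n m); apply: (le_trans (main _ _ _ _ _)).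
  by rewrite ltnW// ltn_mod.
rewrite ler_pM2r ?expR_gt0// ler_pM2l// ler_expR ler_wpM2l// ler_nat.
by rewrite leq_trunc_div.
Qed.

End exponential_moments.

(** * Splines and convergence in distribution *)

Section spline.
Context {R : realType}.
Implicit Types x a h : R.

Definition posp x : R := Num.max x 0.

(** The integral of the quadratic B-spline: a smooth step from [0] to [1] whose
    second derivative is Lipschitz. *)
Definition spline x : R :=
  (posp x ^+ 3 - 3 * posp (x - 1) ^+ 3 + 3 * posp (x - 2) ^+ 3 - posp (x - 3) ^+ 3) / 6.

Definition bspline x : R := spline x - spline (x - 1).

Lemma measurable_posp : measurable_fun setT (posp : measurableTypeR R -> R).
Proof. by apply: measurable_maxr => //; exact: measurable_cst. Qed.

(** The cube of the positive part is twice differentiable with a Lipschitz second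
    derivative; it is the building block of the splines. *)
Lemma posp_cube_taylor a h :
  `|posp (a + h) ^+ 3 - (posp a ^+ 3 + 3 * posp a ^+ 2 * h + 3 * posp a * h ^+ 2)|
  <= `|h| ^+ 3.
Proof.
have e : `|h| ^+ 3 = `|h ^+ 3| by rewrite normrX.
rewrite /posp; have [ah0|ah0] := leP (a + h) 0; have [a0|a0] := leP a 0.
- by rewrite !expr0n/= !mulr0 !mul0r !addr0 subrr normr0 exprn_ge0.
- have h0 : h < 0 by lra.
  rewrite expr0n/= add0r (ltr0_norm h0).
  have -> : - (a ^+ 3 + 3 * a ^+ 2 * h + 3 * a * h ^+ 2) = (- (a + h)) ^+ 3 - (- h) ^+ 3.
    by ring.
  have H : (- (a + h)) ^+ 3 <= (- h) ^+ 3 by rewrite lerXn2r ?nnegrE; lra.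
  have H0 : 0 <= (- (a + h)) ^+ 3 by rewrite exprn_ge0//; lra.
  by rewrite ler_norml; apply/andP; split; lra.
- rewrite !expr0n/= !mulr0 !mul0r !addr0 subr0 ger0_norm ?exprn_ge0 ?(ltW ah0)//.
  rewrite gtr0_norm; last by lra.
  by rewrite lerXn2r ?nnegrE; lra.
- have -> : (a + h) ^+ 3 - (a ^+ 3 + 3 * a ^+ 2 * h + 3 * a * h ^+ 2) = h ^+ 3 by ring.
  by rewrite e.
Qed.

Lemma posp_bounds x : x <= 3 -> 0 <= posp x <= 3.
Proof. by move=> x3; rewrite /posp le_max lexx orbT/= ge_max x3/=; lra. Qed.

Let posp_le0 x : x <= 0 -> posp x = 0.
Proof. by move=> x0; rewrite /posp; exact/max_idPr. Qed.

Let posp_ge0 x : 0 <= x -> posp x = x.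
Proof. by move=> x0; rewrite /posp; exact/max_idPl. Qed.

Lemma spline_le0 x : x <= 0 -> spline x = 0.
Proof.
by move=> x0; rewrite /spline !posp_le0 ?expr0n/= ?mulr0 ?subrr ?addr0 ?subrr ?mul0r//; lra.
Qed.

Lemma spline_ge3 x : 3 <= x -> spline x = 1.
Proof. by move=> x0; rewrite /spline !posp_ge0; [field|lra..]. Qed.

Let spline01 x : 0 <= x <= 1 -> spline x = x ^+ 3 / 6.
Proof.
move=> /andP[x0 x1]; rewrite /spline (posp_ge0 x0) !posp_le0 ?expr0n/=; [|lra..].
by field.
Qed.

Let spline12 x : 1 <= x <= 2 -> spline x = (x ^+ 3 - 3 * (x - 1) ^+ 3) / 6.
Proof.
move=> /andP[x0 x1]; rewrite /spline (posp_ge0 (x := x)); last lra.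
rewrite (posp_ge0 (x := x - 1)); last lra.
by rewrite !posp_le0 ?expr0n/=; [field|lra..].
Qed.

Let spline23 x : 2 <= x <= 3 -> spline x = 1 - (3 - x) ^+ 3 / 6.
Proof.
move=> /andP[x0 x1]; rewrite /spline (posp_ge0 (x := x)); last lra.
rewrite (posp_ge0 (x := x - 1)); last lra.
rewrite (posp_ge0 (x := x - 2)); last lra.
by rewrite !posp_le0 ?expr0n/=; [field|lra..].
Qed.

Let cube01 (y : R) : 0 <= y <= 1 -> [/\ 0 <= y ^+ 3, y ^+ 3 <= y ^+ 2, y ^+ 2 <= y & 0 <= y ^+ 2].
Proof.
move=> /andP[y0 y1]; split; [exact: exprn_ge0| |by rewrite expr2 ler_piMl|exact: sqr_ge0].
by rewrite exprS ler_piMl// sqr_ge0.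
Qed.

Lemma spline_bounds x : 0 <= spline x <= 1.
Proof.
have [x0|x0] := leP x 0; first by rewrite spline_le0// lexx ler01.
have [x1|x1] := leP x 1.
  have x01 : 0 <= x <= 1 by rewrite x1 ltW.
  by rewrite spline01//; have [? ? ? ?] := cube01 x01; apply/andP; split; lra.
have [x2|x2] := leP x 2.
  have x12 : 1 <= x <= 2 by rewrite x2 ltW.
  have y01 : 0 <= x - 1 <= 1 by apply/andP; split; lra.
  rewrite spline12//; have [? ? ? ?] := cube01 y01.
  have -> : x ^+ 3 = 1 + 3 * (x - 1) + 3 * (x - 1) ^+ 2 + (x - 1) ^+ 3 by ring.
  have : 0 <= (x - 1) * (1 - (x - 1)) ^+ 2 by rewrite mulr_ge0 ?sqr_ge0//; lra.
  have -> : (x - 1) * (1 - (x - 1)) ^+ 2 = x - 1 - 2 * (x - 1) ^+ 2 + (x - 1) ^+ 3 by ring.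
  by move=> ?; apply/andP; split; lra.
have [x3|x3] := leP x 3; last by rewrite spline_ge3 ?ler01 ?lexx// ltW.
have x23 : 2 <= x <= 3 by rewrite x3 ltW.
have y01 : 0 <= 3 - x <= 1 by apply/andP; split; lra.
by rewrite spline23//; have [? ? ? ?] := cube01 y01; apply/andP; split; lra.
Qed.

Lemma bspline_ge0 x : 0 <= bspline x.
Proof.
rewrite /bspline; have [x0|x0] := leP x 0; first by rewrite !spline_le0; lra.
have [x1|x1] := leP x 1.
  by rewrite (spline_le0 (x := x - 1)) ?subr0; [have /andP[] := spline_bounds x|lra].
have [x2|x2] := leP x 2.
  have y01 : 0 <= x - 1 <= 1 by apply/andP; split; lra.
  rewrite spline12 ?(ltW x1)// spline01//; have [? ? ? ?] := cube01 y01.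
  have -> : x ^+ 3 = 1 + 3 * (x - 1) + 3 * (x - 1) ^+ 2 + (x - 1) ^+ 3 by ring.
  by lra.
have [x3|x3] := leP x 3.
  have y01 : 0 <= x - 2 <= 1 by apply/andP; split; lra.
  rewrite spline23 ?(ltW x2)// spline12; last by apply/andP; split; lra.
  have [? ? ? ?] := cube01 y01.
  have -> : (x - 1) ^+ 3 = 1 + 3 * (x - 2) + 3 * (x - 2) ^+ 2 + (x - 2) ^+ 3 by ring.
  have -> : (3 - x) ^+ 3 = 1 - 3 * (x - 2) + 3 * (x - 2) ^+ 2 - (x - 2) ^+ 3 by ring.
  have -> : x - 1 - 1 = x - 2 by ring.
  have : 0 <= (x - 2) * (1 - (x - 2)) ^+ 2 by rewrite mulr_ge0 ?sqr_ge0//; lra.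
  have -> : (x - 2) * (1 - (x - 2)) ^+ 2 = x - 2 - 2 * (x - 2) ^+ 2 + (x - 2) ^+ 3 by ring.
  by lra.
by rewrite spline_ge3 ?(ltW x3)// subr_ge0; have /andP[] := spline_bounds (x - 1).
Qed.

Lemma bspline_eq0 x : x <= 0 \/ 4 <= x -> bspline x = 0.
Proof.
rewrite /bspline => -[x0|x4]; first by rewrite !spline_le0 ?subrr; lra.
by rewrite !spline_ge3 ?subrr; lra.
Qed.

(** The expansions of the four cubes combine with total weight
    [(1 + 3 + 3 + 1) / 6 <= 2]. Beyond [3] the spline is constant, so its formal
    derivatives are bounded although each positive part is not. *)
Lemma spline_taylor_class : exists B, taylor_class 2 B spline.
Proof.
(* The third difference of [c], of which [spline] and its derivatives are instances. *)
pose D (c : R -> R) x := (c x - 3 * c (x - 1) + 3 * c (x - 2) - c (x - 3)) / 6.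
have mD (c : R -> R) : measurable_fun setT (c : measurableTypeR R -> R) ->
    measurable_fun setT (D c : measurableTypeR R -> R).
  move=> mc.
  have mB t : measurable_fun setT (fun x : measurableTypeR R => c (x - t)).
    by apply: (measurableT_comp mc); exact: measurable_funB.
  apply: measurable_funM => //; apply: measurable_funB => //.
  apply: measurable_funD; last exact: measurable_funM.
  by apply: measurable_funB => //; exact: measurable_funM.
have bD (c : R -> R) K : (forall x, x <= 3 -> `|c x| <= K) -> forall x, x <= 3 ->
    `|D c x| <= (K + 3 * K + 3 * K + K) / 6.
  move=> cK x x3; rewrite normrM (@ger0_norm _ 6^-1) ?invr_ge0// ler_wpM2r ?invr_ge0//.
  have [] : [/\ x - 1 <= 3, x - 2 <= 3 & x - 3 <= 3] by split; lra.
  move=> /cK + /cK + /cK; have := cK x x3.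
  by rewrite !ler_norml => /andP[? ?] /andP[? ?] /andP[? ?] /andP[? ?]; apply/andP; split; lra.
have mp n : measurable_fun setT (fun x : measurableTypeR R => posp x ^+ n).
  by apply: measurable_funX; exact: measurable_posp.
have bp n x : x <= 3 -> `|posp x ^+ n| <= 3 ^+ n.
  move=> /posp_bounds/andP[p0 p3]; rewrite normrX ger0_norm//.
  by rewrite lerXn2r ?nnegrE.
have bD' n k : (forall x, 3 <= x -> D (fun x => k * posp x ^+ n) x = 0) ->
    exists B, forall x, `|D (fun x => k * posp x ^+ n) x| <= B.
  move=> H; eexists => x; have [x3|x3] := leP x 3.
    apply: (bD _ (`|k| * 3 ^+ n)) => // y y3.
    by rewrite normrM ler_wpM2l// bp.
  rewrite H ?(ltW x3)// normr0 divr_ge0// !addr_ge0// ?mulr_ge0// ?mulr_ge0// exprn_ge0//.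
have [B1 HB1] : exists B, forall x, `|D (fun x => 3 * posp x ^+ 2) x| <= B.
  by apply: bD' => x x3; rewrite /D !posp_ge0; [field|lra..].
have [B2 HB2] : exists B, forall x, `|D (fun x => 6 * posp x ^+ 1) x| <= B.
  by apply: bD' => x x3; rewrite /D !posp_ge0; [field|lra..].
exists B2; split.
  split; first exact: (mD _ (mp 3%N)).
  by exists 1 => x; have /andP[s0 s1] := spline_bounds x; rewrite ger0_norm.
exists (D (fun x => 3 * posp x ^+ 2)), (D (fun x => 6 * posp x ^+ 1)); split => //.
- by split; [apply: mD; exact: measurable_funM|exists B1].
- by split; [apply: mD; exact: measurable_funM|exists B2].
- move=> a h; rewrite /spline /D !expr1.
  have := posp_cube_taylor (a - 3) h; have := posp_cube_taylor (a - 2) h.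
  have := posp_cube_taylor (a - 1) h; have := posp_cube_taylor a h.
  rewrite !(addrAC a _ h).
  set r0 := posp (a + h) ^+ 3 - _; set r1 := posp (a + h - 1) ^+ 3 - _.
  set r2 := posp (a + h - 2) ^+ 3 - _; set r3 := posp (a + h - 3) ^+ 3 - _.
  move=> H0 H1 H2 H3.
  set X := (X in `|X|); have -> : X = (r0 - 3 * r1 + 3 * r2 - r3) / 6.
    by rewrite /X /r0 /r1 /r2 /r3; field.
  have h3 : 0 <= `|h| ^+ 3 by rewrite exprn_ge0.
  rewrite ler_norml; move: H0 H1 H2 H3; rewrite !ler_norml.
  by move=> /andP[? ?] /andP[? ?] /andP[? ?] /andP[? ?]; apply/andP; split; lra.
Qed.

Lemma taylor_class_shift (L B b : R) psi : taylor_class L B psi ->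
  taylor_class L B (fun a => psi (a - b)).
Proof.
move=> [bpsi [psi1 [psi2 [b1 b2 B2 H]]]].
have mb : measurable_fun setT (fun a : measurableTypeR R => a - b) by exact: measurable_funB.
split; first exact: (bounded_mfun_comp mb bpsi).
exists (fun a => psi1 (a - b)), (fun a => psi2 (a - b)); split => //.
- exact: (bounded_mfun_comp mb b1).
- exact: (bounded_mfun_comp mb b2).
- by move=> a h; rewrite addrAC; exact: H.
Qed.

End spline.

Section weak_convergence.
Context {R : realType}.

(** Uniform continuity on a segment, one of the two points being allowed to leave
    the segment. *)
Lemma continuous_uniform_itv (g : R -> R) (A e : R) : continuous g -> 0 < e ->
  exists2 del, 0 < del & forall x y, -A <= x <= A -> `|x - y| < del -> `|g x - g y| <= e.
Proof.
move=> cg e0; have /compact_near_coveringP cK := @segment_compact R (- A) A.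
have := cK R (0^'+) (fun del x => forall y, `|x - y| < del -> `|g x - g y| <= e) _.
have H : forall x, `[- A, A]%classic x -> \forall x' \near x & i \near 0^'+,
    forall y, `|x' - y| < i -> `|g x' - g y| <= e.
  move=> x _; have /cvgrPdist_lt/(_ (e / 2)) := cg x.
  rewrite divr_gt0// => /(_ isT) [r /= r0 Hr].
  exists ([set x' | `|x - x'| < r / 2], [set i : R | i < r / 2]) => /=.
    split; first by exists (r / 2) => /=; [rewrite divr_gt0|].
    by exists (r / 2) => /=; [rewrite divr_gt0|move=> i /=; rewrite sub0r normrN => /(le_lt_trans (ler_norm _))].
  move=> [x' i] /= [xx' ir] y x'y.
  have h1 : `|g x - g x'| < e / 2 by apply: Hr => /=; lra.
  have h2 : `|g x - g y| < e / 2.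
    apply: Hr => /=; rewrite (le_lt_trans (ler_distD x' _ _))//; lra.
  rewrite (le_trans (ler_distD (g x) _ _))// distrC; lra.
move=> /(_ _ H) [r /= r0 Hr]; exists (r / 2); first by rewrite divr_gt0.
move=> x y xA xy; apply: (Hr (r / 2)) => //=.
- by rewrite sub0r normrN gtr0_norm ?divr_gt0//; lra.
- by rewrite divr_gt0.
Qed.

Lemma probability_tail (m : probability (measurableTypeR R) R) (e : R) : 0 < e ->
  exists n : nat, 1 - e <= \int[m]_x \1_`[- n%:R, n%:R] x.
Proof.
move=> e0; pose F n : set (measurableTypeR R) := `[- n%:R, n%:R]%classic.
have mF n : measurable (F n) by exact: measurable_itv.
have bF : \bigcup_n F n = setT.
  rewrite -subTset => x _; exists (Num.truncn `|x|).+1 => //=.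
  by rewrite /F/= in_itv/= -ler_norml ltW// truncnS_gt.
have : m (F n) @[n --> \oo] --> m (\bigcup_n F n).
  apply: nondecreasing_cvg_mu => //; first by rewrite bF.
  move=> a b ab; apply/subsetPset => x; rewrite /F/= !in_itv/= -!ler_norml => /le_trans; apply.
  by rewrite ler_nat.
rewrite bF (_ : m setT = 1%E); last exact: probability_setT.
move=> /fine_cvgP[_] /cvgrPdist_le /(_ e e0)[N _ /(_ N (leqnn N))] /= H.
exists N; rewrite /Rintegral integral_indic//.
by rewrite setIT; move: H; rewrite ler_norml /F => /andP[_]; lra.
Qed.

Lemma expect_dist_le_fun d (T : measurableType d) (P : probability T R) (u v w : T -> R) :
  bounded_mfun u -> bounded_mfun v -> bounded_mfun w ->
  (forall x, `|u x - v x| <= w x) ->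
  `|\int[P]_x u x - \int[P]_x v x| <= \int[P]_x w x.
Proof.
move=> bu bv bw H; rewrite -(expectB P bu bv).
rewrite (le_trans (le_normr_Rintegral _ (bounded_mfun_integrable P (bounded_mfunB bu bv))))//.
apply: expect_le => //; exact: bounded_mfun_norm (bounded_mfunB bu bv).
Qed.

(** The translates [bspline (k * x - i)] form a partition of unity, so a continuous
    function is uniformly close, on an interval, to a combination of them; what
    happens outside is controlled by the total mass of the partition. *)
Lemma weak_cvg_of_spline d (Omega : measurableType d) (P : probability Omega R)
    (Y : nat -> Omega -> R) (m : probability (measurableTypeR R) R) :
  (forall n, measurable_fun setT (Y n)) ->
  (forall k b : R, 0 < k ->
    \int[P]_w spline (k * Y n w - b) @[n --> \oo] --> \int[m]_x spline (k * x - b)) ->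
  cvg_in_distribution P Y m.
Proof.
move=> mY HY g cg bg.
have [B [B0 HB]] : exists B, 0 <= B /\ forall x, `|g x| <= B.
  have [M [_ HM]] := bg; exists (`|M| + 1); split; first by rewrite addr_ge0.
  by move=> x; apply: HM => //; rewrite (le_lt_trans (ler_norm M))// ltrDl.
have [BS bspl] := @spline_taylor_class R.
have bgm : bounded_mfun (g : measurableTypeR R -> R).
  by split; [exact: continuous_measurable_fun|exists B].
have mYn n : measurable_fun setT (Y n : Omega -> measurableTypeR R) := mY n.
suff : \int[P]_w g (Y n w) @[n --> \oo] --> \int[m]_x g x.
  move=> H; rewrite -(EFin_expect m bgm).
  have -> : (fun n => \int[P]_w (g (Y n w))%:E)%E = (fun n => (\int[P]_w g (Y n w))%:E).
    apply/funext => n; rewrite (EFin_expect P)//; exact: (bounded_mfun_comp (mYn n) bgm).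
  by apply: cvg_EFin; [exact: nearW|exact: H].
apply/cvgrPdist_le => e e0 /=.
(* The errors collected at the end total at most [3 * (eta + B * eta)]. *)
pose eta := e / (4 * (B + 1)).
have eta0 : 0 < eta by rewrite divr_gt0// mulr_gt0// ltr_pwDr.
have [A HA] := probability_tail m eta0.
have [del del0 Hdel] := continuous_uniform_itv (A%:R + 4) cg eta0.
pose k : nat := (Num.truncn (4 / del)).+1.
have k0 : 0 < k%:R :> R by rewrite ltr0n.
have kdel : 4 / k%:R < del.
  by rewrite ltr_pdivrMr// mulrC -ltr_pdivrMr// truncnS_gt.
pose N := (k * (2 * A + 3))%N.
(* The [i]-th bump lives on an interval of length [4 / k%:R] from [b i / k%:R]; the
   [N] bumps cover [[- A%:R, A%:R]] with room for the two ramps. *)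
pose b (i : nat) : R := i%:R - k%:R * (A%:R + 3).
pose w (i : nat) (x : R) : R := bspline (k%:R * x - b i).
pose gi (i : nat) : R := g (b i / k%:R).
pose W x := spline (k%:R * x - b 0%N) - spline (k%:R * x - b N).
have WE x : \sum_(0 <= i < N) w i x = W x.
  rewrite /w /W /bspline.
  rewrite (eq_bigr (fun i => spline (k%:R * x - b i) - spline (k%:R * x - b i.+1))).
    rewrite (telescope_sumr_eq (fun i => - spline (k%:R * x - b i)))// => [|i _]; ring.
  by move=> i _; congr (_ - spline _); rewrite /b -natr1; ring.
have w0 i x : 0 <= w i x by exact: bspline_ge0.
have W0 x : 0 <= W x by rewrite -WE sumr_ge0.
have W1 x : W x <= 1.
  have /andP[_ ?] := spline_bounds (k%:R * x - b 0%N).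
  have /andP[? _] := spline_bounds (k%:R * x - b N).
  by rewrite /W; lra.
have WA x : \1_`[- A%:R, A%:R] x <= W x.
  rewrite indicE; have [|_] := boolP (x \in _); last exact: W0.
  rewrite inE/= in_itv/= => /andP[xA Ax].
  rewrite /W spline_ge3 ?spline_le0 ?subr0//.
    rewrite /b /N natrM natrD natrM subr_le0 lerBrDr -mulrDr.
    by rewrite ler_pM2l//; lra.
  rewrite /b sub0r opprK -mulrDr (@le_trans _ _ (1 * 3))//; first lra.
  by apply: ler_pM; rewrite ?ler1n//; lra.
pose Phi x := \sum_(0 <= i < N) gi i * w i x.
have PhiE x : `|g x - Phi x| <= eta + B * (1 - W x).
  have -> : g x - Phi x = \sum_(0 <= i < N) (g x - gi i) * w i x + g x * (1 - W x).
    rewrite /Phi mulrBr mulr1 -WE mulr_sumr.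
    have -> : \sum_(0 <= i < N) (g x - gi i) * w i x =
        \sum_(0 <= i < N) g x * w i x - \sum_(0 <= i < N) gi i * w i x.
      by rewrite -sumrB; apply: eq_bigr => i _; rewrite mulrBl.
    by ring.
  rewrite (le_trans (ler_normD _ _))// lerD//; last first.
    by rewrite normrM ler_pM// ger0_norm// subr_ge0.
  rewrite (le_trans (ler_norm_sum _ _ _))//.
  apply: (@le_trans _ _ (\sum_(0 <= i < N) eta * w i x)); last first.
    by rewrite -mulr_sumr WE ler_piMr// ltW.
  apply: ler_sum_nat => i /andP[_ iN]; rewrite normrM (ger0_norm (w0 i x)).
  have [x1|x1] := leP (k%:R * x - b i) 0.
    by rewrite /w bspline_eq0 ?mulr0//; left.
  have [x2|x2] := leP 4 (k%:R * x - b i).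
    by rewrite /w bspline_eq0 ?mulr0//; right.
  rewrite ler_wpM2r// distrC; apply: Hdel.
    have iN' : (i%:R : R) <= k%:R * (2 * A%:R + 3).
      by rewrite -natrM -natrD -natrM ler_nat ltnW.
    have i0 : (0 : R) <= i%:R by [].
    have k3 : 0 <= k%:R :> R by [].
    have A0 : 0 <= A%:R :> R by [].
    apply/andP; split.
      by rewrite ler_pdivlMr// /b; nra.
    by rewrite ler_pdivrMr// /b; nra.
  rewrite (le_lt_trans _ kdel)//.
  have -> : b i / k%:R - x = - ((k%:R * x - b i) / k%:R) by field; rewrite gt_eqF.
  by rewrite normrN normrM ger0_norm ?(ltW x1)// gtr0_norm ?invr_gt0// ler_pM2r ?invr_gt0// ltW.
have maff (c : R) : measurable_fun setT (fun x : measurableTypeR R => k%:R * x - c).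
  by apply: measurable_funB => //; exact: measurable_funM.
have bw i : bounded_mfun (w i : measurableTypeR R -> R).
  apply: bounded_mfunB; first exact: (bounded_mfun_comp (maff (b i)) bspl.1).
  by apply: (bounded_mfun_comp (f := fun x : measurableTypeR R => k%:R * x - b i - 1) _ bspl.1);
    apply: measurable_funB.
have bgw i : bounded_mfun (fun x : measurableTypeR R => gi i * w i x) := bounded_mfunZ (gi i) (bw i).
have [bPhi _] := expect_sum m (index_iota 0 N) bgw.
have [bW' _] := expect_sum m (index_iota 0 N) bw.
have bW : bounded_mfun (W : measurableTypeR R -> R).
  by have := bW'; rewrite (_ : (fun x => \sum_(i <- index_iota 0 N) w i x) = W)//; apply/funext.
have bE : bounded_mfun (fun x : measurableTypeR R => eta + B * (1 - W x)).
  apply: bounded_mfunD; first exact: bounded_mfun_cst.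
  by apply: bounded_mfunZ; apply: bounded_mfunB => //; exact: bounded_mfun_cst.
have bsp (c : R) : bounded_mfun (fun x : measurableTypeR R => spline (k%:R * x - c)).
  exact: (bounded_mfun_comp (maff c) bspl.1).
have wE i x : w i x = spline (k%:R * x - b i) - spline (k%:R * x - (b i + 1)).
  by rewrite /w /bspline; congr (_ - spline _); ring.
have cvgw i : \int[P]_v w i (Y n v) @[n --> \oo] --> \int[m]_x w i x.
  have -> : \int[m]_x w i x = \int[m]_x spline (k%:R * x - b i) - \int[m]_x spline (k%:R * x - (b i + 1)).
    rewrite -(expectB m (bsp _) (bsp _)); apply: eq_Rintegral => x _; exact: wE.
  have -> : (fun n => \int[P]_v w i (Y n v)) = (fun n =>
      \int[P]_v spline (k%:R * Y n v - b i) - \int[P]_v spline (k%:R * Y n v - (b i + 1))).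
    apply/funext => n; under eq_Rintegral do rewrite wE.
    exact: (expectB P (bounded_mfun_comp (mYn n) (bsp _)) (bounded_mfun_comp (mYn n) (bsp _))).
  by apply: cvgB; exact: HY.
have cvgsum (c : nat -> R) :
    \int[P]_v (\sum_(0 <= i < N) c i * w i (Y n v)) @[n --> \oo] -->
    \int[m]_x (\sum_(0 <= i < N) c i * w i x).
  have bcw i : bounded_mfun (fun x : measurableTypeR R => c i * w i x) := bounded_mfunZ (c i) (bw i).
  rewrite (expect_sum m (index_iota 0 N) bcw).2.
  have -> : (fun n => \int[P]_v (\sum_(0 <= i < N) c i * w i (Y n v))) =
      (fun n => \sum_(0 <= i < N) \int[P]_v (c i * w i (Y n v))).
    apply/funext => n.
    exact: (expect_sum P (index_iota 0 N) (fun i => bounded_mfun_comp (mYn n) (bcw i))).2.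
  suff H i : \int[P]_v (c i * w i (Y n v)) @[n --> \oo] --> \int[m]_x (c i * w i x).
    elim: (index_iota 0 N) => [|i r IH].
      rewrite big_nil; under eq_fun do rewrite big_nil; exact: cvg_cst.
    rewrite big_cons; under eq_fun do rewrite big_cons.
    by apply: cvgD; [exact: H|exact: IH].
  rewrite (expectZ m (c i) (bw i)).
  have -> : (fun n => \int[P]_v (c i * w i (Y n v))) = (fun n => c i * \int[P]_v w i (Y n v)).
    apply/funext => n; exact: (expectZ P (c i) (bounded_mfun_comp (mYn n) (bw i))).
  by apply: cvgM; [exact: cvg_cst|exact: cvgw].
have cvgPhi : \int[P]_v Phi (Y n v) @[n --> \oo] --> \int[m]_x Phi x by exact: (cvgsum gi).
have cvgW : \int[P]_v W (Y n v) @[n --> \oo] --> \int[m]_x W x.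
  have WE1 x : W x = \sum_(0 <= i < N) 1 * w i x.
    by rewrite -WE; apply: eq_bigr => i _; rewrite mul1r.
  have -> : W = (fun x => \sum_(0 <= i < N) 1 * w i x) by apply/funext.
  exact: (cvgsum (fun=> 1)).
have intW : 1 - eta <= \int[m]_x W x.
  rewrite (le_trans HA)//; apply: expect_le => //.
  by apply: bounded_mfun_indic; exact: measurable_itv.
have bYE n := bounded_mfun_comp (mYn n) bE.
have EE (Q : probability Omega R) n : \int[Q]_v (eta + B * (1 - W (Y n v))) =
    eta + B * (1 - \int[Q]_v W (Y n v)).
  have b1 : bounded_mfun (fun v : Omega => 1 : R) by exact: bounded_mfun_cst.
  have bWn := bounded_mfun_comp (mYn n) bW.
  rewrite (expectD Q (bounded_mfun_cst eta) (bounded_mfunZ B (bounded_mfunB b1 bWn))).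
  by rewrite (expectZ Q B (bounded_mfunB b1 bWn)) (expectB Q b1 bWn) !expect_cst.
have Em : \int[m]_x (eta + B * (1 - W x)) = eta + B * (1 - \int[m]_x W x).
  have b1 : bounded_mfun (fun v : measurableTypeR R => 1 : R) by exact: bounded_mfun_cst.
  rewrite (expectD m (bounded_mfun_cst eta) (bounded_mfunZ B (bounded_mfunB b1 bW))).
  by rewrite (expectZ m B (bounded_mfunB b1 bW)) (expectB m b1 bW) !expect_cst.
have d1 : `|\int[m]_x g x - \int[m]_x Phi x| <= eta + B * (1 - \int[m]_x W x).
  by rewrite -Em; exact: expect_dist_le_fun.
move/cvgrPdist_le : cvgPhi => /(_ eta eta0) HPhi.
move/cvgrPdist_le : cvgW => /(_ eta eta0) HW.
near=> n.
have d2 : `|\int[m]_x Phi x - \int[P]_v Phi (Y n v)| <= eta by near: n; exact: HPhi.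
have : `|\int[m]_x W x - \int[P]_v W (Y n v)| <= eta by near: n; exact: HW.
rewrite ler_norml => /andP[_ d3].
have d4 : `|\int[P]_v g (Y n v) - \int[P]_v Phi (Y n v)| <=
    eta + B * (1 - \int[P]_v W (Y n v)).
  rewrite -EE; apply: expect_dist_le_fun => //.
  - exact: (bounded_mfun_comp (mYn n) bgm).
  - exact: (bounded_mfun_comp (mYn n) bPhi).
have b1 : B * (1 - \int[m]_x W x) <= B * eta by rewrite ler_wpM2l//; lra.
have b2 : B * (1 - \int[P]_v W (Y n v)) <= B * (2 * eta) by rewrite ler_wpM2l//; lra.
have etaE : e = 4 * (eta + B * eta) by rewrite /eta; field; rewrite gt_eqF// ltr_pwDr.
have Be : 0 <= B * eta by rewrite mulr_ge0// ltW.
rewrite (le_trans (ler_distD (\int[m]_x Phi x) _ _))//.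
rewrite (le_trans (lerD d1 (ler_distD (\int[P]_v Phi (Y n v)) _ _)))//.
rewrite [in X in _ + (_ + X)]distrC; lra.
Unshelve. all: by end_near. Qed.

End weak_convergence.

(** * The past and the Markov property *)

Section past.
Context {R : realType} {d d'} {Omega : measurableType d} {T' : measurableType d'}.
Variables (P : probability Omega R) (X : nat -> {RV P >-> T'}) (nu : probability T' R).
Hypothesis iidX : iid X nu.

(** A pi-system generating the sigma-algebra of the first [n] increments, so that
    independence of the next increment has to be checked on these sets only. *)
Definition cylinder (n : nat) : set (set Omega) :=
  [set \bigcap_(i in `I_n) (X i @^-1` A i) |
    A in [set A : nat -> set T' | forall i, measurable (A i)]].

(* [Omega] with the sigma-algebra generated by the first [n] increments. *)
Notation past n := (g_sigma_algebraType (cylinder n)).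

Lemma cylinderT n : cylinder n setT.
Proof.
exists (fun=> setT) => [i|]; first exact: measurableT.
by rewrite -subTset => w _ i _.
Qed.

Lemma cylinder_measurable n : cylinder n `<=` (measurable : set (set Omega)).
Proof.
move=> _ [A mA <-]; apply: bigcap_measurableType => i _.
by rewrite -[X in measurable X]setTI; exact: (measurable_funPT (X i)).
Qed.

Lemma past_measurable n (C : set Omega) : <<s cylinder n >> C -> measurable C.
Proof. exact: (smallest_sub (@sigma_algebra_measurable _ Omega) (@cylinder_measurable n)). Qed.

Lemma cylinderI n : setI_closed (cylinder n).
Proof.
move=> _ _ [A mA <-] [B mB <-]; exists (fun i => A i `&` B i).
  by move=> i; exact: measurableI.
rewrite -bigcapI; apply: eq_bigcapr => i _; exact: preimage_setI.
Qed.

Lemma cylinderS n : cylinder n `<=` cylinder n.+1.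
Proof.
move=> _ [A mA <-]; exists (fun i => if (i < n)%N then A i else setT).
  by move=> i; case: ifP => // _; exact: measurableT.
apply/seteqP; split => w H i /= Hi.
  have := H i; rewrite /= Hi ltnS (ltnW Hi); exact.
by case: ifP => // iN; apply: H.
Qed.

Lemma pastS n (C : set Omega) : <<s cylinder n >> C -> <<s cylinder n.+1 >> C.
Proof. by apply: sub_sigma_algebra2; exact: cylinderS. Qed.

Lemma increment_past n (A : set T') : measurable A -> <<s cylinder n.+1 >> (X n @^-1` A).
Proof.
move=> mA; apply: sub_sigma_algebra.
exists (fun i => if i == n then A else setT).
  by move=> i; case: ifP => // _; exact: measurableT.
apply/seteqP; split => [w H|w Aw i /= iN].
  by have := H n; rewrite /= eqxx ltnSn; exact.
by case: eqP => [->|].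
Qed.

Let prob_cylinder n (A : nat -> set T') : (forall i, measurable (A i)) ->
  P (\bigcap_(i in `I_n) (X i @^-1` A i)) = (\prod_(0 <= i < n) P (X i @^-1` A i))%E.
Proof.
move=> mA; have := iidX.1 [fset i in iota 0 n]%fset A mA.
have -> : [set` [fset i in iota 0 n]%fset] = `I_n.
  by apply/seteqP; split => i /=; rewrite inE/= mem_iota add0n.
move=> ->; rewrite (perm_big (iota 0 n)) ?/index_iota ?subn0//.
by apply: uniq_perm; [exact: fset_uniq|exact: iota_uniq|move=> i; rewrite !inE].
Qed.

(** For fixed [A] both sides are finite measures in [C], and they agree on the
    cylinders, which form a pi-system. *)
Lemma past_independent n (C : set Omega) (A : set T') :
  <<s cylinder n >> C -> measurable A -> P (C `&` X n @^-1` A) = (P C * nu A)%E.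
Proof.
move=> CF mA.
have mXA : measurable (X n @^-1` A).
  by rewrite -[X in measurable X]setTI; exact: (measurable_funPT (X n)).
have nuA : nu A \is a fin_num by exact: fin_num_measure.
have nuA0 : 0 <= fine (nu A) by rewrite fine_ge0.
pose m1 := mrestr P mXA; pose m2 := mscale (NngNum nuA0) P.
have m2E D : m2 D = (P D * nu A)%E.
  by rewrite /m2 /mscale/= fineK// muleC.
have : m1 C = m2 C.
  apply: (@g_sigma_algebra_measure_unique _ _ _ (cylinder n) _ (fun=> setT) _ _ m1 m2) CF => //.
  - exact: cylinder_measurable.
  - by move=> _; exact: cylinderT.
  - by rewrite bigcup_const.
  - exact: cylinderI.
  - move=> _ [B mB <-]; apply: (etrans _ (esym (m2E _))).
    transitivity (P (\bigcap_(i in `I_n) (X i @^-1` B i) `&` X n @^-1` A)) => //.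
    pose B' i := if i == n then A else B i.
    have mB' i : measurable (B' i) by rewrite /B'; case: ifP.
    have -> : \bigcap_(i in `I_n) (X i @^-1` B i) `&` X n @^-1` A =
        \bigcap_(i in `I_n.+1) (X i @^-1` B' i).
      apply/seteqP; split => [w [H Aw] i /=|w H].
        rewrite ltnS leq_eqVlt /B' => /orP[/eqP ->|iN]; first by rewrite eqxx.
        by rewrite ltn_eqF//; exact: H.
      split; last by have := H n; rewrite /= /B' eqxx ltnSn; exact.
      by move=> i /= iN; have := H i; rewrite /= /B' ltn_eqF// ltnS ltnW//; exact.
    rewrite !prob_cylinder// big_nat_recr//= /B' eqxx.
    congr (_ * _)%E; last exact: (iidX.2 n A mA).
    by apply: eq_big_nat => i /andP[_ iN]; rewrite ltn_eqF.
  - by move=> k; rewrite /m1 /mrestr (le_lt_trans (probability_le1 _ _))// ?ltry//;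
      rewrite setTI.
by move=> H; apply: (etrans _ (m2E _)); exact: H.
Qed.

Let measurable_past_id n : measurable_fun setT (id : Omega -> past n).
Proof. by move=> _ B mB; rewrite setTI; exact: past_measurable mB. Qed.

Let measurable_past_pair n : measurable_fun setT (fun w : Omega => (w : past n, X n w)).
Proof. by apply: measurable_fun_pair; [exact: measurable_past_id|exact: measurable_funPT]. Qed.

Definition past_id n : {mfun Omega >-> past n} := mfun_Sub (mem_set (@measurable_past_id n)).

Definition past_pair n : {mfun Omega >-> (past n * T')%type} :=
  mfun_Sub (mem_set (@measurable_past_pair n)).

Lemma measurable_pastS n {d2} {E : measurableType d2} (Y : Omega -> E) :
  measurable_fun setT (Y : past n -> E) -> measurable_fun setT (Y : past n.+1 -> E).
Proof. by move=> mY _ B mB; apply: pastS; exact: mY. Qed.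

Lemma measurable_past n {d2} {E : measurableType d2} (Y : Omega -> E) :
  measurable_fun setT (Y : past n -> E) -> measurable_fun setT Y.
Proof. by move=> mY _ B mB; apply: (@past_measurable n); exact: mY. Qed.

Lemma measurable_increment n : measurable_fun setT (X n : past n.+1 -> T').
Proof. by move=> _ B mB; rewrite setTI; exact: increment_past. Qed.

Lemma expect_past_id n (u : past n -> R) : bounded_mfun u ->
  \int[distribution P (past_id n)]_w u w = \int[P]_w u w.
Proof.
by move=> bu; rewrite (@expect_distribution _ _ _ _ _ P (past_id n) _ bu).
Qed.

(** Given the past, the next increment has law [nu]: on rectangles this is
    [past_independent], and product measures are determined by rectangles. *)
Lemma expect_next n (Phi : past n * T' -> R) : bounded_mfun Phi ->
  \int[P]_w Phi (w, X n w) = \int[P]_w \int[nu]_y Phi (w, y).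
Proof.
move=> bPhi.
have -> : \int[P]_w Phi (w, X n w) = \int[distribution P (past_pair n)]_z Phi z.
  by rewrite (@expect_distribution _ _ _ _ _ P (past_pair n) _ bPhi).
rewrite -(expect_past_id (bounded_mfun_expect nu bPhi)) -(expect_prod nu (distribution P (past_id n)) bPhi).
rewrite /Rintegral; congr fine; apply: eq_measure_integral => D mD _.
apply/esym; apply: product_measure_unique => // A B mA mB.
exact: past_independent.
Qed.

End past.

Section walk.
Context {R : realType} {d d' dO} {T : measurableType d} {T' : measurableType d'}
  {Omega : measurableType dO}.
Variables (nu : probability T' R) (step : T * T' -> T) (phi : T * T' -> R) (C : R).
Hypothesis mstep : measurable_fun setT step.
Hypothesis mphi : measurable_fun setT phi.
Hypothesis phiC : forall z, `|phi z| <= C.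
Variables (P : probability Omega R) (X : nat -> {RV P >-> T'}).
Hypothesis iidX : iid X nu.
Variable x0 : T.
Local Notation V := (transition nu step phi).

Fixpoint state (n : nat) (w : Omega) : T :=
  if n is n'.+1 then step (state n' w, X n' w) else x0.

Definition martingale (n : nat) (w : Omega) : R :=
  \sum_(0 <= i < n) phi (state i w, X i w).

Local Notation S := state.
Local Notation M := martingale.
Local Notation past n := (g_sigma_algebraType (cylinder X n)).

Lemma martingaleS n w : M n.+1 w = M n w + phi (S n w, X n w).
Proof. by rewrite /M big_nat_recr. Qed.

Lemma measurable_state n : measurable_fun setT (S n : past n -> T).
Proof.
elim: n => [|n IH]; first exact: measurable_cst.
apply: (measurableT_comp mstep).
by apply: measurable_fun_pair; [exact: measurable_pastS|exact: measurable_increment].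
Qed.

Lemma measurable_martingale n : measurable_fun setT (M n : past n -> R).
Proof.
elim: n => [|n IH].
  have -> : M 0 = cst 0 by apply/funext => w; rewrite /M big_geq.
  exact: measurable_cst.
have -> : M n.+1 = (fun w => M n w + phi (S n w, X n w)).
  by apply/funext => w; exact: martingaleS.
apply: measurable_funD; first exact: measurable_pastS.
apply: (measurableT_comp mphi).
apply: measurable_fun_pair; last exact: measurable_increment.
by apply: measurable_pastS; exact: measurable_state.
Qed.

Lemma martingale_dist n j w : `|M (n + j) w - M n w| <= C * j%:R.
Proof.
elim: j => [|j IH]; first by rewrite addn0 subrr normr0 mulr0.
rewrite addnS martingaleS -natr1 mulrDr mulr1 addrAC.
by rewrite (le_trans (ler_normD _ _))// lerD.
Qed.

Lemma martingale_bound n w : `|M n w| <= C * n%:R.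
Proof. by have := martingale_dist 0 n w; rewrite add0n {2}/M big_geq// subr0. Qed.

Lemma bounded_mfun_past_state n (A : Omega -> R) F :
  bounded_mfun (A : past n -> R) -> locally_bounded_mfun F ->
  bounded_mfun (fun w : past n => F (S n w, A w)).
Proof.
move=> [mA [a Aa]] [mF bF]; split.
  apply: (measurableT_comp mF).
  by apply: measurable_fun_pair => //; exact: measurable_state.
by have [B HB] := bF a; exists B => w; apply: HB.
Qed.

(** Given the past, average over the [n]-th increment with [expect_next]. *)
Lemma markov_step n (D A : Omega -> R) F :
  bounded_mfun (D : past n -> R) -> bounded_mfun (A : past n -> R) ->
  locally_bounded_mfun F ->
  \int[P]_w (D w * F (S n.+1 w, A w + phi (S n w, X n w))) =
  \int[P]_w (D w * V F (S n w, A w)).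
Proof.
move=> bD bA lF; have [mA [a Aa]] := bA.
pose Phi (z : past n * T') := D z.1 * F (step (S n z.1, z.2), A z.1 + phi (S n z.1, z.2)).
have m12 : measurable_fun setT (fun z : past n * T' => (S n z.1, z.2)).
  apply: (measurable_fun_pair (measurableT_comp (@measurable_state n)
    (@measurable_fst _ _ (past n) T')) (@measurable_snd _ _ (past n) T')).
have bPhi : bounded_mfun Phi.
  apply: bounded_mfunM; first exact: (bounded_mfun_comp (@measurable_fst _ _ (past n) T') bD).
  have [mF bF] := lF; split.
    apply: (measurableT_comp mF); apply: measurable_fun_pair.
      exact: (measurableT_comp mstep m12).
    apply: measurable_funD; last exact: (measurableT_comp mphi m12).
    exact: (measurableT_comp mA (@measurable_fst _ _ (past n) T')).
  have [B HB] := bF (a + C); exists B => z; apply: HB.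
  by rewrite (le_trans (ler_normD _ _))// lerD.
have := expect_next iidX bPhi; rewrite /Phi/= => ->.
apply: eq_Rintegral => w _.
rewrite (expectZ nu (D w) (u := fun y => F (step (S n w, y), A w + phi (S n w, y))))//.
exact: (bounded_mfun_next mstep mphi phiC (S n w, A w) lF).
Qed.

Lemma bounded_mfun_pastS n (A : Omega -> R) :
  bounded_mfun (A : past n -> R) -> bounded_mfun (A : past n.+1 -> R).
Proof. by move=> [mA bA]; split => //; exact: measurable_pastS. Qed.

Lemma bounded_mfun_pastD n j (A : Omega -> R) :
  bounded_mfun (A : past n -> R) -> bounded_mfun (A : past (n + j) -> R).
Proof.
by move=> bA; elim: j => [|j IH]; rewrite ?addn0// addnS; exact: bounded_mfun_pastS.
Qed.

Lemma bounded_mfun_past n (A : Omega -> R) :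
  bounded_mfun (A : past n -> R) -> bounded_mfun (A : Omega -> R).
Proof. by move=> [mA bA]; split => //; exact: (measurable_past (X := X) mA). Qed.

Lemma bounded_mfun_martingale n : bounded_mfun (M n : past n -> R).
Proof.
by split; [exact: measurable_martingale|exists (C * n%:R) => w; exact: martingale_bound].
Qed.

(** The weight [D], later the indicator of a past event, makes this a statement on
    conditional expectations given the past. The induction applies [markov_step]
    with the offset [A w + (M (n + j) w - M n w)], a function of the past at time
    [n + j]. *)
Lemma markov_property n j (D A : Omega -> R) F :
  bounded_mfun (D : past n -> R) -> bounded_mfun (A : past n -> R) ->
  locally_bounded_mfun F ->
  \int[P]_w (D w * F (S (n + j) w, A w + (M (n + j) w - M n w))) =
  \int[P]_w (D w * iter j V F (S n w, A w)).
Proof.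
move=> bD bA; elim: j F => [|j IH] F lF.
  by rewrite addn0; apply: eq_Rintegral => w _; rewrite subrr addr0.
have bA' : bounded_mfun ((fun w => A w + (M (n + j) w - M n w)) : past (n + j) -> R).
  apply: bounded_mfunD; first exact: bounded_mfun_pastD.
  apply: bounded_mfunB; first exact: bounded_mfun_martingale.
  by apply: bounded_mfun_pastD; exact: bounded_mfun_martingale.
rewrite addnS iterSr -IH; last exact: locally_bounded_transition.
rewrite -(markov_step (bounded_mfun_pastD j bD) bA' lF).
by apply: eq_Rintegral => w _; rewrite martingaleS; congr (_ * F (_, _)); ring.
Qed.

End walk.

(** * The central limit theorem for the martingale *)

Section taylor_class_facts.
Context {R : realType}.

Lemma taylor_class_spline (k b : R) : 0 < k ->
  exists L B, 0 <= L /\ taylor_class L B (fun y => spline (k * y - b)).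
Proof.
move=> k0; have [B HB] := @spline_taylor_class R.
have ki0 : 0 < k^-1 by rewrite invr_gt0.
have := taylor_class_scale ki0 (taylor_class_shift b HB).
have -> : (fun a => spline (a / k^-1 - b)) = (fun y => spline (k * y - b)).
  by apply/funext => a; rewrite invrK mulrC.
move=> H; exists (2 / k^-1 ^+ 3), (B / k^-1 ^+ 2); split => //.
by rewrite divr_ge0// exprn_ge0// ltW.
Qed.

Lemma taylor_class_lipschitz (L B : R) psi : taylor_class L B psi ->
  exists2 K, 0 <= K & forall a h, `|h| <= 1 -> `|psi (a + h) - psi a| <= K * `|h|.
Proof.
move=> [_ [psi1 [psi2 [[_ [B1 H1]] [_ [B2 H2]] _ H]]]].
have B10 : 0 <= B1 by rewrite (le_trans _ (H1 0)).
have B20 : 0 <= B2 by rewrite (le_trans _ (H2 0)).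
exists (B1 + B2 / 2 + `|L|); first by rewrite !addr_ge0// divr_ge0.
move=> a h h1; have Hr := H a h.
pose r : R := psi (a + h) - (psi a + psi1 a * h + psi2 a / 2 * h ^+ 2).
have -> : psi (a + h) - psi a = r + (psi1 a * h + psi2 a / 2 * h ^+ 2) by rewrite /r; ring.
have h0 : 0 <= `|h| by [].
have h2 : `|h| ^+ 2 <= `|h| by rewrite expr2 ler_piMl.
have h3 : `|h| ^+ 3 <= `|h| by rewrite exprS ler_piMr// exprn_ile1.
have t1 : `|psi1 a * h| <= B1 * `|h| by rewrite normrM ler_wpM2r.
have t2 : `|psi2 a / 2 * h ^+ 2| <= B2 / 2 * `|h|.
  rewrite normrM normrX; apply: ler_pM => //; rewrite normrM normfV (@ger0_norm _ 2)//.
  by rewrite ler_wpM2r.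
have t3 : L * `|h| ^+ 3 <= `|L| * `|h|.
  by rewrite (le_trans (ler_wpM2r _ (ler_norm L))) ?exprn_ge0// ler_wpM2l.
rewrite (le_trans (ler_normD _ _))// (le_trans (lerD (le_trans Hr t3) (ler_normD _ _)))//.
by lra.
Qed.

End taylor_class_facts.

Section limit_in_law.
Context {R : realType} {d d' dO} {T : measurableType d} {T' : measurableType d'}
  {Omega : measurableType dO}.
Variables (nu : probability T' R) (step : T * T' -> T) (phi : T * T' -> R) (C s2 : R).
Hypothesis mstep : measurable_fun setT step.
Hypothesis mphi : measurable_fun setT phi.
Hypothesis phiC : forall z, `|phi z| <= C.
Hypothesis phi0 : forall x, \int[nu]_y phi (x, y) = 0.
Hypothesis s20 : 0 <= s2.
Hypothesis sum_var_s2 : forall e : R, 0 < e -> exists2 m, (0 < m)%N &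
  forall x, `|sum_var nu step phi m x - m%:R * s2| <= e * m%:R.
Variables (P : probability Omega R) (X : nat -> {RV P >-> T'}).
Hypothesis iidX : iid X nu.
Variable x0 : T.
Local Notation V := (transition nu step phi).
Local Notation S := (state step X x0).
Local Notation M := (martingale step phi X x0).
Local Notation past n := (g_sigma_algebraType (cylinder X n)).

Lemma expect_martingale n F : locally_bounded_mfun F ->
  \int[P]_w F (S n w, M n w) = iter n V F (x0, 0).
Proof.
move=> lF; have b c : bounded_mfun (fun _ : past 0 => c : R) by exact: bounded_mfun_cst.
have := markov_property mstep mphi phiC iidX x0 n (b 1) (b 0) lF.
rewrite add0n => H.
have E0 w : M 0 w = 0 by rewrite /martingale big_geq.
transitivity (\int[P]_w (1 * F (S n w, 0 + (M n w - M 0 w)))).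
  by apply: eq_Rintegral => w _; rewrite mul1r E0 subr0 add0r.
rewrite H -[RHS](expect_cst P).
by apply: eq_Rintegral => w _; rewrite mul1r.
Qed.

Lemma measurable_martingaleT n : measurable_fun setT (M n).
Proof.
exact: (measurable_past (measurable_martingale mstep mphi (X := X) x0 (n := n))).
Qed.

(** Translated and rescaled splines are test functions for [uniform_clt] and suffice
    for convergence in distribution; the bounded remainder is absorbed by their
    Lipschitz continuity after division by [Num.sqrt n%:R]. *)
Lemma clt_martingale (rem : nat -> Omega -> R) (K : R) :
  (forall n, measurable_fun setT (rem n)) -> (forall n w, `|rem n w| <= K) ->
  cvg_in_distribution P (fun n w => (M n w + rem n w) / Num.sqrt n%:R)
    (centered_normal (Num.sqrt s2)).
Proof.
move=> mrem remK; have K0 : 0 <= K by rewrite (le_trans _ (remK 0 point)).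
have mMr n : measurable_fun setT (fun w => (M n w + rem n w) / Num.sqrt n%:R).
  by apply: measurable_funM => //; apply: measurable_funD => //; exact: measurable_martingaleT.
apply: weak_cvg_of_spline => // k b k0.
have [L [B [L0 cpsi]]] := taylor_class_spline b k0.
set psi := fun y => spline (k * y - b) in cpsi.
have cont := taylor_class_continuous cpsi.
rewrite (gauss_centered_normal (sqrtr_ge0 s2) cont cpsi.1).
have [K' K'0 lip] := taylor_class_lipschitz cpsi.
apply/cvgrPdist_le => e e0 /=.
have [N HN] := uniform_clt mstep mphi phiC phi0 s20 sum_var_s2 L0 cpsi (divr_gt0 e0 (ltr0n _ 2)).
(* Makes the displacement at most [1] and its effect at most [e / 2]. *)
pose c := Num.max K (2 * K' * K / e).
exists (maxn N (Num.truncn (c ^+ 2)).+1) => // n /=; rewrite geq_max => /andP[Nn cn].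
have n0 : (0 < n)%N by rewrite (leq_trans _ cn).
have c0 : 0 <= c by rewrite le_max K0.
have cq : c <= Num.sqrt n%:R.
  rewrite -(ger0_norm c0) -sqrtr_sqr ler_wsqrtr//.
  by rewrite (le_trans (ltW (truncnS_gt _)))// ler_nat.
have q0 : 0 < Num.sqrt n%:R :> R by rewrite sqrtr_gt0 ltr0n.
have mdiv : measurable_fun setT (fun y : measurableTypeR R => y / Num.sqrt n%:R).
  exact: measurable_funM.
have lpsi : locally_bounded_mfun (fun z : T * R => psi (z.2 / Num.sqrt n%:R)).
  apply: (bounded_mfun_snd (psi := fun y => psi (y / Num.sqrt n%:R))).
  exact: (bounded_mfun_comp mdiv cpsi.1).
have := HN n Nn x0; rewrite -(expect_martingale n lpsi)/= => H1.
have H2 : `|\int[P]_w psi (M n w / Num.sqrt n%:R) -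
    \int[P]_w psi ((M n w + rem n w) / Num.sqrt n%:R)| <= e / 2.
  have mMd : measurable_fun setT (fun w => M n w / Num.sqrt n%:R : measurableTypeR R).
    by apply: measurable_funM => //; exact: measurable_martingaleT.
  apply: expect_dist_le.
  - exact: (bounded_mfun_comp mMd cpsi.1).
  - exact: (bounded_mfun_comp (mMr n : measurable_fun setT (_ : Omega -> measurableTypeR R)) cpsi.1).
  - move=> w; rewrite distrC mulrDl.
    have remq : `|rem n w / Num.sqrt n%:R| <= K / Num.sqrt n%:R.
      by rewrite normrM normfV (gtr0_norm q0) ler_wpM2r// invr_ge0 ltW.
    apply: (le_trans (lip _ _ _)).
      rewrite (le_trans remq)// ler_pdivrMr// mul1r (le_trans _ cq)//.
      by rewrite /c le_max lexx.
    apply: (le_trans (ler_wpM2l K'0 remq)).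
    have : 2 * K' * K / e <= Num.sqrt n%:R.
      by rewrite (le_trans _ cq)// /c le_max lexx orbT.
    rewrite ler_pdivrMr// => H.
    by rewrite mulrA ler_pdivrMr//; lra.
rewrite (le_trans (ler_distD (\int[P]_w psi (M n w / Num.sqrt n%:R)) _ _))//.
by rewrite distrC; lra.
Qed.

End limit_in_law.

(** * The upper half of the law of the iterated logarithm *)

Section maximal_inequality.
Context {R : realType} {d d' dO} {T : measurableType d} {T' : measurableType d'}
  {Omega : measurableType dO}.
Variables (nu : probability T' R) (step : T * T' -> T) (phi : T * T' -> R) (C : R).
Hypothesis mstep : measurable_fun setT step.
Hypothesis mphi : measurable_fun setT phi.
Hypothesis phiC : forall z, `|phi z| <= C.
Hypothesis phi0 : forall x, \int[nu]_y phi (x, y) = 0.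
Variables (P : probability Omega R) (X : nat -> {RV P >-> T'}).
Hypothesis iidX : iid X nu.
Variable x0 : T.
Local Notation V := (transition nu step phi).
Local Notation S := (state step X x0).
Local Notation M := (martingale step phi X x0).
Local Notation past n := (g_sigma_algebraType (cylinder X n)).

(** Convexity: the exponential lies above its tangent at [a], and the tangent has
    average [expR (l * a)] because the increment is centered. *)
Lemma transition_expR_ge l x a : expR (l * a) <= V (fun z => expR (l * z.2)) (x, a).
Proof.
have := @iter_transition_quadratic _ _ _ _ _ nu step phi C mstep mphi phiC phi0 1
  (expR (l * a) - l * expR (l * a) * a) (l * expR (l * a)) 0 x a.
rewrite mul0r addr0 subrK => {1}<-.
have lq : locally_bounded_mfun (fun z : T * R =>
    expR (l * a) - l * expR (l * a) * a + l * expR (l * a) * z.2 + 0 * z.2 ^+ 2).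
  apply: (locally_bounded_mfun_snd (psi := fun b : R =>
    expR (l * a) - l * expR (l * a) * a + l * expR (l * a) * b + 0 * b ^+ 2)).
    apply: measurable_funD; first by apply: measurable_funD => //; exact: measurable_funM.
    by apply: measurable_funM => //; exact: measurable_funX.
  move=> A; exists (`|expR (l * a) - l * expR (l * a) * a| + `|l * expR (l * a)| * A) => b bA.
  rewrite mul0r addr0 (le_trans (ler_normD _ _))// lerD// normrM ler_wpM2l//.
apply: (@iter_transition_le _ _ _ _ _ nu step phi C mstep mphi phiC 1 _
  (fun z => expR (l * z.2)) x a lq (locally_bounded_expR l)).
move=> y b _ /=; rewrite mul0r addr0.
have -> : expR (l * a) - l * expR (l * a) * a + l * expR (l * a) * b =
   expR (l * a) * (1 + l * (b - a)) by ring.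
have -> : l * b = l * a + l * (b - a) by ring.
by rewrite expRD ler_pM2l ?expR_gt0// expR_ge1Dx.
Qed.

Fixpoint hit (a : R) (n : nat) (w : Omega) : bool :=
  (a <= M n w) || (if n is n'.+1 then hit a n' w else false).

Lemma hitP a n w : reflect (exists2 i, (i <= n)%N & a <= M i w) (hit a n w).
Proof.
elim: n => [|n IH] /=.
  rewrite orbF; apply: (iffP idP) => [H|[i]]; first by exists 0%N.
  by rewrite leqn0 => /eqP ->.
apply: (iffP orP) => [[H|/IH[i iN Hi]]|[i]]; [by exists n.+1|by exists i => //; rewrite leqW|].
rewrite leq_eqVlt => /orP[/eqP -> H|iN H]; first by left.
by right; apply/IH; exists i.
Qed.

Lemma measurable_hit a n : (<<s cylinder X n >>) [set w | hit a n w].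
Proof.
have mM k : (<<s cylinder X k >>) [set w | a <= M k w].
  have := @measurable_martingale _ _ _ _ _ _ _ step phi mstep mphi P X x0 k measurableT
    `[a, +oo[%classic (measurable_itv _).
  rewrite setTI (_ : _ @^-1` _ = [set w | a <= M k w])//.
  by apply/seteqP; split => w /=; rewrite in_itv/= andbT.
elim: n => [|n IH] /=.
  by rewrite (_ : [set w | _] = [set w | a <= M 0 w])//; apply/seteqP; split => w /=; rewrite orbF.
rewrite (_ : [set w | _] = [set w | a <= M n.+1 w] `|` [set w | hit a n w]).
  by apply: (@measurableU _ (past n.+1)); [exact: mM|exact: pastS].
by apply/seteqP; split => w /=; [move/orP|move=> ?; apply/orP].
Qed.

Lemma indic_hit a n w : \1_[set w | hit a n w] w = (hit a n w)%:R :> R.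
Proof.
rewrite indicE; have [H|/negP H] := boolP (hit a n w); first by rewrite mem_set.
by rewrite memNset.
Qed.

Lemma bounded_mfun_hit a n : bounded_mfun (\1_[set w | hit a n w] : past n -> R).
Proof. by apply: bounded_mfun_indic; exact: measurable_hit. Qed.

Lemma bounded_mfun_expR_martingale l n : bounded_mfun ((fun w => expR (l * M n w)) : past n -> R).
Proof.
exact: (bounded_mfun_past_state mstep x0 (bounded_mfun_martingale mstep mphi phiC X x0 n)
  (locally_bounded_expR l)).
Qed.

(** Doob's inequality. Passing from [n] to [n + 1] splits the event according to
    whether the level is reached for the first time at [n + 1], where the bound is
    immediate, or earlier, where the submartingale property applies. *)
Lemma maximal_inequality l a n : 0 <= l ->
  expR (l * a) * \int[P]_w (\1_[set w | hit a n w] w) <= \int[P]_w expR (l * M n w).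
Proof.
move=> l0.
suff H : expR (l * a) * \int[P]_w (\1_[set w | hit a n w] w) <=
    \int[P]_w (\1_[set w | hit a n w] w * expR (l * M n w)).
  apply: (le_trans H); apply: expect_le.
  - apply: (@bounded_mfun_past _ _ _ _ _ P X n).
    by apply: bounded_mfunM; [exact: bounded_mfun_hit|exact: bounded_mfun_expR_martingale].
  - apply: (@bounded_mfun_past _ _ _ _ _ P X n); exact: bounded_mfun_expR_martingale.
  - by move=> w; rewrite indic_hit; case: hit; rewrite ?mul1r// mul0r expR_ge0.
elim: n => [|n IH].
  rewrite -expectZ; last exact: bounded_mfun_past (bounded_mfun_hit a 0).
  apply: expect_le => [||w].
  - by apply: bounded_mfunZ; exact: bounded_mfun_past (bounded_mfun_hit a 0).
  - apply: (@bounded_mfun_past _ _ _ _ _ P X 0).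
    by apply: bounded_mfunM; [exact: bounded_mfun_hit|exact: bounded_mfun_expR_martingale].
  - rewrite indic_hit /= orbF; case: (leP a (M 0 w)) => H /=; last by rewrite mulr0n mulr0 mul0r.
    by rewrite mulr1n mulr1 mul1r ler_expR ler_wpM2l.
pose new w : R := (\1_[set w | hit a n.+1 w] w - \1_[set w | hit a n w] w).
have newE w : new w = (~~ hit a n w && (a <= M n.+1 w))%:R.
  rewrite /new !indic_hit /=; case: (hit a n w); case: (a <= M n.+1 w);
    by rewrite /= ?subrr ?subr0.
have bnew : bounded_mfun (new : past n.+1 -> R).
  by apply: bounded_mfunB; [exact: bounded_mfun_hit|apply: bounded_mfun_pastS; exact: bounded_mfun_hit].
have bh := bounded_mfun_hit a n.
have be := bounded_mfun_expR_martingale l n.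
have be1 := bounded_mfun_expR_martingale l n.+1.
have bh1 := bounded_mfun_pastS bh.
have E1 : \int[P]_w (\1_[set w | hit a n.+1 w] w) =
    \int[P]_w (\1_[set w | hit a n w] w) + \int[P]_w new w.
  rewrite -(expectD P (bounded_mfun_past bh) (bounded_mfun_past bnew)).
  by apply: eq_Rintegral => w _; rewrite /new addrC subrK.
have E2 : \int[P]_w (\1_[set w | hit a n.+1 w] w * expR (l * M n.+1 w)) =
    \int[P]_w (\1_[set w | hit a n w] w * expR (l * M n.+1 w)) +
    \int[P]_w (new w * expR (l * M n.+1 w)).
  rewrite -(expectD P (bounded_mfun_past (bounded_mfunM bh1 be1))
    (bounded_mfun_past (bounded_mfunM bnew be1))).
  by apply: eq_Rintegral => w _; rewrite -mulrDl /new addrC subrK.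
rewrite E1 E2 mulrDr; apply: lerD.
  apply: (le_trans IH).
  have := markov_step mstep mphi phiC iidX x0 bh (bounded_mfun_martingale mstep mphi phiC X x0 n)
    (locally_bounded_expR l).
  under eq_Rintegral do rewrite /= -martingaleS.
  move=> ->; apply: expect_le.
  - exact: bounded_mfun_past (bounded_mfunM bh be).
  - apply: (@bounded_mfun_past _ _ _ _ _ P X n); apply: bounded_mfunM => //.
    exact: (bounded_mfun_past_state mstep x0 (bounded_mfun_martingale mstep mphi phiC X x0 n)
      (locally_bounded_transition nu mstep mphi phiC (locally_bounded_expR l))).
  - move=> w; apply: ler_wpM2l; first by rewrite indic_hit.
    exact: transition_expR_ge.
rewrite -(expectZ P _ (bounded_mfun_past bnew)); apply: expect_le.
- exact: bounded_mfunZ (bounded_mfun_past bnew).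
- exact: bounded_mfun_past (bounded_mfunM bnew be1).
- move=> w; rewrite newE mulrC; case: (~~ hit a n w) => /=; last by rewrite mulr0n !mul0r.
  case: (leP a (M n.+1 w)) => H /=; last by rewrite mulr0n !mul0r.
  by rewrite mulr1n !mul1r ler_expR ler_wpM2l.
Qed.

End maximal_inequality.

Section real_estimates.
Context {R : realType}.
Implicit Types t : R.

Definition lil_norm t : R := Num.sqrt (2 * t * ln (ln t)).

Lemma ln_ln_ge0 t : expR 1 <= t -> 0 <= ln (ln t).
Proof.
move=> et; apply: ln_ge0; rewrite -[leLHS](@expRK R) ler_ln// posrE ?expR_gt0//.
by rewrite (lt_le_trans (expR_gt0 1)).
Qed.

Lemma lil_norm_le t t' : expR 1 <= t -> t <= t' -> lil_norm t <= lil_norm t'.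
Proof.
move=> et tt'; have t0 : 0 < t by rewrite (lt_le_trans (expR_gt0 1)).
have t0' : 0 < t' by rewrite (lt_le_trans t0).
have l0 : 1 <= ln t by rewrite -[leLHS](@expRK R) ler_ln// posrE expR_gt0.
have ll : ln t <= ln t' by rewrite ler_ln.
apply: ler_wsqrtr; apply: ler_pM; rewrite ?mulr_ge0 ?(ltW t0)//; last 2 first.
- by rewrite ler_pM2l.
- by rewrite ler_ln ?posrE// (lt_le_trans ltr01)// (le_trans l0).
- exact: ln_ln_ge0.
Qed.

(** Telescoping: with [q = p - 1], the difference of [k ^ (- q)] and
    [(k + 1) ^ (- q)] dominates [q * (k + 1) ^ (- p)]. *)
Lemma sum_expR_ln_le (p : R) : 1 < p -> exists B : R, forall n,
  \sum_(0 <= k < n) expR (- p * ln k%:R) <= B.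
Proof.
move=> p1; pose q := p - 1; have q0 : 0 < q by rewrite subr_gt0.
pose u (k : nat) : R := expR (- q * ln k%:R).
suff H n : \sum_(0 <= k < n.+2) expR (- p * ln k%:R) + u n.+1 / q <= 2 + q^-1.
  exists (2 + q^-1) => n; apply: (le_trans _ (H n)).
  rewrite !big_nat_recr//= -!addrA lerDl !addr_ge0 ?expR_ge0// divr_ge0 ?expR_ge0// ltW//.
elim: n => [|n IH].
  rewrite !big_nat_recr//= big_geq// add0r /u ln1 !mulr0 ln0// mulr0 expR0.
  by rewrite mul1r.
rewrite big_nat_recr//=; apply: (le_trans _ IH).
rewrite -addrA lerD2l.
have n1 : 0 < n.+1%:R :> R by rewrite ltr0n.
have n2 : 0 < n.+2%:R :> R by rewrite ltr0n.
have d : n.+2%:R^-1 <= ln n.+2%:R - ln n.+1%:R :> R.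
  have := @le_ln1Dx R (- n.+2%:R^-1).
  have -> : 1 + - n.+2%:R^-1 = n.+1%:R / n.+2%:R :> R.
    by rewrite -[X in X / _](addrK 1) natr1 mulrBl divff ?gt_eqF// mul1r.
  rewrite ln_div ?posrE// ltrN2 invf_lt1// ltr1n => /(_ isT) H.
  by rewrite -opprB lerNr.
have uE : u n.+1 = u n.+2 * expR (q * (ln n.+2%:R - ln n.+1%:R)).
  by rewrite /u -expRD; congr expR; ring.
have wE : expR (- p * ln n.+2%:R) = u n.+2 / n.+2%:R.
  by rewrite -[X in _ / X]lnK ?posrE// -expRN /u -expRD; congr expR; rewrite /q; ring.
rewrite [X in X + _]wE uE -!mulrA -mulrDr ler_pM2l ?expR_gt0//.
rewrite -(ler_pM2r q0) mulrDl mulVf ?gt_eqF// mulfVK ?gt_eqF//.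
apply: (le_trans _ (expR_ge1Dx _)).
by rewrite addrC lerD2l mulrC ler_pM2l.
Qed.

End real_estimates.

Section borel_cantelli_real.
Context {R : realType} {d} {Omega : measurableType d} (P : probability Omega R).

Lemma borel_cantelli_eventually (F : nat -> set Omega) (u : nat -> R) (B : R) :
  (forall k, measurable (F k)) -> (forall k, 0 <= u k) ->
  (forall k, (P (F k) <= (u k)%:E)%E) ->
  (forall n, \sum_(0 <= k < n) u k <= B) ->
  {ae P, forall w, exists K, forall k, (K <= k)%N -> ~ F k w}.
Proof.
move=> mF u0 PF uB.
have P0 : P (lim_sup_set F) = 0%E.
  apply: lim_sup_set_cvg0 => //.
  apply: (@le_lt_trans _ _ B%:E); last by rewrite ltry.
  apply: lime_le; first by apply: is_cvg_nneseries => k _ _; exact: measure_ge0.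
  apply: nearW => n; apply: (@le_trans _ _ (\sum_(0 <= k < n) (u k)%:E)%E).
    by apply: lee_sum => k _; exact: PF.
  by rewrite sumEFin lee_fin.
exists (lim_sup_set F); split => //.
  apply: bigcapT_measurable => n; apply: bigcup_measurable => k _; exact: mF.
move=> w /= H n _; apply: contrapT => Hn; apply: H.
by exists n => k nk Fk; apply: Hn; exists k.
Qed.

End borel_cantelli_real.

Section lil_upper_bound.
Context {R : realType} {d d' dO} {T : measurableType d} {T' : measurableType d'}
  {Omega : measurableType dO}.
Variables (nu : probability T' R) (step : T * T' -> T) (phi : T * T' -> R) (C s2 : R).
Hypothesis mstep : measurable_fun setT step.
Hypothesis mphi : measurable_fun setT phi.
Hypothesis phiC : forall z, `|phi z| <= C.
Hypothesis phi0 : forall x, \int[nu]_y phi (x, y) = 0.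
Hypothesis s20 : 0 <= s2.
Hypothesis sum_var_s2 : forall e : R, 0 < e -> exists2 m, (0 < m)%N &
  forall x, `|sum_var nu step phi m x - m%:R * s2| <= e * m%:R.
Variables (P : probability Omega R) (X : nat -> {RV P >-> T'}).
Hypothesis iidX : iid X nu.
Variable x0 : T.
Local Notation M := (martingale step phi X x0).
Local Notation hitset a n := [set w | hit step phi X x0 a n w].

Lemma measurable_hitT a n : measurable (hitset a n).
Proof. exact: (past_measurable (measurable_hit mstep mphi x0 a (X := X) (n := n))). Qed.

(** The exponential bound optimised at [l = a / (v * t)]. *)
Lemma hit_probability (v : R) : s2 < v -> exists2 l0 : R, 0 < l0 &
  forall (a t : R) n, 0 <= a -> 0 < t -> n%:R <= t -> a / (v * t) <= l0 ->
  (P (hitset a n) <= (expR 1 * expR (- (a ^+ 2 / (2 * v * t))))%:E)%E.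
Proof.
move=> sv; have v0 : 0 < v by rewrite (le_lt_trans s20).
have [l0 l00 Hl] := exponential_moment mstep mphi phiC phi0 s20 sum_var_s2
  (ltac:(by rewrite subr_gt0) : 0 < v - s2).
exists l0 => // a t n a0 t0 nt al.
set l := a / (v * t) in al.
have lge0 : 0 <= l by rewrite divr_ge0// mulr_ge0// ltW.
have mh := measurable_hitT a n.
have PE : P (hitset a n) = (\int[P]_w (\1_(hitset a n) w))%:E.
  rewrite (EFin_expect P (bounded_mfun_indic mh)) integral_indic//.
  by rewrite setIT.
rewrite PE lee_fin.
have := maximal_inequality mstep mphi phiC phi0 iidX x0 a n lge0.
rewrite (expect_martingale mstep mphi phiC iidX x0 n (locally_bounded_expR l)).
move=> H; have := Hl l _ n x0 0; rewrite lge0 al => /(_ isT).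
rewrite mulr0 expR0 mulr1 [s2 + _]addrC subrK => H1.
have {}H := le_trans H H1.
rewrite -(ler_pM2l (expR_gt0 (l * a))) (le_trans H)//.
rewrite [leRHS]mulrCA -[expR (l * a) * _]expRD ler_pM2l ?expR_gt0// ler_expR.
apply: (@le_trans _ _ (l ^+ 2 / 2 * v * t)).
  by rewrite ler_wpM2l// mulr_ge0 ?divr_ge0 ?sqr_ge0// ltW.
by rewrite le_eqVlt; apply/orP; left; apply/eqP; rewrite /l; field; rewrite !gt_eqF.
Qed.

(** Along the times [t k = expR (c * k)], the probability of exceeding
    [s * lil_norm (t k)] before time [t k.+1] is of order [k ^ (- expR (2 * c))],
    which is summable. Between [t k] and [t k.+1] the norming is monotone, so the
    bound at [t k] passes to all the times in between. *)
Lemma lil_upper (s : R) : Num.sqrt s2 < s ->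
  {ae P, forall w, exists N, forall n, (N <= n)%N -> M n w <= s * lil_norm n%:R}.
Proof.
move=> ss; have s0 : 0 < s by rewrite (le_lt_trans (sqrtr_ge0 s2)).
have s2s : s2 < s ^+ 2 by rewrite -(sqr_sqrtr s20) ltrXn2r ?nnegrE ?sqrtr_ge0 ?(ltW s0).
pose v := (s2 + s ^+ 2) / 2.
have sv : s2 < v by rewrite /v; lra.
have vs : v < s ^+ 2 by rewrite /v; lra.
clearbody v.
have v0 : 0 < v by rewrite (le_lt_trans s20).
have [l0 l00 Hl] := hit_probability sv.
(* With this [c], [s ^+ 2 / (v * expR c) = expR (2 * c)] exceeds [1]: one factor
   [expR c] is lost between consecutive times. *)
pose c := ln (s ^+ 2 / v) / 3.
have c0 : 0 < c by rewrite divr_gt0// ln_gt0// ltr_pdivlMr// mul1r.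
have c3 : expR (3 * c) * v = s ^+ 2.
  rewrite /c (_ : 3 * (ln (s ^+ 2 / v) / 3) = ln (s ^+ 2 / v)); last by field.
  rewrite lnK ?posrE ?divr_gt0 ?exprn_gt0//.
  by rewrite divfK// gt_eqF.
pose t (k : nat) : R := expR (c * k%:R).
pose a (k : nat) : R := s * lil_norm (t k).
pose N (k : nat) := Num.truncn (t k.+1).
have tS k : t k.+1 = expR c * t k by rewrite /t -expRD -natr1; congr expR; ring.
pose p := expR (2 * c).
have p1 : 1 < p by rewrite /p -expR0 ltr_expR mulr_gt0.
(* From [k0] on, [ln (c * k%:R)] is nonnegative and the optimal [l] is within the
   range of the exponential bound. *)
pose k0 := maxn (Num.truncn c^-1).+1 (Num.truncn (4 * s ^+ 2 / (v ^+ 2 * c * l0 ^+ 2))).+1.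
have ck0 k : (k0 <= k)%N -> 1 <= c * k%:R.
  rewrite /k0 geq_max => /andP[H _]; rewrite -ler_pdivrMl// mulr1.
  by rewrite (le_trans (ltW (truncnS_gt _)))// ler_nat.
have ak0 k : (k0 <= k)%N ->
    (P (hitset (a k) (N k)) <= (expR 1 * expR (- p * ln (c * k%:R)))%:E)%E.
  move=> kk; have ck := ck0 k kk.
  have ck0' : 0 < c * k%:R by rewrite (lt_le_trans ltr01).
  have k00 : 0 < k%:R :> R by rewrite -(pmulr_rgt0 _ c0).
  have L0 : 0 <= ln (c * k%:R) by exact: ln_ge0.
  have t0 : 0 < t k by exact: expR_gt0.
  have a2 : a k ^+ 2 = s ^+ 2 * (2 * t k * ln (c * k%:R)).
    rewrite /a exprMn /lil_norm /t expRK sqr_sqrtr// !mulr_ge0// expR_ge0//.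
  have a0 : 0 <= a k by rewrite mulr_ge0 ?(ltW s0)// sqrtr_ge0.
  have al : a k / (v * t k.+1) <= l0.
    rewrite -(@ler_pXn2r _ 2) ?nnegrE ?(ltW l00)//; last first.
      by rewrite divr_ge0// mulr_ge0 ?expR_ge0// ltW.
    rewrite expr_div_n a2 tS.
    have e1 : 1 <= expR c by rewrite -expR0 ler_expR ltW.
    have Lk : ln (c * k%:R) <= c * k%:R by rewrite ltW// ln_sublinear.
    have tk : (c * k%:R) ^+ 2 / 2 <= t k.
      have := @expR_ge1Dxn R (c * k%:R) 1 (ltW ck0'); rewrite /t !factS fact0; lra.
    rewrite ler_pdivrMr; last by rewrite exprn_gt0// mulr_gt0// mulr_gt0// expR_gt0.
    have kl : 4 * s ^+ 2 <= v ^+ 2 * c * l0 ^+ 2 * k%:R.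
      rewrite -ler_pdivrMl; last by apply: mulr_gt0; [apply: mulr_gt0|]; rewrite ?exprn_gt0.
      rewrite mulrC (le_trans (ltW (truncnS_gt _)))// ler_nat.
      by move: kk; rewrite /k0 geq_max => /andP[].
    have step1 : s ^+ 2 * (2 * t k * ln (c * k%:R)) <= 2 * s ^+ 2 * t k * (c * k%:R).
      rewrite [leLHS](_ : _ = 2 * s ^+ 2 * t k * ln (c * k%:R)); last by ring.
      by rewrite ler_wpM2l// !mulr_ge0 ?sqr_ge0// ltW.
    apply: (le_trans step1).
    have step2 : v ^+ 2 * t k ^+ 2 <= (v * (expR c * t k)) ^+ 2.
      rewrite !exprMn ler_wpM2l ?sqr_ge0// ler_peMl ?sqr_ge0//.
      by rewrite expr2 -[1]mulr1 ler_pM.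
    apply: (le_trans _ (ler_wpM2l (sqr_ge0 l0) step2)).
    have -> : l0 ^+ 2 * (v ^+ 2 * t k ^+ 2) = l0 ^+ 2 * v ^+ 2 * t k * t k by ring.
    have -> : 2 * s ^+ 2 * t k * (c * k%:R) = 2 * s ^+ 2 * (c * k%:R) * t k by ring.
    rewrite ler_pM2r// .
    apply: (@le_trans _ _ (l0 ^+ 2 * v ^+ 2 * ((c * k%:R) ^+ 2 / 2))); last first.
      by rewrite ler_wpM2l// mulr_ge0 ?sqr_ge0.
    have -> : 2 * s ^+ 2 * (c * k%:R) = 4 * s ^+ 2 * (c * k%:R / 2) by field.
    have -> : l0 ^+ 2 * v ^+ 2 * ((c * k%:R) ^+ 2 / 2) =
      v ^+ 2 * c * l0 ^+ 2 * k%:R * (c * k%:R / 2) by field.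
    by rewrite ler_wpM2r// divr_ge0// ltW.
  have := Hl (a k) (t k.+1) (N k) a0 (expR_gt0 _) _ al.
  rewrite truncn_le ?expR_ge0// => /(_ isT) /le_trans; apply.
  rewrite lee_fin ler_pM2l ?expR_gt0// ler_expR mulNr lerN2 a2 tS.
  have -> : s ^+ 2 * (2 * t k * ln (c * k%:R)) / (2 * v * (expR c * t k)) =
     s ^+ 2 / (v * expR c) * ln (c * k%:R) by field; rewrite !gt_eqF ?expR_gt0.
  rewrite ler_wpM2r// -c3 /p ler_pdivlMr ?mulr_gt0 ?expR_gt0//.
  by rewrite mulrCA -expRD mulrC (_ : 2 * c + c = 3 * c)//; ring.
have [B HB] := sum_expR_ln_le p1.
pose D : R := expR 1 * expR (- p * ln c).
have D0 : 0 <= D by rewrite mulr_ge0 ?expR_ge0.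
have mF k : measurable (if (k0 <= k)%N then hitset (a k) (N k) else set0).
  by case: ifP => // _; exact: measurable_hitT.
have PF k : (P (if (k0 <= k)%N then hitset (a k) (N k) else set0) <=
    (D * expR (- p * ln k%:R))%:E)%E.
  case: ifPn => [kk|_]; last by rewrite measure0 lee_fin mulr_ge0// expR_ge0.
  apply: (le_trans (ak0 k kk)); rewrite lee_fin /D -mulrA ler_pM2l ?expR_gt0//.
  have k00 : 0 < k%:R :> R by rewrite -(pmulr_rgt0 _ c0) (lt_le_trans ltr01)// ck0.
  by rewrite -expRD ler_expR lnM ?posrE// mulrDr.
have sumD n : \sum_(0 <= k < n) D * expR (- p * ln k%:R) <= D * B.
  by rewrite -mulr_sumr ler_wpM2l.
have u0 k : 0 <= D * expR (- p * ln k%:R) by rewrite mulr_ge0// expR_ge0.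
have := borel_cantelli_eventually mF u0 PF sumD.
apply: filterS => w [K HK].
pose k1 := maxn K k0; exists (Num.truncn (t k1)).+1 => n Nn.
have tn : t k1 <= n%:R by rewrite (le_trans (ltW (truncnS_gt _)))// ler_nat.
have n0 : 0 < n%:R :> R by rewrite (lt_le_trans (expR_gt0 _) tn).
have lnn : c * k1%:R <= ln n%:R by rewrite -(@expRK R (c * k1%:R)) ler_ln// posrE expR_gt0.
have lnn0 : 0 <= ln n%:R / c by rewrite divr_ge0 ?(ltW c0)// (le_trans _ lnn)// mulr_ge0// ltW.
pose k := Num.truncn (ln n%:R / c).
have k1k : (k1 <= k)%N by rewrite /k truncn_ge_nat// ler_pdivlMr// mulrC.
have tkn : t k <= n%:R.
  rewrite -[leRHS]lnK ?posrE// ler_expR mulrC -ler_pdivlMr//.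
  by rewrite truncn_le.
have nNk : (n <= N k)%N.
  rewrite /N truncn_ge_nat ?expR_ge0// -[leLHS]lnK ?posrE// ler_expR mulrC -ler_pdivrMr//.
  by rewrite ltW// truncnS_gt.
have kk0 : (k0 <= k)%N by rewrite (leq_trans _ k1k)// leq_maxr.
have := HK k; rewrite kk0 (leq_trans _ k1k) ?leq_maxl// => /(_ isT) /= /negP nh.
have : M n w < a k.
  by rewrite ltNge; apply: contra nh => H; apply/hitP; exists n.
move/ltW/le_trans; apply; rewrite /a ler_pM2l//; apply: lil_norm_le => //.
by rewrite /t ler_expR ck0.
Qed.

End lil_upper_bound.

(** * The lower half of the law of the iterated logarithm *)

Section lil_lower_bound.
Context {R : realType} {d d' dO} {T : measurableType d} {T' : measurableType d'}
  {Omega : measurableType dO}.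
Variables (nu : probability T' R) (step : T * T' -> T) (phi : T * T' -> R) (C s2 : R).
Hypothesis mstep : measurable_fun setT step.
Hypothesis mphi : measurable_fun setT phi.
Hypothesis phiC : forall z, `|phi z| <= C.
Hypothesis phi0 : forall x, \int[nu]_y phi (x, y) = 0.
Hypothesis s20 : 0 < s2.
Hypothesis sum_var_s2 : forall e : R, 0 < e -> exists2 m, (0 < m)%N &
  forall x, `|sum_var nu step phi m x - m%:R * s2| <= e * m%:R.
Variables (P : probability Omega R) (X : nat -> {RV P >-> T'}).
Hypothesis iidX : iid X nu.
Variable x0 : T.
Local Notation V := (transition nu step phi).
Local Notation S := (state step X x0).
Local Notation M := (martingale step phi X x0).
Local Notation past n := (g_sigma_algebraType (cylinder X n)).
Local Notation sigma := (Num.sqrt s2).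

Let sigma0 : 0 < sigma. Proof. by rewrite sqrtr_gt0. Qed.

Lemma probability_expect (A : set Omega) : measurable A -> P A = (\int[P]_w \1_A w)%:E.
Proof.
by move=> mA; rewrite (EFin_expect P (bounded_mfun_indic mA)) integral_indic// setIT.
Qed.

Lemma measurable_increment_ge n j b :
  (<<s cylinder X (n + j) >>) [set w | b <= M (n + j) w - M n w].
Proof.
have mMn : measurable_fun setT ((fun w => M (n + j) w - M n w) : past (n + j) -> R).
  have [] := bounded_mfunB (bounded_mfun_martingale mstep mphi phiC X x0 (n + j))
    (bounded_mfun_pastD j (bounded_mfun_martingale mstep mphi phiC X x0 n)) => //.
have := mMn measurableT `[b, +oo[%classic (measurable_itv _).
rewrite setTI (_ : _ @^-1` _ = [set w | b <= M (n + j) w - M n w])//.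
by apply/seteqP; split => w /=; rewrite in_itv/= andbT.
Qed.

Lemma measurable_pastD n j (D : set Omega) :
  (<<s cylinder X n >>) D -> (<<s cylinder X (n + j) >>) D.
Proof.
move=> mD; elim: j => [|j IH]; first by rewrite addn0.
by rewrite addnS; exact: pastS.
Qed.

(** The central limit theorem, uniform in the starting point, bounds below the
    conditional probability that one block of [q] steps gains [u] deviations. For
    large [u] the exponent is [u ^+ 2 / 2] to leading order, and [c] is the same
    for all [u]. *)
Lemma block_lower : exists2 c, 0 <= c & forall u : R, 0 <= u ->
  exists Q, forall q n (D : set Omega),
  (Q <= q)%N -> (<<s cylinder X n >>) D ->
  ((expR (- ((u + 2) ^+ 2 / 2 + c)))%:E * P D <=
   P (D `&` [set w | (u * sigma * Num.sqrt q%:R <= M (n + q) w - M n w)%R]))%E.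
Proof.
have np0 : 0 < normal_peak 1 :> R by apply: normal_peak_gt0; rewrite oner_eq0.
pose c : R := `|ln (normal_peak 1 / 2)|.
exists c => [|u u0]; first exact: normr_ge0.
pose p : R := normal_peak 1 * expR (- ((u + 2) ^+ 2 / 2)).
have p0 : 0 < p by rewrite mulr_gt0// expR_gt0.
(* [psi] vanishes below [u * sigma] and equals [1] above [(u + 1) * sigma]. *)
pose k := 3 / sigma; have k0 : 0 < k by rewrite divr_gt0.
have [L [B [L0 cpsi]]] := taylor_class_spline (k * (u * sigma)) k0.
set psi := fun y => spline (k * y - k * (u * sigma)) in cpsi.
have [N HN] := uniform_clt mstep mphi phiC phi0 (ltW s20) sum_var_s2 L0 cpsi
  (divr_gt0 p0 (ltr0n _ 2)).
exists (maxn 1 N) => q n D; rewrite geq_max => /andP[q1 Nq] mD.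
have q0 : 0 < Num.sqrt q%:R :> R by rewrite sqrtr_gt0 ltr0n.
have mDT := past_measurable mD.
pose G := [set w | u * sigma * Num.sqrt q%:R <= M (n + q) w - M n w].
have mG : measurable G := past_measurable (@measurable_increment_ge n q _).
have mDG : measurable (D `&` G) by exact: measurableI.
have heat_ge : p <= heat sigma psi 0.
  have := @gauss_tail R (u + 1) (ltac:(by rewrite addr_ge0)).
  rewrite (_ : u + 1 + 1 = u + 2); last by ring.
  move=> /le_trans; apply.
  apply: expect_le.
  - by apply: bounded_mfun_indic; exact: measurable_itv.
  - exact: (bounded_mfun_affine _ _ cpsi.1).
  - move=> z; rewrite indicE; have [|_] := boolP (z \in _); last first.
      by rewrite /psi; have /andP[] := spline_bounds (k * (0 + sigma * z) - k * (u * sigma)).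
    rewrite inE/= in_itv/= andbT => uz; rewrite /psi spline_ge3//.
    rewrite add0r -mulrBr (_ : sigma * z - u * sigma = sigma * (z - u)); last by ring.
    rewrite /k mulrA divfK ?gt_eqF// ler_peMr//; lra.
have lpsi : locally_bounded_mfun (fun z : T * R => psi (z.2 / Num.sqrt q%:R)).
  apply: (bounded_mfun_snd (psi := fun y => psi (y / Num.sqrt q%:R))).
  by apply: (bounded_mfun_comp _ cpsi.1); exact: measurable_funM.
have Vge x : p / 2 <= iter q V (fun z => psi (z.2 / Num.sqrt q%:R)) (x, 0).
  have := HN q Nq x; rewrite ler_norml => /andP[+ _]; lra.
have bD : bounded_mfun (\1_D : past n -> R) by exact: bounded_mfun_indic.
have b0 : bounded_mfun ((fun=> 0) : past n -> R) by exact: bounded_mfun_cst.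
have MP := markov_property mstep mphi phiC iidX x0 q bD b0 lpsi.
rewrite (probability_expect mDT) (probability_expect mDG) -EFinM lee_fin.
have cp : expR (- ((u + 2) ^+ 2 / 2 + c)) <= p / 2.
  have -> : p / 2 = expR (- ((u + 2) ^+ 2 / 2)) * (normal_peak 1 / 2) by rewrite /p; ring.
  rewrite opprD expRD ler_pM2l ?expR_gt0//.
  rewrite -[leRHS]lnK ?posrE ?divr_gt0// ler_expR /c.
  by rewrite lerNl -normrN ler_norm.
have bDM : bounded_mfun ((fun w =>
    \1_D w * psi ((0 + (M (n + q) w - M n w)) / Num.sqrt q%:R)) : past (n + q) -> R).
  apply: bounded_mfunM; first exact: bounded_mfun_pastD.
  have bMM : bounded_mfun ((fun w => 0 + (M (n + q) w - M n w)) : past (n + q) -> R).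
    apply: bounded_mfunD; first exact: bounded_mfun_cst.
    apply: bounded_mfunB; first exact: bounded_mfun_martingale.
    by apply: bounded_mfun_pastD; exact: (bounded_mfun_martingale mstep mphi phiC).
  exact: (bounded_mfun_past_state mstep x0 bMM lpsi).
have bDV : bounded_mfun ((fun w =>
    \1_D w * iter q V (fun z => psi (z.2 / Num.sqrt q%:R)) (S n w, 0)) : past n -> R).
  apply: bounded_mfunM => //.
  exact: (bounded_mfun_past_state mstep x0 b0 (locally_bounded_iter nu mstep mphi phiC q lpsi)).
apply: (@le_trans _ _ (\int[P]_w (\1_D w * psi ((0 + (M (n + q) w - M n w)) / Num.sqrt q%:R)))).
  rewrite MP -(expectZ P _ (bounded_mfun_indic mDT)); apply: expect_le.
  - by apply: bounded_mfunZ; exact: bounded_mfun_indic.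
  - exact: (bounded_mfun_past bDV).
  - move=> w; rewrite mulrC; apply: ler_wpM2l; first by rewrite indicE.
    exact: (le_trans cp (Vge _)).
apply: expect_le; [exact: (bounded_mfun_past bDM)|exact: bounded_mfun_indic|].
move=> w; rewrite indicI/= /G; have /andP[s0 s1] := spline_bounds
  (k * ((0 + (M (n + q) w - M n w)) / Num.sqrt q%:R) - k * (u * sigma)).
apply: ler_wpM2l; first by rewrite indicE.
rewrite indicE; have [_|/negP H] := boolP (w \in _); first exact: s1.
rewrite /psi spline_le0// subr_le0 ler_pM2l// ler_pdivrMr// add0r ltW// ltNge.
by apply/negP => H'; apply: H; rewrite inE.
Qed.

(** Successive blocks are chained by conditioning: what happened in the first blocks
    is an event of the past of the next one. *)
Lemma blocks_lower (p b : R) q : 0 <= p ->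
  (forall n (D : set Omega), (<<s cylinder X n >>) D ->
    (p%:E * P D <= P (D `&` [set w | (b <= M (n + q) w - M n w)%R]))%E) ->
  forall j n (D : set Omega), (<<s cylinder X n >>) D ->
  ((p ^+ j)%:E * P D <=
    P (D `&` [set w | (j%:R * b <= M (n + j * q) w - M n w)%R]))%E.
Proof.
move=> p0 H; elim=> [|j IH] n D mD.
  rewrite expr0 mul1e mul0n addn0 (_ : _ `&` _ = D)//.
  by apply/seteqP; split => w; [case|move=> Dw; split => //=; rewrite mul0r subrr].
pose G := D `&` [set w | j%:R * b <= M (n + j * q) w - M n w].
have mG : (<<s cylinder X (n + j * q) >>) G.
  apply: (@measurableI _ (past (n + j * q))); first exact: measurable_pastD.
  exact: measurable_increment_ge.
have := H _ _ mG.
have le1 : ((p ^+ j.+1)%:E * P D <= p%:E * P G)%E.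
  by rewrite exprS EFinM -muleA; apply: lee_wpmul2l; [rewrite lee_fin|exact: IH].
move=> /(le_trans le1)/le_trans; apply; apply: le_measure; rewrite ?inE.
- apply: measurableI; first exact: past_measurable mG.
  exact: past_measurable (@measurable_increment_ge _ _ _).
- apply: measurableI; first exact: past_measurable mD.
  exact: past_measurable (@measurable_increment_ge _ _ _).
- move=> w [[Dw /= h1] /= h2]; split => //=.
  rewrite mulSn [(q + _)%N]addnC addnA -natr1 mulrDl mul1r; lra.
Qed.

(** A conditional form of the second Borel-Cantelli lemma: the probability that none
    of the [B k] with [k1 <= k < K] occurs is at most the product of the [1 - c k],
    hence at most the exponential of the opposite of their sum. *)
Lemma borel_cantelli_past (nk : nat -> nat) (B : nat -> set Omega) (c : nat -> R) k0 :
  (forall k, (nk k <= nk k.+1)%N) ->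
  (forall k, (<<s cylinder X (nk k.+1) >>) (B k)) ->
  (forall k (D : set Omega), (k0 <= k)%N -> (<<s cylinder X (nk k) >>) D ->
    ((c k)%:E * P D <= P (D `&` B k))%E) ->
  (forall A k1, exists K, A <= \sum_(k1 <= k < K) c k) ->
  {ae P, forall w, forall k1, exists2 k, (k1 <= k)%N & B k w}.
Proof.
move=> nkS mB HB cdiv.
have mBT k : measurable (B k) := past_measurable (mB k).
pose E k1 K := \bigcap_(k in [set k | (k1 <= k < K)%N]) ~` B k.
have mE k1 K : (k1 <= K)%N -> (<<s cylinder X (nk K) >>) (E k1 K).
  move=> _; apply: (@bigcap_measurableType _ (past (nk K))) => k /= /andP[_ kK].
  apply: (@measurableC _ (past (nk K))).
  have := mB k; rewrite -(subnKC kK) => H.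
  elim: (K - k.+1)%N => [|j IH]; first by rewrite addn0.
  by rewrite addnS -(subnKC (nkS (k.+1 + j)%N)); apply: measurable_pastD.
have PE k1 K : (k0 <= k1)%N -> (k1 <= K)%N ->
    (P (E k1 K) <= (expR (- \sum_(k1 <= k < K) c k))%:E)%E.
  move=> k01 k1K; rewrite -(subnKC k1K); elim: (K - k1)%N => [|j IH].
    rewrite addn0 big_geq// oppr0 expR0.
    exact: (probability_le1 P (past_measurable (mE k1 k1 (leqnn _)))).
  rewrite addnS; set K' := (k1 + j)%N in IH *.
  have kK' : (k1 <= K')%N by rewrite leq_addr.
  have ES : E k1 K'.+1 = E k1 K' `\` B K'.
    apply/seteqP; split => w.
      move=> H; split; last by apply: (H K'); rewrite /= kK' ltnSn.
      by move=> k /= /andP[k1k kk]; apply: H; rewrite /= k1k ltnS ltnW.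
    move=> [H1 H2] k /= /andP[k1k]; rewrite ltnS leq_eqVlt => /orP[/eqP ->//|kk].
    by apply: H1; rewrite /= k1k.
  have mEK := mE k1 K' kK'.
  have mEKT : measurable (E k1 K') := past_measurable mEK.
  have := HB K' _ (leq_trans k01 kK') mEK.
  have fE : P (E k1 K') \is a fin_num by exact: fin_num_measure.
  have fEB : P (E k1 K' `&` B K') \is a fin_num by apply: fin_num_measure; exact: measurableI.
  have PD : P (E k1 K' `\` B K') =
      (fine (P (E k1 K')) - fine (P (E k1 K' `&` B K')))%:E.
    by rewrite EFinB !fineK//; apply: measureD => //; rewrite ltey_eq fE.
  rewrite ES PD -{1}(fineK fE) -{1}(fineK fEB) -EFinM !lee_fin => H.
  have := IH; rewrite -{1}(fineK fE) lee_fin => IH'.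
  have x0' : 0 <= fine (P (E k1 K')) by rewrite fine_ge0.
  rewrite big_nat_recr//= opprD expRD.
  apply: (@le_trans _ _ (fine (P (E k1 K')) * (1 - c K'))); first lra.
  apply: (@le_trans _ _ (fine (P (E k1 K')) * expR (- c K'))).
    by rewrite ler_wpM2l// expR_ge1Dx.
  by rewrite ler_wpM2r// expR_ge0.
pose Z k1 := \bigcap_(k in [set k | (k1 <= k)%N]) ~` B k.
have mZ k1 : measurable (Z k1).
  by apply: bigcap_measurableType => k _; exact: measurableC.
have Z0 k1 : (k0 <= k1)%N -> P (Z k1) = 0%E.
  move=> k01; apply/eqP; rewrite eq_le measure_ge0 andbT.
  apply/lee_addgt0Pr => e e0; rewrite add0e.
  have [K HK] := cdiv (- ln e) k1.
  pose K' := maxn k1 K.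
  have K'E : (P (Z k1) <= P (E k1 K'))%E.
    apply: le_measure; rewrite ?inE//; first exact: (past_measurable (mE k1 K' (leq_maxl _ _))).
    by move=> w H k /= /andP[k1k _]; apply: H.
  apply: (le_trans K'E); apply: (le_trans (PE k1 K' k01 (leq_maxl _ _))).
  rewrite lee_fin -[leRHS]lnK ?posrE// ler_expR lerNl.
  rewrite /K'; have [k1K|Kk1] := leqP k1 K; first exact: HK.
  by move: HK; rewrite !big_geq// ltnW.
have : P.-negligible (\bigcup_k1 Z (k0 + k1)%N).
  apply: negligible_bigcup => k1.
  by exists (Z (k0 + k1)%N); split => //; apply: Z0; rewrite leq_addr.
apply: negligibleS => w /= H; apply: contrapT => HZ; apply: H => k1.
apply: contrapT => Hk; apply: HZ; exists k1 => // k /= kk Bk; apply: Hk.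
by exists k => //; rewrite (leq_trans _ kk)// leq_addl.
Qed.

End lil_lower_bound.

Section lil_lower_parameters.
Context {R : realType}.

Lemma ln_natX_S (r k : nat) : (1 < r)%N -> ln (r ^ k.+1)%:R = k.+1%:R * ln r%:R :> R.
Proof. by move=> r1; rewrite natrX lnXn ?ltr0n ?(ltnW r1)// mulr_natl. Qed.

(** The iterated logarithm of [r ^ k.+1] is of order [ln k], whereas [r ^ k] grows
    exponentially. *)
Lemma log_log_negligible (r : nat) (A : R) : (1 < r)%N -> 0 <= A -> exists k0, forall k,
  (k0 <= k)%N -> [/\ expR 1 <= (r ^ k)%:R :> R, 0 <= ln (ln (r ^ k.+1)%:R) :> R &
    A * (2 * ln (ln (r ^ k.+1)%:R) + 1) <= (r ^ k)%:R].
Proof.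
move=> r1 A0; pose y : R := ln r%:R.
have y0 : 0 < y by rewrite ln_gt0// ltr1n.
pose k0 := maxn (Num.truncn (y^-1)).+1 (Num.truncn (2 * A * (4 * y + 1) / y ^+ 2)).+1.
exists k0 => k; rewrite geq_max => /andP[k1 k2].
have kR1 : 1 <= k%:R :> R by rewrite ler1n (leq_trans _ k1).
have ky : 1 <= k%:R * y.
  by rewrite -ler_pdivrMr// mul1r (le_trans (ltW (truncnS_gt _)))// ler_nat.
have rkE : (r ^ k)%:R = expR (k%:R * y) :> R.
  by rewrite natrX expRM_natl lnK// posrE ltr0n ltnW.
have lnE : ln (r ^ k.+1)%:R = k.+1%:R * y :> R by rewrite ln_natX_S.
have ln1' : 1 <= k.+1%:R * y.
  by rewrite (le_trans ky)// ler_pM2r// ler_nat.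
split; first by rewrite rkE ler_expR.
  by rewrite lnE ln_ge0.
have H2 : 2 * A * (4 * y + 1) <= k%:R * y ^+ 2.
  rewrite -ler_pdivrMr ?exprn_gt0// (le_trans (ltW (truncnS_gt _)))// ler_nat//.
have ll : ln (ln (r ^ k.+1)%:R) <= k.+1%:R * y.
  by rewrite lnE ltW// ln_sublinear// (lt_le_trans ltr01).
apply: (@le_trans _ _ (A * (2 * (k.+1%:R * y) + 1))).
  by rewrite ler_wpM2l//; lra.
have kS : k.+1%:R <= 2 * k%:R :> R by rewrite -natr1; lra.
apply: (@le_trans _ _ (A * ((4 * y + 1) * k%:R))).
  rewrite ler_wpM2l//.
  have : k.+1%:R * y <= 2 * k%:R * y by rewrite ler_pM2r.
  by rewrite mulrDl mul1r; lra.
apply: (@le_trans _ _ ((k%:R * y) ^+ 2 / 2)).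
  have := ler_wpM2r (le_trans ler01 kR1) H2.
  by rewrite exprMn; lra.
rewrite rkE; have := @expR_ge1Dxn R (k%:R * y) 1 (le_trans ler01 ky).
by rewrite !factS fact0; lra.
Qed.

(** The [(r - 1) * r ^ k] steps between [r ^ k] and [r ^ k.+1] are cut into about
    [2 * kap * L / u ^+ 2] blocks of length [q], each of which gains [u] deviations
    with probability [expR (- Lam)]. Altogether they gain close to
    [Num.sqrt (2 * kap * L * (r - 1) * r ^ k)] deviations, and they do so with
    probability at least of order [expR (- L)], that is [1 / k]. *)
Lemma block_parameters (kap tau u Lam : R) (Q r : nat) : 0 < kap <= 1 -> 0 < tau ->
  1 <= u -> 0 <= Lam -> 2 * kap * Lam <= u ^+ 2 -> (1 < r)%N ->
  exists k0, forall k, (k0 <= k)%N -> let L : R := ln (ln (r ^ k.+1)%:R) in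
  exists j q : nat, [/\ (Q <= q)%N, (j * q <= (r - 1) * r ^ k)%N,
    2 * kap * L * ((1 - tau) * ((r - 1) * r ^ k)%:R) <= (j%:R * u) ^+ 2 * q%:R &
    expR (- Lam) * expR (- L) <= expR (- Lam) ^+ j].
Proof.
move=> /andP[kap0 kap1] tau0 u1 Lam0 Lamu r1.
have u0 : 0 < u by rewrite (lt_le_trans ltr01).
have u21 : 1 <= u ^+ 2 by rewrite -(expr1n _ 2) lerXn2r ?nnegrE// ltW.
have u20 : 0 < u ^+ 2 by rewrite exprn_gt0.
pose A : R := tau^-1 + Q%:R.
have ti0 : 0 < tau^-1 by rewrite invr_gt0.
have A0 : 0 <= A by rewrite addr_ge0// ltW.
have [k0 Hk0] := log_log_negligible r1 A0.
exists k0 => k kk L; have [_ L0 AL] := Hk0 k kk; rewrite -/L in L0 AL.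
set l := ((r - 1) * r ^ k)%N.
have lrk : ((r ^ k)%:R : R) <= l%:R.
  by rewrite ler_nat /l leq_pmull// subn_gt0.
pose j := (Num.truncn (2 * kap * L / u ^+ 2)).+1.
have z0 : 0 <= 2 * kap * L / u ^+ 2 by rewrite divr_ge0 ?(ltW u20)// !mulr_ge0// ltW.
have j1 : 2 * kap * L / u ^+ 2 <= j%:R by rewrite ltW// truncnS_gt.
have j2 : j%:R <= 2 * kap * L / u ^+ 2 + 1.
  by rewrite /j -natr1 lerD2r truncn_le.
have j3 : j%:R <= 2 * L + 1.
  rewrite (le_trans j2)// lerD2r ler_pdivrMr//.
  apply: (@le_trans _ _ (2 * L * 1)); last by rewrite ler_wpM2l// mulr_ge0.
  by rewrite mulr1 mulrAC ler_piMr// mulr_ge0.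
have Aj : A * j%:R <= l%:R.
  by rewrite (le_trans _ lrk)// (le_trans _ AL)// ler_wpM2l.
have jR0 : 0 < j%:R :> R by rewrite ltr0n.
have jtau : j%:R <= tau * l%:R.
  rewrite -ler_pdivrMl//; apply: (le_trans _ Aj).
  by rewrite /A mulrDl lerDl mulr_ge0.
have Qj : (Q * j <= l)%N.
  rewrite -(ler_nat R) natrM; apply: (le_trans _ Aj).
  by rewrite /A mulrDl lerDr mulr_ge0// ltW.
exists j, (l %/ j)%N; split.
- by rewrite leq_divRL.
- by rewrite mulnC leq_trunc_div.
- have jq : (1 - tau) * l%:R <= j%:R * (l %/ j)%:R.
    have lj : (l < (l %/ j).+1 * j)%N by rewrite ltn_ceil.
    have : (l%:R : R) <= (l %/ j).+1%:R * j%:R by rewrite -natrM ler_nat ltnW.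
    by rewrite -natr1; lra.
  have ju : 2 * kap * L <= j%:R * u ^+ 2 by rewrite -ler_pdivrMr.
  rewrite (_ : (j%:R * u) ^+ 2 * (l %/ j)%:R = (j%:R * u ^+ 2) * (j%:R * (l %/ j)%:R)); last by ring.
  apply: (@le_trans _ _ ((2 * kap * L) * (j%:R * (l %/ j)%:R))).
    by rewrite ler_wpM2l// !mulr_ge0// ltW.
  by rewrite ler_wpM2r// mulr_ge0// ltW.
- rewrite -expRM_natl -expRD ler_expR mulrN -opprD lerN2.
  apply: (le_trans (ler_wpM2r Lam0 j2)).
  rewrite mulrDl mul1r addrC lerD2l.
  have -> : 2 * kap * L / u ^+ 2 * Lam = (2 * kap * Lam) / u ^+ 2 * L by field; rewrite gt_eqF.
  by rewrite ler_piMl// ler_pdivrMr// mul1r.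
Qed.

Lemma sum_harmonic_ge (D A : R) k1 : 0 < D ->
  exists K, A <= \sum_(k1 <= k < K) (D / k.+1%:R).
Proof.
move=> D0.
have H K : (k1 <= K)%N -> D * (ln K.+1%:R - ln k1.+1%:R) <= \sum_(k1 <= k < K) (D / k.+1%:R).
  move=> kK; rewrite -mulr_sumr ler_wpM2l ?(ltW D0)//.
  rewrite -(telescope_sumr (fun k => ln k.+1%:R) kK); apply: ler_sum => k _.
  have k1' : 0 < k.+1%:R :> R by rewrite ltr0n.
  rewrite -ln_div ?posrE ?ltr0n//.
  have -> : k.+2%:R / k.+1%:R = 1 + k.+1%:R^-1 :> R.
    by rewrite -natr1 mulrDl divff ?gt_eqF// mul1r.
  apply: le_ln1Dx; rewrite (lt_trans (_ : -1 < 0))// ?invr_gt0//; lra.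
pose K := maxn k1 (Num.truncn (expR (A / D + ln k1.+1%:R))).+1.
exists K; apply: (le_trans _ (H K (leq_maxl _ _))).
rewrite -ler_pdivrMl// lerBrDr mulrC -[leLHS](@expRK R) ler_ln ?posrE ?expR_gt0 ?ltr0n//.
rewrite (le_trans (ltW (truncnS_gt _)))// ler_nat (leq_trans (leq_maxr k1 _))//.
Qed.

End lil_lower_parameters.

Section lil_lower.
Context {R : realType} {d d' dO} {T : measurableType d} {T' : measurableType d'}
  {Omega : measurableType dO}.
Variables (nu : probability T' R) (step : T * T' -> T) (phi : T * T' -> R) (C s2 : R).
Hypothesis mstep : measurable_fun setT step.
Hypothesis mphi : measurable_fun setT phi.
Hypothesis phiC : forall z, `|phi z| <= C.
Hypothesis phi0 : forall x, \int[nu]_y phi (x, y) = 0.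
Hypothesis s20 : 0 <= s2.
Hypothesis sum_var_s2 : forall e : R, 0 < e -> exists2 m, (0 < m)%N &
  forall x, `|sum_var nu step phi m x - m%:R * s2| <= e * m%:R.
Variables (P : probability Omega R) (X : nat -> {RV P >-> T'}).
Hypothesis iidX : iid X nu.
Variable x0 : T.
Local Notation M := (martingale step phi X x0).
Local Notation sigma := (Num.sqrt s2).

(** The upper bound for the functional [- phi], which has the same variances. *)
Lemma lil_upper_opp (s : R) : sigma < s ->
  {ae P, forall w, exists N, forall n, (N <= n)%N -> - (s * lil_norm n%:R) <= M n w}.
Proof.
move=> ss; pose phiN z := - phi z.
have mphiN : measurable_fun setT phiN by exact: measurable_funN.
have phiNC z : `|phiN z| <= C by rewrite normrN.
have phiN0 x : \int[nu]_y phiN (x, y) = 0.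
  have := expectB nu (bounded_mfun_cst 0) (bounded_mfun_section x (bounded_mfun_phi mphi phiC)).
  rewrite phi0 expect_cst subrr => H; rewrite -[RHS]H.
  by apply: eq_Rintegral => y _; rewrite sub0r.
have svE : sum_var nu step phiN = sum_var nu step phi.
  apply/funext => x; apply/eqP; move: x.
  suff H m : sum_var nu step phiN m = sum_var nu step phi m by move=> m; rewrite H.
  elim: m => [//|m IH]; apply/funext => x /=; rewrite IH; congr (_ + _).
  by apply: eq_Rintegral => y _; rewrite sqrrN.
have svN e : 0 < e -> exists2 m, (0 < m)%N &
    forall x, `|sum_var nu step phiN m x - m%:R * s2| <= e * m%:R.
  by rewrite svE; exact: sum_var_s2.
have := lil_upper mstep mphiN phiNC phiN0 s20 svN iidX x0 ss.
apply: filterS => w [N HN]; exists N => n Nn; rewrite lerNl.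
have -> : - M n w = martingale step phiN X x0 n w.
  by rewrite /martingale -sumrN.
exact: HN.
Qed.

(** Between [r ^ k] and [r ^ k.+1] the martingale gains almost the full
    [sigma * lil_norm (r ^ k.+1)] with conditional probability at least of order
    [1 / k], hence infinitely often. What was accumulated before [r ^ k] cannot
    spoil this: by the upper bound for [- M] it is at least
    [- 2 * sigma * lil_norm (r ^ k)], which is small compared with
    [lil_norm (r ^ k.+1)] when [r] is large. *)
Lemma lil_lower (s : R) : s < sigma ->
  {ae P, forall w, forall N, exists2 n, (N <= n)%N & s * lil_norm n%:R <= M n w}.
Proof.
wlog s0 : s / 0 <= s.
  move=> H ss; have [s0|s0] := leP 0 s; first exact: H.
  have [sg0|sg0] := ltP 0 sigma.
    have := H 0 (lexx 0) sg0; apply: filterS => w Hw N.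
    have [n Nn Hn] := Hw N; exists n => //; apply: (le_trans _ Hn).
    by rewrite ler_wpM2r ?sqrtr_ge0// ltW.
  have sgs : sigma < - s by rewrite (le_lt_trans sg0)// oppr_gt0.
  have := lil_upper_opp sgs; apply: filterS => w [N1 HN1] N.
  exists (maxn N N1); first exact: leq_maxl.
  by have := HN1 _ (leq_maxr N N1); rewrite mulNr opprK.
move=> ss; have sg0 : 0 < sigma by rewrite (le_lt_trans s0).
have s2gt0 : 0 < s2 by rewrite -sqrtr_gt0.
have sg2 : sigma ^+ 2 = s2 by rewrite sqr_sqrtr.
have dss : 0 < sigma - s by rewrite subr_gt0.
(* The gain [s' - s] pays for the value at [r ^ k]. *)
pose s' := (s + sigma) / 2.
have s'0 : 0 < s' by rewrite /s'; lra.
have s's : s' < sigma by rewrite /s'; lra.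
have s'E : s' - s = (sigma - s) / 2 by rewrite /s'; field.
pose rho := s' ^+ 2 / s2.
have rho0 : 0 < rho by rewrite divr_gt0// exprn_gt0.
have rho1 : rho < 1.
  by rewrite ltr_pdivrMr// mul1r -sg2 ltrXn2r ?nnegrE// ltW.
have rhoE : rho * s2 = s' ^+ 2 by rewrite /rho divfK// gt_eqF.
clearbody s' rho.
(* Three losses by a factor [1 - tau] are affordable: in [kap], in the rounding of
   the blocks, and in replacing [r] by [r - 1]. *)
pose tau := (1 - rho) / 3.
have tau0 : 0 < tau by rewrite /tau; lra.
have tau1 : tau < 1 / 3 by rewrite /tau; lra.
have tauE : 1 - 3 * tau = rho by rewrite /tau; lra.
clearbody tau.
pose kap := 1 - tau.
have kap0 : 0 < kap <= 1 by apply/andP; split; rewrite /kap; lra.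
have [cc cc0 Hcc] := block_lower mstep mphi phiC phi0 s2gt0 sum_var_s2 iidX x0.
(* For such [u], [(u + 2) ^+ 2 / 2 + cc] is at most [u ^+ 2 / 2] divided by [1 - tau]. *)
pose u := (8 + 2 * cc) / tau + 1.
have u1 : 1 <= u by rewrite /u lerDr divr_ge0// ?(ltW tau0)//; lra.
have u0 : 0 < u by rewrite (lt_le_trans ltr01).
pose Lam := (u + 2) ^+ 2 / 2 + cc.
have Lam0 : 0 <= Lam by rewrite addr_ge0// divr_ge0// sqr_ge0.
have Lamu : 2 * kap * Lam <= u ^+ 2.
  have H1 : (8 + 2 * cc) <= tau * u.
    by rewrite /u mulrDr mulr1 mulrCA divff ?gt_eqF// mulr1 lerDl ltW.
  have H2 : (8 + 2 * cc) * u <= tau * u * u by rewrite ler_pM2r.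
  have H3 : 2 * Lam <= u ^+ 2 + (8 + 2 * cc) * u.
    have : 4 + 2 * cc <= (4 + 2 * cc) * u by rewrite ler_peMr//; lra.
    by rewrite /Lam sqrrD; lra.
  have /andP[k0 k1] := kap0.
  rewrite mulrC mulrA [Lam * 2]mulrC.
  apply: (le_trans (ler_wpM2r (ltW k0) H3)).
  have : (8 + 2 * cc) * u * kap <= (8 + 2 * cc) * u.
    by rewrite ler_piMr// mulr_ge0 ?(ltW u0)//; lra.
  by rewrite /kap expr2; lra.
have [Q HQ] := Hcc u (ltW u0).
(* The first term makes [r - 1] close to [r]; the second makes [lil_norm (r ^ k)]
   small compared with [lil_norm (r ^ k.+1)]. *)
pose r := (Num.truncn (tau^-1 + (4 * sigma / (sigma - s)) ^+ 2)).+2.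
have r1 : (1 < r)%N by [].
have rR : tau^-1 + (4 * sigma / (sigma - s)) ^+ 2 <= r%:R.
  by rewrite (le_trans (ltW (truncnS_gt _)))// ler_nat /r.
have r0 : 0 < r%:R :> R by rewrite ltr0n.
have rtau : 1 <= r%:R * tau.
  rewrite -ler_pdivrMr// mul1r (le_trans _ rR)// lerDl sqr_ge0//.
have rs : 4 * sigma / (sigma - s) <= Num.sqrt r%:R.
  have z0 : 0 <= 4 * sigma / (sigma - s) by rewrite divr_ge0 ?(ltW dss)// mulr_ge0// ltW.
  rewrite -(ger0_norm z0) -sqrtr_sqr ler_wsqrtr// (le_trans _ rR)//.
  by rewrite lerDr invr_ge0 ltW.
have rpar : s' ^+ 2 * r%:R <= s2 * kap * ((1 - tau) * (r%:R - 1)).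
  have H : rho * r%:R <= kap * ((1 - tau) * (r%:R - 1)).
    have h1 : r%:R * (1 - tau) <= r%:R - 1 by lra.
    have h2 : (1 - tau) * (r%:R * (1 - tau)) <= (1 - tau) * (r%:R - 1).
      by rewrite ler_wpM2l//; lra.
    have h3 : (1 - tau) * ((1 - tau) * (r%:R * (1 - tau))) <= kap * ((1 - tau) * (r%:R - 1)).
      by rewrite ler_wpM2l//; lra.
    apply: (le_trans _ h3).
    rewrite (_ : (1 - tau) * ((1 - tau) * (r%:R * (1 - tau))) = (1 - tau) ^+ 3 * r%:R); last by ring.
    rewrite ler_wpM2r ?(ltW r0)// -tauE.
    have : 0 <= tau ^+ 2 * (3 - tau) by rewrite mulr_ge0 ?sqr_ge0//; lra.
    rewrite (_ : (1 - tau) ^+ 3 = 1 - 3 * tau + tau ^+ 2 * (3 - tau)); [lra|ring].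
  rewrite -rhoE; have := ler_wpM2l s20 H; lra.
clearbody r.
have [k0 Hk0] := block_parameters Q kap0 tau0 u1 Lam0 Lamu r1.
have [k1 Hk1] := @log_log_negligible R r 1 r1 ler01.
pose L k : R := ln (ln (r ^ k.+1)%:R).
have /choice[jq Hjq] : forall k : nat, exists jq : nat * nat,
    (jq.1 * jq.2 <= (r - 1) * r ^ k)%N /\ ((k0 <= k)%N ->
    [/\ (Q <= jq.2)%N,
    2 * kap * L k * ((1 - tau) * ((r - 1) * r ^ k)%:R) <= (jq.1%:R * u) ^+ 2 * jq.2%:R &
    expR (- Lam) * expR (- L k) <= expR (- Lam) ^+ jq.1]).
  move=> k; have [kk|kk] := leqP k0 k; last by exists (0%N, 0%N).
  by have [j [q [h1 h2 h3 h4]]] := Hk0 k kk; exists (j, q).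
pose ell k := ((jq k).1 * (jq k).2)%N.
pose beta k : R := (jq k).1%:R * (u * sigma * Num.sqrt (jq k).2%:R).
pose B k := [set w | beta k <= M (r ^ k + ell k) w - M (r ^ k) w].
have nkS k : (r ^ k <= r ^ k.+1)%N by rewrite expnS leq_pmull// ltnW.
have ellE k : (r ^ k + ell k <= r ^ k.+1)%N.
  have [H _] := Hjq k; rewrite expnS (leq_trans (_ : _ <= r ^ k + (r - 1) * r ^ k)%N) ?leq_add2l//.
  by rewrite -{1}(mul1n (r ^ k)%N) -mulnDl subnKC// ltnW.
have mB k : (<<s cylinder X (r ^ k.+1) >>) (B k).
  rewrite -(subnKC (ellE k)); apply: measurable_pastD.
  exact: (@measurable_increment_ge _ _ _ _ _ _ _ step phi C mstep mphi phiC).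
pose K0 := maxn k0 k1.
have lnr0 : 0 < ln r%:R :> R by rewrite ln_gt0// ltr1n.
pose D := expR (- Lam) / ln r%:R.
have D0 : 0 < D by rewrite divr_gt0// expR_gt0.
have HB k (E : set Omega) : (K0 <= k)%N -> (<<s cylinder X (r ^ k) >>) E ->
    ((D / k.+1%:R)%:E * P E <= P (E `&` B k))%E.
  rewrite geq_max => /andP[kk0 kk1] mE.
  have [_ /(_ kk0)[h1 h2 h3]] := Hjq k.
  have := @blocks_lower _ _ _ _ _ _ _ step phi C mstep mphi phiC P X x0 (expR (- Lam))
    (u * sigma * Num.sqrt (jq k).2%:R) (jq k).2 (expR_ge0 _)
    (fun n E' mE' => HQ (jq k).2 n E' h1 mE') (jq k).1 (r ^ k)%N E mE.
  apply: le_trans; apply: lee_wpmul2r; first exact: measure_ge0.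
  rewrite lee_fin (le_trans _ h3)// /D -mulrA ler_pM2l ?expR_gt0//.
  have [_ _ _] := Hk1 k kk1.
  have lr0 : 0 < k.+1%:R * ln r%:R :> R by rewrite mulr_gt0// ltr0n.
  rewrite /L ln_natX_S// expRN lnK ?posrE// invfM mulrC //.
have Hdiv (A : R) k2 : exists K, A <= \sum_(k2 <= k < K) (D / k.+1%:R) by exact: sum_harmonic_ge.
have ae1 := borel_cantelli_past nkS mB HB Hdiv.
have sg2s : sigma < 2 * sigma by lra.
have ae2 := lil_upper_opp sg2s.
apply: filterS2 ae1 ae2 => w HBw [N1 HN1] N.
have [k kk Bk] := HBw (maxn K0 (maxn N N1)).
move: kk; rewrite !geq_max => /andP[/andP[kk0 kk1] /andP[kN kN1]].
have rk : (k <= r ^ k)%N by rewrite ltnW// ltn_expl.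
pose n := (r ^ k + ell k)%N.
exists n; first by rewrite (leq_trans kN)// (leq_trans rk)// leq_addr.
have [er L0 _] := Hk1 k kk1.
have [_ /(_ kk0)[_ h2 _]] := Hjq k.
pose b' : R := lil_norm (r ^ k.+1)%:R.
have b'0 : 0 <= b' by exact: sqrtr_ge0.
have bn : lil_norm n%:R <= b'.
  apply: lil_norm_le; last by rewrite ler_nat; exact: ellE.
  by rewrite (le_trans er)// ler_nat /n leq_addr.
have M1 : - (2 * sigma * lil_norm (r ^ k)%:R) <= M (r ^ k) w.
  by apply: HN1; exact: leq_trans kN1 rk.
have b2 : lil_norm (r ^ k)%:R * Num.sqrt r%:R <= b'.
  rewrite /b' /lil_norm -sqrtrM; last first.
    rewrite mulr_ge0 ?mulr_ge0// ln_ln_ge0//.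
  apply: ler_wsqrtr.
  have l1 : ln (ln (r ^ k)%:R) <= ln (ln (r ^ k.+1)%:R) :> R.
    have rk0 : 0 < (r ^ k)%:R :> R by rewrite (lt_le_trans (expR_gt0 1)).
    have lrk : 1 <= ln (r ^ k)%:R :> R by rewrite -[leLHS](@expRK R) ler_ln// posrE expR_gt0.
    have ll : ln (r ^ k)%:R <= ln (r ^ k.+1)%:R :> R.
      by rewrite ler_ln ?posrE ?ler_nat// (lt_le_trans rk0)// ler_nat.
    by rewrite ler_ln ?posrE// (lt_le_trans ltr01)// (le_trans lrk).
  have := ler_wpM2l (_ : 0 <= 2 * (r ^ k)%:R * r%:R) l1.
  rewrite (_ : (r ^ k.+1)%:R = r%:R * (r ^ k)%:R); last by rewrite expnS natrM.
  have h0 : 0 <= 2 * (r ^ k)%:R * r%:R :> R by rewrite !mulr_ge0.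
  by move=> /(_ h0); lra.
have b3 : 2 * sigma * lil_norm (r ^ k)%:R <= (s' - s) * b'.
  have q0 : 0 < Num.sqrt r%:R :> R by rewrite sqrtr_gt0.
  rewrite -(ler_pM2r q0) -[2 * sigma * _ * _]mulrA.
  apply: (le_trans (ler_wpM2l _ b2)); first by rewrite mulr_ge0// ltW.
  rewrite s'E [leRHS]mulrAC ler_wpM2r//.
  by move: rs; rewrite ler_pdivrMr//; lra.
have b4 : s' * b' <= beta k.
  have bb0 : 0 <= beta k by rewrite /beta !mulr_ge0 ?sqrtr_ge0// ltW.
  rewrite -(@ler_pXn2r _ 2) ?nnegrE ?bb0 ?(mulr_ge0 (ltW s'0) b'0)//.
  rewrite exprMn /b' /lil_norm sqr_sqrtr; last by rewrite !mulr_ge0.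
  have -> : beta k ^+ 2 = s2 * ((jq k).1%:R * u) ^+ 2 * (jq k).2%:R.
    rewrite /beta !exprMn !sqr_sqrtr//; ring.
  have h4 := ler_wpM2l s20 h2.
  rewrite -[s2 * _ * _]mulrA; apply: (le_trans _ h4).
  rewrite -/(L k) natrM natrB ?(ltnW r1)// expnS natrM.
  have h5 : 0 <= 2 * (r ^ k)%:R * L k by rewrite !mulr_ge0.
  have := ler_wpM2r h5 rpar; lra.
have := Bk; rewrite /B/= -/n => Bk'.
have h6 : s * lil_norm n%:R <= s * b' by exact: ler_wpM2l.
lra.
Qed.

End lil_lower.

(** * Convolution powers and equidistribution on the group *)

Section topological_group.
Context {R : realType} {G : topologicalGroupType}.

Lemma continuous_measurable_borel (u : G -> R) :
  continuous u -> measurable_fun setT (u : borel G -> R).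
Proof.
move=> cu; apply: (measurability _ (RGenOInfty.measurableE R)).
move=> _ [_ [a ->] <-]; rewrite setTI; apply: sub_sigma_algebra.
by apply: open_comp => // x _; exact: cu.
Qed.

Lemma continuous_bounded_mfun (u : G -> R) :
  compact [set: G] -> continuous u -> bounded_mfun (u : borel G -> R).
Proof.
move=> cG cu; split; first exact: continuous_measurable_borel.
have /compact_bounded[B [_ HB]] : compact (u @` setT).
  by apply: continuous_compact => //; exact: continuous_subspaceT.
exists (B + 1) => x; apply: HB; first by rewrite ltrDl.
by exists x.
Qed.

Lemma measurable_invg_borel :
  measurable_fun setT (fun x : borel G => (x^-1)%g : borel G).
Proof.
apply: (measurability (@open (borel G))) => // _ [U oU <-].
rewrite setTI; apply: sub_sigma_algebra.
by apply: open_comp => // x _; exact: invg_continuous.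
Qed.

Lemma measurable_mulg_left (a : G) :
  measurable_fun setT (fun x : borel G => (a * x)%g : borel G).
Proof.
apply: (measurability (@open (borel G))) => // _ [U oU <-].
rewrite setTI; apply: sub_sigma_algebra.
apply: open_comp => // x _.
apply: (@continuous_comp _ _ _ (fun x : G => (a, x)) (fun z : G * G => (z.1 * z.2)%g)).
  by apply: cvg_pair => //=; exact: cvg_cst.
exact: mulg_continuous.
Qed.

End topological_group.

Section haar.
Context {R : realType} {G : topologicalGroupType}.
Variables (mu : probability (borel G) R) (mu_haar : normalized_haar mu).

Lemma expect_haar_mulg (a : G) (u : borel G -> R) : bounded_mfun u ->
  \int[mu]_y u (a * y)%g = \int[mu]_y u y.
Proof.
move=> bu.
pose L : {mfun borel G >-> borel G} := mfun_Sub (mem_set (measurable_mulg_left a)).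
rewrite -(@expect_distribution _ _ _ _ _ mu L _ bu).
rewrite /Rintegral; congr fine; apply: eq_measure_integral => A mA _.
have := measurable_mulg_left a measurableT mA; rewrite setTI => mLA.
apply: (etrans (esym (mu_haar a mLA))).
congr (mu _); apply/seteqP; split => [_ [x Ax <-]//|x Ax].
exists (a^-1 * x)%g; last by rewrite mulgA mulgV mul1g.
by rewrite /preimage/= mulgA mulgV mul1g.
Qed.

End haar.

Section coupling.
Context {R : realType} {G : topologicalGroupType}.
Variables (nu1 nu2 : probability (borel G) R)
  (theta : probability (borel G * borel G)%type R).
Hypothesis ctheta : coupling nu1 nu2 theta.

Lemma expect_coupling_fst (u : borel G -> R) : bounded_mfun u ->
  \int[theta]_z u z.1 = \int[nu1]_x u x.
Proof.
move=> bu.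
pose F : {mfun (borel G * borel G)%type >-> borel G} :=
  mfun_Sub (mem_set (@measurable_fst _ _ _ _)).
rewrite -(@expect_distribution _ _ _ _ _ theta F _ bu).
rewrite /Rintegral; congr fine; apply: eq_measure_integral => A mA _.
apply: (etrans _ (ctheta mA).1); congr (theta _).
by apply/seteqP; split => [[x y]|[x y] []].
Qed.

Lemma expect_coupling_snd (u : borel G -> R) : bounded_mfun u ->
  \int[theta]_z u z.2 = \int[nu2]_x u x.
Proof.
move=> bu.
pose F : {mfun (borel G * borel G)%type >-> borel G} :=
  mfun_Sub (mem_set (@measurable_snd _ _ _ _)).
rewrite -(@expect_distribution _ _ _ _ _ theta F _ bu).
rewrite /Rintegral; congr fine; apply: eq_measure_integral => A mA _.
apply: (etrans _ (ctheta mA).2); congr (theta _).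
by apply/seteqP; split => [[x y]|[x y] []].
Qed.

End coupling.

Section almost_holder.
Context {R : realType} {G : topologicalGroupType}.
Hypothesis G_compact : compact [set: G].
Variables (d : G -> G -> R) (p : R).
Hypothesis dmetrizes : metrizes d.
Hypothesis p0 : 0 < p.

(** Uniform continuity measured by [d x y `^ p]. The Hoelder condition itself is
    lost in the infinite sum defining the potential, whereas this class is closed
    under uniform limits and still gives Wasserstein estimates, up to an arbitrary
    [e]. *)
Definition almost_holder (u : G -> R) : Prop :=
  forall e : R, 0 < e -> exists2 K : R, 0 < K &
    forall x y, `|u x - u y| <= e + K * d x y `^ p.

Implicit Types u v : G -> R.

Lemma holder_almost_holder u : holder d p u -> almost_holder u.
Proof.
move=> [K K0 uK] e e0; exists (K + 1); first by rewrite ltr_wpDl.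
move=> x y; rewrite (le_trans (uK x y))// -[leLHS]add0r lerD ?(ltW e0)//.
by rewrite ler_wpM2r ?powR_ge0// lerDl.
Qed.

Lemma almost_holder_continuous u : (forall x y, 0 <= d x y) ->
  almost_holder u -> continuous u.
Proof.
move=> d0 hu x; apply/cvgrPdist_lt => e e0.
have e20 : 0 < e / 2 by rewrite divr_gt0.
have [K K0 uK] := hu _ e20.
pose r := (e / (2 * K)) `^ (p^-1).
have eK0 : 0 < e / (2 * K) by rewrite divr_gt0// mulr_gt0.
have r0 : 0 < r by rewrite powR_gt0.
have rp : r `^ p = e / (2 * K).
  by rewrite /r -powRrM mulVf ?gt_eqF// powRr1// ltW.
apply/(dmetrizes x); exists r => // y /= dr.
apply: (le_lt_trans (uK x y)).
have : d x y `^ p < r `^ p by rewrite gt0_ltr_powR// nnegrE ?d0 ?ltW.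
rewrite rp -(ltr_pM2l K0) => H.
have Ke : K * (e / (2 * K)) = e / 2 by field; rewrite gt_eqF.
by rewrite Ke in H; lra.
Qed.

Lemma almost_holderB u v : almost_holder u -> almost_holder v ->
  almost_holder (fun x => u x - v x).
Proof.
move=> hu hv e e0; have e20 : 0 < e / 2 by rewrite divr_gt0.
have [A A0 uA] := hu _ e20; have [B B0 vB] := hv _ e20.
exists (A + B) => [|x y]; first exact: addr_gt0.
have -> : u x - v x - (u y - v y) = (u x - u y) - (v x - v y) by ring.
apply: (le_trans (ler_normB _ _)).
by have := uA x y; have := vB x y; lra.
Qed.

Lemma almost_holderD u v : almost_holder u -> almost_holder v ->
  almost_holder (fun x => u x + v x).
Proof.
move=> hu hv e e0; have e20 : 0 < e / 2 by rewrite divr_gt0.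
have [A A0 uA] := hu _ e20; have [B B0 vB] := hv _ e20.
exists (A + B) => [|x y]; first exact: addr_gt0.
have -> : u x + v x - (u y + v y) = (u x - u y) + (v x - v y) by ring.
apply: (le_trans (ler_normD _ _)).
by have := uA x y; have := vB x y; lra.
Qed.

Lemma almost_holder_sqr u (B : R) : (forall x, `|u x| <= B) -> almost_holder u ->
  almost_holder (fun x => u x ^+ 2).
Proof.
move=> uB hu e e0.
have B0 : 0 <= B by rewrite (le_trans _ (uB 1%g)).
have c0 : 0 < 2 * B + 1 by rewrite ltr_wpDl// mulr_ge0.
have e20 : 0 < e / (2 * B + 1) by rewrite divr_gt0.
have [A A0 uA] := hu _ e20.
exists ((2 * B + 1) * A) => [|x y]; first exact: mulr_gt0.
rewrite (_ : u x ^+ 2 - u y ^+ 2 = (u x + u y) * (u x - u y)); last by ring.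
rewrite normrM.
apply: (@le_trans _ _ ((2 * B + 1) * (e / (2 * B + 1) + A * d x y `^ p))).
  rewrite ler_pM//; have := ler_normD (u x) (u y).
  by have := uB x; have := uB y; lra.
by rewrite mulrDr mulrCA divff ?gt_eqF// mulr1 mulrA.
Qed.

Lemma almost_holder_uniform_limit u :
  (forall e : R, 0 < e -> exists2 v, almost_holder v & forall x, `|u x - v x| <= e) ->
  almost_holder u.
Proof.
move=> H e e0; have e30 : 0 < e / 3 by rewrite divr_gt0.
have [v hv uv] := H _ e30; have [K K0 vK] := hv _ e30.
exists K => // x y.
have -> : u x - u y = (u x - v x) + (v x - v y) - (u y - v y) by ring.
apply: (le_trans (ler_normB _ _)); have := ler_normD (u x - v x) (v x - v y).
by have := vK x y; have := uv x; have := uv y; lra.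
Qed.

Lemma almost_holder_bounded_mfun u : (forall x y, 0 <= d x y) ->
  almost_holder u -> bounded_mfun (u : borel G -> R).
Proof.
by move=> d0 hu; apply: continuous_bounded_mfun => //; exact: almost_holder_continuous.
Qed.

End almost_holder.

Section convolution_operator.
Context {R : realType} {G : topologicalGroupType} (hG : @second_countable G).
Variable nu : probability (borel G) R.

Definition mul_step (z : borel G * borel G) : borel G := (z.1 * z.2)%g.

Lemma measurable_mul_step : measurable_fun setT mul_step.
Proof. exact: measurable_mulg. Qed.

Local Notation U := (markov nu mul_step).

(** Iterating the averaging operator on the right of [x] amounts to averaging once
    against the law of the product of the increments. *)
Lemma iter_markov_convolution k (u : borel G -> R) x : bounded_mfun u ->
  iter k U u x = \int[convolution_pow hG nu k]_y u (x * y)%g.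
Proof.
elim: k u x => [|k IH] u x bu.
  rewrite /= /Rintegral integral_dirac//=; last first.
    apply/measurable_EFinP.
    exact: (bounded_mfun_comp (measurable_mulg_left x) bu).1.
  by rewrite indicT mul1r mulg1.
rewrite iterSr IH; last exact: (bounded_mfun_markov nu measurable_mul_step bu).
have bux := bounded_mfun_comp (measurable_mulg_left x) bu.
rewrite /= (@expect_distribution _ _ _ _ _ _ _ _ bux)/=.
have bH : bounded_mfun (fun z : borel G * borel G => u (x * (z.1 * z.2))%g).
  exact: (bounded_mfun_comp measurable_mul_step bux).
rewrite (expect_prod nu _ bH); apply: eq_Rintegral => y _.
by rewrite /markov/mul_step; apply: eq_Rintegral => z _ /=; rewrite mulgA.
Qed.

End convolution_operator.

Section equidistribution.
Context {R : realType} {G : topologicalGroupType} (hG : @second_countable G).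
Hypothesis G_compact : compact [set: G].
Variables (mu nu : probability (borel G) R) (mu_haar : normalized_haar mu).
Variables (d : G -> G -> R) (p : R).
Hypothesis dmetric : is_metric d.
Hypothesis dinv : bi_invariant d.
Hypothesis dmetrizes : metrizes d.
Hypothesis p0 : 0 < p.
Local Notation U := (markov nu mul_step).
Local Notation W k := (wasserstein d p (convolution_pow hG nu k) mu).

Let bounded_mfunAH u := almost_holder_bounded_mfun G_compact dmetrizes p0 (u := u) (metric_ge0 dmetric).

(** By invariance [d z.1 z.2] is the distance of [z.1 * z.2^-1] to the unit, a
    continuous function of one group element: this makes the transport cost
    measurable for the product sigma-algebra. *)
Lemma bounded_mfun_distX :
  bounded_mfun (fun z : borel G * borel G => d z.1 z.2 `^ p).
Proof.
pose delta (x : G) := d x 1%g.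
have dl x : 0 <= delta x by exact: (metric_ge0 dmetric).
have cdelta : continuous delta.
  apply: (almost_holder_continuous dmetrizes ltr01 (metric_ge0 dmetric)).
  apply: holder_almost_holder; exists 1 => // x y.
  rewrite mul1r powRr1 ?(metric_ge0 dmetric)// ler_distlC /delta.
  have := metric_triangular dmetric x y 1%g; have := metric_triangular dmetric y x 1%g.
  by rewrite (metric_symmetric dmetric y x) => h1 h2; apply/andP; split; lra.
have [mdl [B HB]] := continuous_bounded_mfun G_compact cdelta.
have bX : bounded_mfun (fun x : borel G => delta x `^ p).
  split; first by apply: (measurableT_comp (measurable_powR p) mdl).
  exists (B `^ p) => x; rewrite ger0_norm ?powR_ge0// ge0_ler_powR ?nnegrE ?(ltW p0)//.
    by rewrite (le_trans _ (HB x)).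
  by rewrite (le_trans (ler_norm _)).
rewrite (_ : (fun z => _) = (fun z : borel G * borel G => delta (z.1 * z.2^-1)%g `^ p)).
  have mdiv : measurable_fun setT
      (fun z : borel G * borel G => (z.1, z.2^-1)%g : borel G * borel G).
    apply: measurable_fun_pair; first exact: measurable_fst.
    exact: (measurableT_comp measurable_invg_borel measurable_snd).
  exact: (bounded_mfun_comp mdiv (bounded_mfun_comp (measurable_mulg hG) bX)).
apply/funext => z; rewrite /delta.
by rewrite -(mulgV z.2) (dinv _ _ _).2.
Qed.

Section modulus.
Variables (u : G -> R) (e K : R).
Hypothesis bu : bounded_mfun (u : borel G -> R).
Hypothesis K0 : 0 < K.
Hypothesis uK : forall x y, `|u x - u y| <= e + K * d x y `^ p.

(** Left invariance is used twice: that of [mu] puts the same translate by [x] on both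
    sides, and that of [d] makes the resulting bound independent of [x]. *)
Lemma coupling_estimate m theta x : coupling m mu theta ->
  `|\int[m]_y u (x * y)%g - \int[mu]_y u y| <= e + K * \int[theta]_z (d z.1 z.2 `^ p).
Proof.
move=> cth.
have bux := bounded_mfun_comp (measurable_mulg_left x) bu.
rewrite -(expect_haar_mulg mu_haar x bu).
rewrite -(expect_coupling_fst cth bux) -(expect_coupling_snd cth bux).
have b1 : bounded_mfun (fun z : borel G * borel G => u (x * z.1)%g).
  exact: (bounded_mfun_comp measurable_fst bux).
have b2 : bounded_mfun (fun z : borel G * borel G => u (x * z.2)%g).
  exact: (bounded_mfun_comp measurable_snd bux).
have b3 := bounded_mfunB b1 b2.
have b4 := bounded_mfunD (bounded_mfun_cst e) (bounded_mfunZ K bounded_mfun_distX).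
rewrite -(expectB theta b1 b2) -(expectZ theta K bounded_mfun_distX).
rewrite -{1}(expect_cst theta e).
rewrite -(expectD theta (bounded_mfun_cst e) (bounded_mfunZ K bounded_mfun_distX)).
have H z : `|u (x * z.1)%g - u (x * z.2)%g| <= e + K * d z.1 z.2 `^ p.
  by rewrite -(dinv z.1 z.2 x).1.
rewrite ler_norml; apply/andP; split.
  rewrite -mulN1r -(expectZ theta _ b4).
  apply: (expect_le theta (bounded_mfunZ _ b4) b3) => z.
  by have := H z; rewrite ler_norml => /andP[]; lra.
apply: (expect_le theta b3 b4) => z.
by have := H z; rewrite ler_norml => /andP[].
Qed.

Lemma wasserstein_estimate m x : wasserstein d p m mu \is a fin_num ->
  `|\int[m]_y u (x * y)%g - \int[mu]_y u y| <= e + K * fine (wasserstein d p m mu).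
Proof.
move=> fW; rewrite -lerBlDl -ler_pdivrMl// -lee_fin fineK//.
apply: le_ereal_inf_tmp => _ [theta cth <-].
rewrite -(EFin_expect theta bounded_mfun_distX) lee_fin ler_pdivrMl// lerBlDl.
exact: coupling_estimate.
Qed.

Lemma markov_rate k x : W k \is a fin_num ->
  `|iter k U u x - \int[mu]_y u y| <= e + K * fine (W k).
Proof. by move=> fW; rewrite (iter_markov_convolution hG)//; exact: wasserstein_estimate. Qed.

End modulus.

(** Here it is the right invariance of [d] that matters. *)
Lemma almost_holder_markov u : almost_holder d p u -> almost_holder d p (U u).
Proof.
move=> hu e e0; have [K K0 uK] := hu e e0; exists K => // x y.
have b z : bounded_mfun (fun a : borel G => u (z * a)%g).
  exact: (bounded_mfun_comp (measurable_mulg_left z) (bounded_mfunAH hu)).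
apply: (expect_dist_le nu (b x) (b y)) => z.
by rewrite -(dinv x y z).2.
Qed.

Lemma almost_holder_iter_markov k u : almost_holder d p u -> almost_holder d p (iter k U u).
Proof. by move=> hu; elim: k => //= k; exact: almost_holder_markov. Qed.

End equidistribution.

(** * The Poisson equation and the limiting variance *)

Lemma series_uniform_tail {R : realType} {T : Type} (a : R^nat) (v : nat -> T -> R) :
  (forall k x, `|v k x| <= a k) -> cvgn (series a) ->
  forall n x, `|limn (series (v^~ x)) - series (v^~ x) n| <= limn (series a) - series a n.
Proof.
move=> va ca n x.
have cv : cvgn (series (v^~ x)).
  apply: normed_cvg; apply: (series_le_cvg _ _ _ ca) => k //=.
  by rewrite (le_trans _ (va k x)).
apply/ler_addgt0Pr => e e0; have e20 : 0 < e / 2 by rewrite divr_gt0.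
move/cvgrPdist_lt : cv => /(_ _ e20) [m1 _ H1].
move/cvgrPdist_lt : ca => /(_ _ e20) [m2 _ H2].
pose m := maxn n (maxn m1 m2).
have {}H1 := H1 m (leq_trans (leq_maxl _ _) (leq_maxr _ _)).
have {}H2 := H2 m (leq_trans (leq_maxr _ _) (leq_maxr _ _)).
have nm : (n <= m)%N by exact: leq_maxl.
have H3 : `|series (v^~ x) m - series (v^~ x) n| <= series a m - series a n.
  rewrite !sub_series_geq// (le_trans (ler_norm_sum _ _ _))//.
  by apply: ler_sum.
move: H1 H2 H3 => /=; rewrite !ltr_norml !ler_norml.
by move=> /andP[? ?] /andP[? ?] /andP[? ?]; apply/andP; split; lra.
Qed.

Section potential.
Context {R : realType} {G : topologicalGroupType} (hG : @second_countable G).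
Hypothesis G_compact : compact [set: G].
Variables (mu nu : probability (borel G) R) (mu_haar : normalized_haar mu).
Variables (d : G -> G -> R) (p : R).
Hypothesis dmetric : is_metric d.
Hypothesis dinv : bi_invariant d.
Hypothesis dmetrizes : metrizes d.
Hypothesis p0 : 0 < p.
Local Notation U := (markov nu mul_step).
Local Notation W k := (wasserstein d p (convolution_pow hG nu k) mu).
Hypothesis W_summable : (\sum_(1 <= k <oo) W k < +oo)%E.

Let bounded_mfunAH u := almost_holder_bounded_mfun G_compact dmetrizes p0 (u := u) (metric_ge0 dmetric).

Lemma wasserstein_ge0 m : (0 <= wasserstein d p m mu)%E.
Proof.
by apply: le_ereal_inf_tmp => _ [theta _ <-]; apply: integral_ge0 => z _; rewrite lee_fin powR_ge0.
Qed.

Lemma wasserstein_fin_num k : (0 < k)%N -> W k \is a fin_num.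
Proof.
move=> k0; rewrite ge0_fin_numE ?wasserstein_ge0//.
apply: (le_lt_trans _ W_summable).
apply: (le_trans _ (nneseries_lim_ge k.+1 (fun n _ _ => wasserstein_ge0 _))).
by rewrite big_nat_recr//= leeDr// sume_ge0// => n _; exact: wasserstein_ge0.
Qed.

Lemma cvg_series_wasserstein (a : R^nat) (K : R) : 0 <= K ->
  (forall k, (0 < k)%N -> a k = K * fine (W k)) -> cvgn (series a).
Proof.
move=> K0 aW; rewrite -(is_cvg_series_restrict 1).
have a0 k : (0 < k)%N -> 0 <= a k.
  by move=> k0; rewrite aW// mulr_ge0// fine_ge0// wasserstein_ge0.
apply: nondecreasing_is_cvgn.
  apply/nondecreasing_seqP => n /=; case: n => [|n]; first by rewrite !big_geq.
  by rewrite [leRHS]big_nat_recr//= lerDl a0.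
exists (K * fine (\sum_(1 <= k <oo) W k)%E) => _ [n _ <-] /=.
rewrite (eq_big_nat _ _ (F2 := fun k => K * fine (W k))); last first.
  by move=> k /andP[k1 _]; exact: aW.
rewrite -mulr_sumr ler_wpM2l// -lee_fin fineK; last first.
  by rewrite ge0_fin_numE// nneseries_ge0// => k _ _; exact: wasserstein_ge0.
rewrite -sumEFin big_nat (eq_bigr (fun k => W k)) -?big_nat; last first.
  by move=> k /andP[k1 _]; rewrite fineK// wasserstein_fin_num.
by apply: nneseries_lim_ge => k _ _; exact: wasserstein_ge0.
Qed.

(** Choose the modulus of continuity of [u] first, then [m] so large that the
    Wasserstein distance of the [m]-th convolution power to [mu] is negligible. *)
Lemma markov_equidistribution u : almost_holder d p u -> forall e : R, 0 < e ->
  exists m0, forall m x, (m0 <= m)%N -> `|iter m U u x - \int[mu]_y u y| <= e.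
Proof.
move=> hu e e0; have e20 : 0 < e / 2 by rewrite divr_gt0.
have [K K0 uK] := hu _ e20.
have /cvg_series_cvg_0/cvgrPdist_lt/(_ _ e20)[m1 _ Hm1] :
  cvgn (series (fun k => K * fine (W k))) by exact: (cvg_series_wasserstein (ltW K0)).
exists (maxn 1 m1) => m x; rewrite geq_max => /andP[m0 m1m].
apply: (le_trans (markov_rate G_compact mu_haar dmetric dinv dmetrizes p0
  (bounded_mfunAH hu) K0 uK x (wasserstein_fin_num m0))).
have /= := Hm1 m m1m; rewrite sub0r normrN => /ltW H.
by have := le_trans (ler_norm _) H; lra.
Qed.

(** The solution of the Poisson equation [g - U g = f], as the Neumann series of [U].
    It is determined by [f] and [nu] alone. *)
Definition potential (f : G -> R) (x : G) : R :=
  limn (series (fun k => iter k U f x)).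

Section poisson.
Variable f : G -> R.
Hypothesis hf : holder d p f.
Hypothesis f0 : \int[mu]_x f x = 0.
Let ahf := holder_almost_holder hf.
Let bf := bounded_mfunAH ahf.

(** The Wasserstein distances are summable and [f] has mean zero, so the series
    converges uniformly. *)
Lemma potential_approx (e : R) : 0 < e -> exists n0, forall n x, (n0 <= n)%N ->
  `|potential f x - series (fun k => iter k U f x) n| <= e.
Proof.
move=> e0; have [K K0 fK] := hf; have [_ [B HB]] := bf.
have K10 : 0 < K + 1 by rewrite ltr_wpDl.
pose a k := if k is 0%N then B else (K + 1) * fine (W k).
have ca : cvgn (series a) by apply: (cvg_series_wasserstein (ltW K10)) => -[].
have fa k x : `|iter k U f x| <= a k.
  case: k => [|k]; first exact: HB.
  have fK' y z : `|f y - f z| <= 0 + (K + 1) * d y z `^ p.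
    by rewrite add0r (le_trans (fK y z))// ler_wpM2r ?powR_ge0// lerDl.
  have := markov_rate G_compact mu_haar dmetric dinv dmetrizes p0
    bf K10 fK' x (wasserstein_fin_num (ltn0Sn k)).
  by rewrite f0 subr0 add0r.
have [n0 _ H] := (cvgrPdist_lt _ _).1 ca _ e0.
exists n0 => n x n0n.
have := series_uniform_tail (v := fun k x => iter k U f x) fa ca n x.
move=> /le_trans; apply; apply: le_trans (ler_norm _) _; exact/ltW/H.
Qed.

Lemma almost_holder_series n : almost_holder d p (fun x => series (fun k => iter k U f x) n).
Proof.
elim: n => [|n IH].
  rewrite (_ : (fun x => _) = fun=> 0); last by apply/funext => x; rewrite /series/= big_geq.
  move=> e e0; exists 1 => // x y; rewrite subrr normr0 addr_ge0 ?(ltW e0)//.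
  by rewrite mul1r powR_ge0.
rewrite (_ : (fun x => _) = (fun x => series (fun k => iter k U f x) n + iter n U f x)); last first.
  by apply/funext => x; rewrite /series/= big_nat_recr.
by apply: almost_holderD => //; exact: almost_holder_iter_markov.
Qed.

Lemma almost_holder_potential : almost_holder d p (potential f).
Proof.
apply: almost_holder_uniform_limit => e e0.
have [n H] := potential_approx e0.
by exists (fun x => series (fun k => iter k U f x) n); [exact: almost_holder_series|move=> x; exact: H].
Qed.

(** Applying [U] to a partial sum shifts it by one term. *)
Lemma poisson_equation x : potential f x - U (potential f) x = f x.
Proof.
apply/eqP; rewrite -subr_eq0 -normr_le0; apply/ler_addgt0Pr => e e0; rewrite add0r.
have e20 : 0 < e / 2 by rewrite divr_gt0.
have [n H] := potential_approx e20.
have ah := almost_holder_series n.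
have b u : almost_holder d p u -> bounded_mfun (fun y : borel G => u (mul_step (x, y))).
  move=> hu; exact: (bounded_mfun_comp (measurable_mulg_left x) (bounded_mfunAH hu)).
have UE : U (fun x => series (fun k => iter k U f x) n) x = series (fun k => iter k U f x) n.+1 - f x.
  rewrite /series/= big_nat_recl//= addrC addKr /markov.
  have [_ ->] := expect_sum nu (index_iota 0 n) (fun i =>
    b _ (almost_holder_iter_markov G_compact nu dmetric dinv dmetrizes p0 i ahf)).
  by [].
have H1 : `|U (potential f) x - U (fun x => series (fun k => iter k U f x) n) x| <= e / 2.
  by apply: (expect_dist_le nu (b _ almost_holder_potential) (b _ ah)) => y; exact: H.
have H2 := H n.+1 x (leqnSn n).
rewrite UE in H1.
move: H1 H2; rewrite !ler_norml => /andP[? ?] /andP[? ?].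
by apply/andP; split; lra.
Qed.

End poisson.

End potential.

Section markov_sums.
Context {R : realType} {d d'} {T : measurableType d} {T' : measurableType d'}.
Variables (nu : probability T' R) (step : T * T' -> T) (phi : T * T' -> R).
Hypothesis mstep : measurable_fun setT step.
Hypothesis bphi : bounded_mfun phi.
Local Notation U := (markov nu step).
Local Notation h := (cond_var nu phi).

Lemma bounded_mfun_iter_markov k u : bounded_mfun u -> bounded_mfun (iter k U u).
Proof. by move=> bu; elim: k => //= k; exact: bounded_mfun_markov. Qed.

Lemma iter_markov_bound k (u : T -> R) (B : R) : bounded_mfun u ->
  (forall x, `|u x| <= B) -> forall x, `|iter k U u x| <= B.
Proof.
move=> bu uB; elim: k => //= k IH x; apply: expect_norm_le => //.
exact: (bounded_mfun_section x (H := fun z => iter k U u (step z))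
  (bounded_mfun_comp mstep (bounded_mfun_iter_markov k bu))).
Qed.

Lemma sum_varE m x : sum_var nu step phi m x = \sum_(0 <= k < m) iter k U h x.
Proof.
have [C phiC] := bphi.2.
have bh := bounded_mfun_cond_var nu bphi.1 phiC.
elim: m x => [|m IH] x; first by rewrite big_geq.
rewrite big_nat_recl//=; congr (_ + _); rewrite /markov.
under eq_Rintegral do rewrite IH.
have b i : bounded_mfun (fun y => iter i U h (step (x, y))).
  exact: (bounded_mfun_section x (H := fun z => iter i U h (step z))
    (bounded_mfun_comp mstep (bounded_mfun_iter_markov i bh))).
by have [_ ->] := expect_sum nu (index_iota 0 m) b.
Qed.

(** A Cesaro mean: all but the first [m0] terms are close to [s2], and the first ones
    are bounded. *)
Lemma sum_var_average (s2 : R) :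
  (forall e : R, 0 < e -> exists m0, forall m x, (m0 <= m)%N -> `|iter m U h x - s2| <= e) ->
  forall e : R, 0 < e -> exists2 m, (0 < m)%N &
  forall x, `|sum_var nu step phi m x - m%:R * s2| <= e * m%:R.
Proof.
move=> H e e0; have e20 : 0 < e / 2 by rewrite divr_gt0.
have [C phiC] := bphi.2.
have bh := bounded_mfun_cond_var nu bphi.1 phiC.
have [_ [B hB]] := bh; have [m0 Hm0] := H _ e20.
pose D := B + `|s2|.
have D0 : 0 <= D by rewrite addr_ge0// (le_trans _ (hB point)).
have HD k x : `|iter k U h x - s2| <= D.
  by rewrite (le_trans (ler_normB _ _))// lerD2r; exact: iter_markov_bound.
pose n := (Num.truncn (D * m0%:R / (e / 2))).+1.
have nD : D * m0%:R <= e / 2 * n%:R.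
  by rewrite -ler_pdivrMl// [leLHS]mulrC; exact: ltW (truncnS_gt _).
exists (m0 + n)%N => [|x]; first by rewrite addnS.
rewrite sum_varE (_ : _ - _ = \sum_(0 <= k < m0 + n) (iter k U h x - s2)); last first.
  by rewrite sumrB sumr_const_nat subn0 mulr_natl.
rewrite (le_trans (ler_norm_sum _ _ _))// (big_cat_nat (leq0n m0) (leq_addr n m0))/=.
have h1 : \sum_(0 <= k < m0) `|iter k U h x - s2| <= D * m0%:R.
  rewrite -[in leRHS](subn0 m0) mulr_natr -sumr_const_nat.
  by apply: ler_sum => k _; exact: HD.
have h2 : \sum_(m0 <= k < m0 + n) `|iter k U h x - s2| <= e / 2 * n%:R.
  rewrite -[in leRHS](addKn m0 n) mulr_natr -sumr_const_nat.
  by apply: ler_sum_nat => k /andP[kk _]; exact: Hm0.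
rewrite natrD mulrDr; have : 0 <= e * m0%:R by rewrite mulr_ge0// ltW.
by lra.
Qed.

End markov_sums.

Section variance.
Context {R : realType} {G : topologicalGroupType} (hG : @second_countable G).
Variables (mu nu : probability (borel G) R).
Local Notation U := (markov nu mul_step).

(** The increment of the martingale when the walk at [z.1] is multiplied by [z.2]. *)
Definition increment (f : G -> R) (z : borel G * borel G) : R :=
  potential nu f (mul_step z) - U (potential nu f) z.1.

Definition limit_variance (f : G -> R) : R :=
  \int[mu]_x cond_var nu (increment f) x.

Hypothesis G_compact : compact [set: G].
Hypothesis mu_haar : normalized_haar mu.
Variables (d : G -> G -> R) (p : R).
Hypothesis dmetric : is_metric d.
Hypothesis dinv : bi_invariant d.
Hypothesis dmetrizes : metrizes d.
Hypothesis p0 : 0 < p.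
Hypothesis W_summable :
  (\sum_(1 <= k <oo) wasserstein d p (convolution_pow hG nu k) mu < +oo)%E.
Variable f : G -> R.
Hypothesis hf : holder d p f.
Hypothesis f0 : \int[mu]_x f x = 0.
Local Notation g := (potential nu f).

Let ahg : almost_holder d p g.
Proof. exact: (almost_holder_potential G_compact mu_haar dmetric dinv dmetrizes p0 W_summable hf f0). Qed.

Let bounded_mfunAH u := almost_holder_bounded_mfun G_compact dmetrizes p0 (u := u) (metric_ge0 dmetric).

Let mstep := @measurable_mul_step G hG.

Lemma bounded_mfun_potential : bounded_mfun (g : borel G -> R).
Proof. exact: bounded_mfunAH. Qed.

Lemma bounded_mfun_markov_potential : bounded_mfun (U g : borel G -> R).
Proof. exact: (bounded_mfun_markov nu mstep bounded_mfun_potential). Qed.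

Lemma bounded_mfun_increment : bounded_mfun (increment f).
Proof.
apply: bounded_mfunB; first exact: (bounded_mfun_comp mstep bounded_mfun_potential).
exact: (bounded_mfun_comp measurable_fst bounded_mfun_markov_potential).
Qed.

Let bgx x : bounded_mfun (fun y : borel G => g (mul_step (x, y))).
Proof. exact: (bounded_mfun_comp (measurable_mulg_left x) bounded_mfun_potential). Qed.

Lemma increment_centered x : \int[nu]_y increment f (x, y) = 0.
Proof.
rewrite (expectB nu (bgx x) (bounded_mfun_cst (U g x))).
by rewrite expect_cst subrr.
Qed.

(** The variance of [g] under the law of one step from [x]. *)
Lemma cond_var_increment x : cond_var nu (increment f) x = U (fun y => g y ^+ 2) x - U g x ^+ 2.
Proof.
rewrite /cond_var; set c := U g x.
have -> : \int[nu]_y (increment f (x, y) ^+ 2) =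
    \int[nu]_y (g (mul_step (x, y)) ^+ 2 - (2 * c * g (mul_step (x, y)) - c ^+ 2)).
  by apply: eq_Rintegral => y _; rewrite /increment -/c; ring.
have b1 := bounded_mfunM (bgx x) (bgx x).
have b2 := bounded_mfunZ (2 * c) (bgx x).
rewrite (expectB nu b1 (bounded_mfunB b2 (bounded_mfun_cst _))).
rewrite (expectB nu b2 (bounded_mfun_cst _)) expect_cst (expectZ nu _ (bgx x)).
rewrite -/(U g x) -/c -/(U (fun y => g y ^+ 2) x); ring.
Qed.

Lemma almost_holder_cond_var : almost_holder d p (cond_var nu (increment f)).
Proof.
have -> : cond_var nu (increment f) = (fun x => U (fun y => g y ^+ 2) x - U g x ^+ 2).
  by apply/funext => x; exact: cond_var_increment.
have [_ [B gB]] := bounded_mfun_potential.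
have [_ [B' gB']] := bounded_mfun_markov_potential.
have am u : almost_holder d p u -> almost_holder d p (U u).
  by move=> hu; exact: (almost_holder_markov G_compact nu dmetric dinv dmetrizes p0).
apply: almost_holderB; first exact/am/(almost_holder_sqr gB).
exact/(almost_holder_sqr gB')/am.
Qed.

Lemma limit_variance_ge0 : 0 <= limit_variance f.
Proof.
have [C phiC] := bounded_mfun_increment.2.
have bh := bounded_mfun_cond_var nu bounded_mfun_increment.1 phiC.
rewrite -(expect_cst mu 0); apply: (expect_le mu (bounded_mfun_cst 0) bh) => x.
rewrite -(expect_cst nu 0); apply: (expect_le nu (bounded_mfun_cst 0)) => [|y]; last exact: sqr_ge0.
have b1 := bounded_mfun_section x bounded_mfun_increment.
exact: (bounded_mfunM b1 b1).
Qed.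

Lemma sum_var_increment (e : R) : 0 < e -> exists2 m, (0 < m)%N &
  forall x, `|sum_var nu mul_step (increment f) m x - m%:R * limit_variance f| <= e * m%:R.
Proof.
apply: (sum_var_average mstep bounded_mfun_increment) => {}e.
exact: (markov_equidistribution G_compact mu_haar dmetric dinv dmetrizes p0 W_summable almost_holder_cond_var).
Qed.

End variance.

(** * The limit theorems for the random walk *)

Section limsup_of_bounds.
Context {R : realType}.

Lemma lil_norm_ge (A : R) : exists N, forall n, (N <= n)%N -> A <= lil_norm n%:R.
Proof.
pose T := expR (expR 1) + A ^+ 2 :> R.
exists (Num.truncn T).+1 => n Nn.
have nT : T <= n%:R.
  by rewrite (le_trans (ltW (truncnS_gt T)))// ler_nat.
have T0 : 0 < expR (expR 1) :> R by exact: expR_gt0.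
have A0 : 0 <= A ^+ 2 by exact: sqr_ge0.
have n0 : 0 < n%:R :> R by rewrite (lt_le_trans T0)// (le_trans _ nT)// lerDl.
have ee : expR 1 <= ln n%:R :> R.
  by rewrite -[leLHS](@expRK R) ler_ln ?posrE// (le_trans _ nT)// lerDl.
have l1 : 1 <= ln (ln n%:R) :> R.
  by rewrite -[leLHS](@expRK R) ler_ln ?posrE ?expR_gt0// (lt_le_trans (expR_gt0 1)).
apply: (le_trans (ler_norm A)); rewrite -sqrtr_sqr ler_wsqrtr//.
have h1 : n%:R <= 2 * n%:R * ln (ln n%:R) :> R.
  by rewrite -mulrA mulrCA ler_peMr ?ltW//; lra.
by rewrite (le_trans _ h1)// (le_trans _ nT)// lerDr ltW.
Qed.

Lemma limn_esup_of_bounds (u : R^nat) (l : R) :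
  (forall e : R, 0 < e -> exists N, forall n, (N <= n)%N -> u n <= l + e) ->
  (forall e : R, 0 < e -> forall N, exists2 n, (N <= n)%N & l - e <= u n) ->
  limn_esup (fun n => (u n)%:E) = l%:E.
Proof.
move=> ub lb; rewrite limn_esup_lim (cvg_lim _ (@cvg_esups_inf R _))//.
apply/eqP; rewrite eq_le; apply/andP; split.
  apply/lee_addgt0Pr => e e0; have [N HN] := ub e e0.
  apply: ge_ereal_inf; exists (esups (fun n => (u n)%:E) N); first by exists N.
  by apply: ub_ereal_sup => _ [n /= Nn <-]; rewrite lee_fin; exact: HN.
apply: le_ereal_inf_tmp => _ [N _ <-].
apply/lee_addgt0Pr => e e0; have [n Nn Hn] := lb e e0 N.
rewrite -leeBlDr//; apply: (@le_trans _ _ (u n)%:E); first by rewrite lee_fin.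
by apply: ereal_sup_ubound; exists n.
Qed.

(** The norming tends to infinity, so a bounded perturbation disappears in the
    limit; the levels [s +- 1 / (k + 1)] are the countably many at which almost sure
    bounds have been established. *)
Lemma limsup_perturbation (M rem : R^nat) (s K : R) : (forall n, `|rem n| <= K) ->
  (forall k : nat, exists N, forall n, (N <= n)%N -> M n <= (s + k.+1%:R^-1) * lil_norm n%:R) ->
  (forall k : nat, forall N, exists2 n, (N <= n)%N & (s - k.+1%:R^-1) * lil_norm n%:R <= M n) ->
  limn_esup (fun n => ((M n + rem n) / lil_norm n%:R)%:E) = s%:E.
Proof.
move=> remK ub lb.
have inv_small (e : R) : 0 < e -> exists k : nat, k.+1%:R^-1 <= e.
  move=> e0; exists (Num.truncn e^-1); rewrite invf_ple ?posrE//.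
  exact: ltW (truncnS_gt _).
have rem_small (e : R) : 0 < e -> exists N, forall n, (N <= n)%N ->
    0 < lil_norm n%:R :> R /\ `|rem n| <= e * lil_norm n%:R.
  move=> e0; have [N1 H1] := lil_norm_ge (K / e); have [N2 H2] := lil_norm_ge 1.
  exists (maxn N1 N2) => n; rewrite geq_max => /andP[/H1 h1 /H2 h2].
  split; first exact: lt_le_trans h2.
  by rewrite (le_trans (remK n))// mulrC -ler_pdivrMr.
apply: limn_esup_of_bounds => e e0; have e20 : 0 < e / 2 by rewrite divr_gt0.
  have [k ke] := inv_small _ e20; have [N1 H1] := ub k; have [N2 H2] := rem_small _ e20.
  exists (maxn N1 N2) => n; rewrite geq_max => /andP[/H1 h1 /H2[l0 h2]].
  rewrite ler_pdivrMr//.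
  have h3 := ler_norm (rem n).
  have h4 := ler_wpM2r (ltW l0) ke; move: (k.+1%:R^-1) h1 h4 => c h1 h4.
  by lra.
move=> N; have [k ke] := inv_small _ e20; have [N2 H2] := rem_small _ e20.
have [n] := lb k (maxn N N2); rewrite geq_max => /andP[Nn /H2[l0 h2]] h1.
exists n => //; rewrite ler_pdivlMr//.
have h3 := ler_norm (- rem n); rewrite normrN in h3.
have h4 := ler_wpM2r (ltW l0) ke; move: (k.+1%:R^-1) h1 h4 => c h1 h4.
by lra.
Qed.

End limsup_of_bounds.

Section random_walk.
Context {R : realType} {G : topologicalGroupType}.
Context {dO : measure_display} {Omega : measurableType dO}.
Variables (P : probability Omega R) (X : nat -> {RV P >-> borel G}).
Variables (nu : probability (borel G) R) (f : G -> R).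

Lemma state_random_walk n w : state mul_step X 1%g n w = random_walk X n w.
Proof.
elim: n => [|n IH]; first by rewrite /random_walk big_geq.
by rewrite /= IH /random_walk big_nat_recr.
Qed.

(** The Poisson equation summed along the walk: the terms [U g] at consecutive
    positions telescope. *)
Lemma walk_sum_martingale n w :
  (forall x, potential nu f x - markov nu mul_step (potential nu f) x = f x) ->
  walk_sum f X n w = martingale mul_step (increment nu f) X 1%g n w +
    (markov nu mul_step (potential nu f) 1%g -
     markov nu mul_step (potential nu f) (state mul_step X 1%g n w)).
Proof.
move=> poisson; elim: n => [|n IH].
  by rewrite /walk_sum big_geq// /martingale big_geq// subrr addr0.
rewrite /walk_sum big_nat_recr//= -/(walk_sum f X n w) IH martingaleS /increment/=.
rewrite -state_random_walk -poisson /=; ring.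
Qed.

End random_walk.

Theorem theorem1 (R : realType) (G : topologicalGroupType)
    (G_compact : compact [set: G]) (G_hausdorff : hausdorff_space G)
    (G_countable : @second_countable G)
    (mu : probability (borel G) R) (mu_haar : normalized_haar mu)
    (nu : probability (borel G) R) (f : G -> R) :
  exists2 sigma : R, 0 <= sigma &
    forall (d : G -> G -> R) (p : R),
      is_metric d -> bi_invariant d -> metrizes d -> 0 < p <= 1 ->
      (\sum_(1 <= k <oo) wasserstein d p (convolution_pow G_countable nu k) mu
        < +oo)%E ->
      holder d p f -> (\int[mu]_x (f x)%:E = 0)%E ->
    forall (dO : measure_display) (Omega : measurableType dO)
      (P : probability Omega R) (X : nat -> {RV P >-> borel G}),
      iid X nu ->
      cvg_in_distribution P
        (fun N w => walk_sum f X N w / Num.sqrt N%:R) (centered_normal sigma) /\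
      {ae P, forall w,
        limn_esup (fun N =>
          (walk_sum f X N w / Num.sqrt (2 * N%:R * ln (ln N%:R)))%:E)
        = sigma%:E}.
Proof.
(* This value is fixed before [d] and [p] are introduced. *)
exists (Num.sqrt (limit_variance mu nu f)); first exact: sqrtr_ge0.
move=> d p dmetric dinv dmetrizes /andP[p0 _] W_summable hf fmu0 dO Omega P X iidX.
have f0 : \int[mu]_x f x = 0 by rewrite /Rintegral fmu0.
have poisson := poisson_equation G_compact mu_haar dmetric dinv dmetrizes p0 W_summable hf f0.
have mstep := measurable_mul_step G_countable.
have [mphi [C phiC]] := bounded_mfun_increment G_compact mu_haar dmetric dinv dmetrizes p0 W_summable hf f0.
have phi0 := increment_centered G_compact mu_haar dmetric dinv dmetrizes p0 W_summable hf f0.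
have s20 := limit_variance_ge0 G_compact mu_haar dmetric dinv dmetrizes p0 W_summable hf f0.
have svar := sum_var_increment G_compact mu_haar dmetric dinv dmetrizes p0 W_summable hf f0.
have [mUg [B UgB]] := bounded_mfun_markov_potential G_compact mu_haar dmetric dinv dmetrizes p0 W_summable hf f0.
pose Ug := markov nu mul_step (potential nu f).
pose rem n w := Ug 1%g - Ug (state mul_step X 1%g n w).
have remB n w : `|rem n w| <= B + B.
  by apply: (le_trans (ler_normB _ _)); apply: lerD; exact: UgB.
have mrem n : measurable_fun setT (rem n).
  apply: measurable_funB => //; apply: (measurableT_comp mUg).
  exact: (measurable_past (measurable_state mstep (X := X) 1%g (n := n))).
have walkE n w : walk_sum f X n w = martingale mul_step (increment nu f) X 1%g n w + rem n w.
  exact: walk_sum_martingale.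
split.
  have -> : (fun N w => walk_sum f X N w / Num.sqrt N%:R) = (fun n w =>
      (martingale mul_step (increment nu f) X 1%g n w + rem n w) / Num.sqrt n%:R).
    by apply/funext => n; apply/funext => w; rewrite walkE.
  exact: (clt_martingale mstep mphi phiC phi0 s20 svar iidX 1%g mrem remB).
set sigma := Num.sqrt _ in svar *.
have up : {ae P, forall w, forall k : nat, exists N, forall n, (N <= n)%N ->
    martingale mul_step (increment nu f) X 1%g n w <=
    (sigma + k.+1%:R^-1) * lil_norm n%:R}.
  apply: ae_foralln => k.
  by apply: (lil_upper mstep mphi phiC phi0 s20 svar iidX); rewrite ltrDl invr_gt0.
have low : {ae P, forall w, forall k : nat, forall N, exists2 n, (N <= n)%N &
    (sigma - k.+1%:R^-1) * lil_norm n%:R <=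
    martingale mul_step (increment nu f) X 1%g n w}.
  apply: ae_foralln => k.
  by apply: (lil_lower mstep mphi phiC phi0 s20 svar iidX); rewrite ltrBlDr ltrDl invr_gt0.
apply: filterS2 up low => w up low.
rewrite (_ : (fun N : nat => _) = (fun n : nat =>
    ((martingale mul_step (increment nu f) X 1%g n w + rem n w) / lil_norm n%:R)%:E)).
  by apply: (limsup_perturbation _ up low) => n; exact: remB.
by apply/funext => n; rewrite walkE.
Qed.
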